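(* Assume (A1), (A4) and (A5) below. Then for all $D\ge0$ and $P\ge0$, $$\tilde R_{\mathrm{cr}}(D,P)=R(D,P).$$ (A1) For each $\mu$, the map $\nu\mapsto d(\mu,\nu)$ is convex. (A4) Tensorizability: for all $n$ and all $p_{Y_1},\dots,p_{Y_n}\in\mathcal P(\mathcal X)$ and $p_{\hat Y^n}\in\mathcal P(\mathcal X^n)$ with marginals $p_{\hat Y_t}$, $$d\Big(\otimes_{t=1}^np_{Y_t},\,p_{\hat Y^n}\Big)\ge\sum_{t=1}^nd(p_{Y_t},p_{\hat Y_t}).$$ (A5) Decomposability: for all $n$ and all $p_{Y_t},p_{\hat Y_t}\in\mathcal P(\mathcal X)$, $$d\Big(\otimes_{t=1}^np_{Y_t},\,\otimes_{t=1}^np_{\hat Y_t}\Big)=\sum_{t=1}^nd(p_{Y_t},p_{\hat Y_t}).$$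
   Context: Let $\mathcal X$ be a Polish metric space with its Borel $\sigma$-algebra, and let $\mathcal P(\mathcal X)$ be the set of Borel probability measures on $\mathcal X$. Let $X\sim p_X\in\mathcal P(\mathcal X)$, and let $\{X_t\}_{t\ge1}$ be i.i.d. with marginal $p_X$. Let $\Delta:\mathcal X\times\mathcal X\to[0,\infty)$ be a measurable distortion function with $\Delta(x,\hat x)=0$ iff $x=\hat x$. For each $n\ge1$, $d:\mathcal P(\mathcal X^n)\times\mathcal P(\mathcal X^n)\to[0,\infty]$ is a divergence with $d(\mu,\nu)=0$ iff $\mu=\nu$; the same symbol $d$ is used for every $n$. The rate-distortion-perception function is $$R(D,P):=\inf I(X;\hat X),$$ where the infimum is over Markov kernels $p_{\hat X|X}$ from $\mathcal X$ to $\mathcal X$ with $\mathbb E[\Delta(X,\hat X)]\le D$ and $d(p_X,p_{\hat X})\le P$. Operational definition. A rate $\tilde R$ is achievable with common randomness under the multiletter perception constraint if, for all sufficiently large $n$, there exist: - a distribution $p_Q$ on a Polish space; - an encoder kernel $p_{Z|X^nQ}$ with $Z$ taking values in a countable set; - a decoder kernel $p_{\hat X^n|ZQ}$ with $\hat X^n\in\mathcal X^n$; such that, under $p_X^np_Qp_{Z|X^nQ}p_{\hat X^n|ZQ}$, the following hold: - $\frac1nH(Z|Q)\le\tilde R$; - $\frac1n\sum_{t=1}^n\mathbb E[\Delta(X_t,\hat X_t)]\le D$; - $\frac1nd(p_X^n,p_{\hat X^n})\le P$. $\tilde R_{\mathrm{cr}}(D,P)$ is the infimum of such $\tilde R$.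 *)

(* Defs.v *)
From HB Require Import structures.
From mathcomp Require Import all_boot all_order all_algebra.
From mathcomp Require Import all_classical all_reals all_analysis measurable_realfun.

Set Implicit Arguments.
Unset Strict Implicit.
Unset Printing Implicit Defensive.

Import Order.TTheory GRing.Theory Num.Theory.

Local Open Scope classical_set_scope.
Local Open Scope ring_scope.

(* A (nonempty) metric space: pointedness is harmless since every space
   considered carries a probability measure. *)
#[short(type="pmetricType")]
HB.structure Definition PointedMetric (K : numDomainType) :=
  { M of Pointed M & Metric K M }.

Definition polish {R : realType} (X : pmetricType R) : Prop :=
  (forall F : set_system X, ProperFilter F -> cauchy F -> cvg F) /\
  (exists S : set X, countable S /\ dense S).

Definition borelT {R : realType} (X : pmetricType R) := g_sigma_algebraType (@open X).

Local Open Scope ereal_scope.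

Section defs.
Context {R : realType}.

Definition meq {d} {T : measurableType d} (mu nu : set T -> \bar R) : Prop :=
  forall A, measurable A -> mu A = nu A.

(* P is the product measure of the mus on n.-tuple T (product sigma-algebra);
   this characterizes the product measure uniquely (rectangles). *)
Definition is_prodn {d} {T : measurableType d} (n : nat)
  (mus : 'I_n -> probability T R) (P : probability (n.-tuple T) R) : Prop :=
  forall A : 'I_n -> set T, (forall i, measurable (A i)) ->
    P [set x | forall i, A i (tnth x i)] = (\prod_(i < n) fine (mus i (A i)))%R%:E.

Definition is_marg {d} {T : measurableType d} (n : nat)
  (P : probability (n.-tuple T) R) (t : 'I_n) (mu : probability T R) : Prop :=
  forall A, measurable A -> mu A = P [set x | A (tnth x t)].

Definition is_divergence {d} {T : measurableType d}
  (dv : probability T R -> probability T R -> \bar R) : Prop :=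
  (forall mu nu : probability T R, 0 <= dv mu nu) /\
  (forall mu nu : probability T R, dv mu nu = 0 <-> meq mu nu) /\
  (forall mu mu' nu nu' : probability T R, meq mu mu' -> meq nu nu' -> dv mu nu = dv mu' nu').

Definition convex_snd {d} {T : measurableType d}
  (dv : probability T R -> probability T R -> \bar R) : Prop :=
  forall (mu nu1 nu2 nu : probability T R) (l : R), (0 <= l <= 1)%R ->
    meq nu (fun A => l%:E * nu1 A + (1 - l)%:E * nu2 A) ->
    dv mu nu <= l%:E * dv mu nu1 + (1 - l)%:E * dv mu nu2.

Definition markov_kernel {d1 d2} {T1 : measurableType d1} {T2 : measurableType d2}
  (k : T1 -> probability T2 R) : Prop :=
  forall A, measurable A -> measurable_fun setT (fun x => k x A).

(* Relative entropy of set functions P, Q on a measurable space, defined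
   (Gelfand--Kolmogorov--Yaglom--Dobrushin) as the supremum over finite
   measurable partitions of sum P(A) ln (P(A)/Q(A)), with 0 ln(0/q) = 0 and
   p ln(p/0) = +oo for p > 0. *)
Definition kl_term (p q : \bar R) : \bar R :=
  if fine p == 0%R then 0
  else if fine q == 0%R then +oo
  else (fine p * ln (fine p / fine q))%:E.

Definition KL {d} {T : measurableType d} (P Q : set T -> \bar R) : \bar R :=
  ereal_sup [set s | exists (k : nat) (A : 'I_k -> set T),
    (forall i, measurable (A i)) /\
    (forall i j, i != j -> A i `&` A j = set0) /\
    \big[setU/set0]_(i < k) A i = setT /\
    s = \sum_(i < k) kl_term (P (A i)) (Q (A i))].

Definition mutual_info {d} {T : measurableType d}
  (pX : probability T R) (k : T -> probability T R) : \bar R :=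
  let joint := fun C : set (T * T) => \int[pX]_x k x [set y | C (x, y)] in
  let pXh := fun B : set T => \int[pX]_x k x B in
  let prod := fun C : set (T * T) => \int[pX]_x pXh [set y | C (x, y)] in
  KL joint prod.

Definition RDP {d} {T : measurableType d} (pX : probability T R)
  (Delta : T -> T -> R) (dX : probability T R -> probability T R -> \bar R)
  (D P : R) : \bar R :=
  ereal_inf [set mutual_info pX k | k in
    [set k | markov_kernel k /\
      \int[pX]_x \int[k x]_y (Delta x y)%:E <= D%:E /\
      exists pXh : probability T R,
        meq pXh (fun B => \int[pX]_x k x B) /\ dX pX pXh <= P%:E]].

(* Binary entropy summand -p ln p (with ln 0 = 0 convention giving 0). *)
Definition negplogp (p : \bar R) : \bar R := (- fine p * ln (fine p))%:E.

(* Achievability with common randomness under the multiletter perception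
   constraint.  Z takes values in nat (any countable set can be injected). *)
Definition achievable_cr {d} {T : measurableType d} (pX : probability T R)
  (Delta : T -> T -> R)
  (dn : forall n, probability (n.-tuple T) R -> probability (n.-tuple T) R -> \bar R)
  (D P Rt : R) : Prop :=
  exists N : nat, forall n : nat, (N <= n)%N ->
  forall pXn : probability (n.-tuple T) R, is_prodn (fun _ => pX) pXn ->
  exists (Q : pmetricType R), polish Q /\
  exists (pQ : probability (borelT Q) R)
         (enc : nat -> (n.-tuple T * borelT Q) -> R)
         (dec : nat -> borelT Q -> probability (n.-tuple T) R),
    (forall z, measurable_fun setT (enc z)) /\
    (forall z xq, (0 <= enc z xq)%R) /\
    (forall xq, \sum_(0 <= z <oo) (enc z xq)%:E = 1) /\
    (forall z, markov_kernel (dec z)) /\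
    (* (1/n) H(Z|Q) <= Rt, with p(z|q) = int p(z|x^n,q) dp_X^n(x^n) *)
    (n%:R^-1)%:E * \int[pQ]_q
        (\sum_(0 <= z <oo) negplogp (\int[pXn]_x (enc z (x, q))%:E))
      <= Rt%:E /\
    (n%:R^-1)%:E * (\sum_(t < n)
       \int[pXn]_x \int[pQ]_q \sum_(0 <= z <oo)
          ((enc z (x, q))%:E * \int[dec z q]_y (Delta (tnth x t) (tnth y t))%:E))
      <= D%:E /\
    exists pXhn : probability (n.-tuple T) R,
      meq pXhn (fun B => \int[pXn]_x \int[pQ]_q \sum_(0 <= z <oo)
                            ((enc z (x, q))%:E * dec z q B)) /\
      (n%:R^-1)%:E * dn n pXn pXhn <= P%:E.

Definition Rcr {d} {T : measurableType d} (pX : probability T R)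
  (Delta : T -> T -> R)
  (dn : forall n, probability (n.-tuple T) R -> probability (n.-tuple T) R -> \bar R)
  (D P : R) : \bar R :=
  ereal_inf [set Rt%:E | Rt in [set Rt | achievable_cr pX Delta dn D P Rt]].

End defs.

(* Main.v *)
(* Converse.  Averaging the coordinates of a code of length n gives a single-letter kernel; it
   meets the distortion constraint by linearity and the perception constraint by (A4) and
   convexity.  Its mutual information is bounded through the variational formula for relative
   entropy: for a bounded likelihood ratio u on single letters, the product of the u (x_t, y_t)
   has p_X^n-mean 1 for every y^n, and averaging it against p(z | x^n, q) <= 1 yields - p ln p
   by Jensen's inequality, so that the average log-likelihood is at most H(Z | Q) / n.

   Achievability.  The product of an almost optimal test channel is simulated exactly, so the
   output is i.i.d. and (A5) gives the perception constraint with equality.  The density of the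
   channel with respect to its output law is rounded up to levels e^(delta l - b); the encoder
   first draws the level, which bounds the density, and then performs rejection sampling on an
   i.i.d. codebook shared through Q.  The index of the accepted sample has mean about the bound
   on the density and costs its logarithm, up to a constant, so the rate per letter exceeds the
   mutual information by an arbitrarily small amount for long blocks.  All codebooks are
   functions of one uniform variable on the real line, by binary expansion. *)

Require Import Defs.
From HB Require Import structures.
From mathcomp Require Import all_boot all_order all_algebra.
From mathcomp Require Import all_classical all_reals all_analysis measurable_realfun.
From mathcomp Require Import ring lra.

Set Implicit Arguments.
Unset Strict Implicit.
Unset Printing Implicit Defensive.

Import Order.TTheory GRing.Theory Num.Theory.
Import numFieldNormedType.Exports.
Local Open Scope classical_set_scope.
Local Open Scope ring_scope.
Local Open Scope ereal_scope.

(** * Kernels and product measures *)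

(** No continuity of the divergence is assumed, so an output law merely close to the i.i.d. one
    could violate the perception constraint; hence the simulation must be exact. Rejection sampling
    needs a bounded density, which finite mutual information does not give; hence the random level.
    One level is drawn per block, not per letter, so that the constant cost of describing it is
    divided by n. The message entropy is never computed: Gibbs' inequality compares it with explicit
    weights of total mass at most 2, built so that their cost is affine in the level and in the
    sample index. The converse uses neither a chain rule nor conditional laws given a coordinate:
    when one input letter is fixed, the others are drawn afresh. Relative entropy, a supremum over
    finite partitions, is handled in both directions through its dual form sum p a - sum q e^a + 1,
    with the tangent inequality ln t <= t - 1. Logarithms change sign, so constants ([c], [C],
    [kap]) are added to keep integrands nonnegative, and Tonelli and monotone convergence then apply
    without integrability conditions. *)

Definition prob_of {R : realType} {d} {T : measurableType d}
  (m : {measure set T -> \bar R}) (m1 : m setT = 1) : set T -> \bar R := m.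

HB.instance Definition _ {R : realType} {d} {T : measurableType d}
  (m : {measure set T -> \bar R}) (m1 : m setT = 1) :=
  Measure.on (prob_of m1).

HB.instance Definition _ {R : realType} {d} {T : measurableType d}
  (m : {measure set T -> \bar R}) (m1 : m setT = 1) :=
  Measure_isProbability.Build _ _ _ (prob_of m1) m1.

Lemma probability_of_measure {R : realType} {d} {T : measurableType d}
    (m : {measure set T -> \bar R}) :
  m setT = 1 -> exists p : probability T R, forall A, p A = m A.
Proof. by move=> m1; exists (prob_of m1). Qed.


(** The hypothesis is an argument, as in [prob_of], so that the structures registered below can
    recover it from the term. This turns the predicate [markov_kernel] back into a bundled
    kernel. *)
Definition kernel_of {R : realType} {d1 d2} {T1 : measurableType d1}
    {T2 : measurableType d2} (k : T1 -> probability T2 R)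
    (hk : markov_kernel k) : T1 -> {measure set T2 -> \bar R} := k.

HB.instance Definition _ {R : realType} {d1 d2} {T1 : measurableType d1}
    {T2 : measurableType d2} (k : T1 -> probability T2 R)
    (hk : markov_kernel k) := isKernel.Build _ _ T1 T2 R (kernel_of hk) hk.

HB.instance Definition _ {R : realType} {d1 d2} {T1 : measurableType d1}
    {T2 : measurableType d2} (k : T1 -> probability T2 R)
    (hk : markov_kernel k) := Kernel_isProbability.Build _ _ T1 T2 R
      (kernel_of hk) (fun x => probability_setT (k x)).

Lemma markov_integral_measurable {R : realType} {d1 d2} {T1 : measurableType d1}
    {T2 : measurableType d2} (k : T1 -> probability T2 R)
    (g : T1 * T2 -> \bar R) : markov_kernel k ->
  (forall z, 0 <= g z) -> measurable_fun setT g ->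
  measurable_fun setT (fun x => \int[k x]_y g (x, y)).
Proof.
move=> hk g0 mg.
exact: (measurable_fun_integral_sfinite_kernel g (kernel_of hk)).
Qed.

Lemma markov_comp {R : realType} {d1 d2 d3} {X : measurableType d1}
    {Y : measurableType d2} {Z : measurableType d3}
    (l : X -> probability Y R) (k : X * Y -> probability Z R) :
  markov_kernel l -> markov_kernel k ->
  exists m : X -> probability Z R, markov_kernel m /\
    (forall x B, measurable B -> m x B = \int[l x]_y k (x, y) B) /\
    forall x (g : Z -> \bar R), (forall z, 0 <= g z) -> measurable_fun setT g ->
      \int[m x]_z g z = \int[l x]_y \int[k (x, y)]_z g z.
Proof.
move=> hl hk.
have mT x : mkcomp (kernel_of hl) (kernel_of hk) x setT = 1.
  transitivity (\int[l x]_y k (x, y) setT); first by [].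
  rewrite (eq_integral (cst 1)) => [|y _]; last exact: probability_setT.
  by rewrite integral_cst// mul1e; exact: probability_setT.
have /choice[m hm] : forall x, exists p : probability Z R,
    forall A, p A = mkcomp (kernel_of hl) (kernel_of hk) x A.
  by move=> x; exact: (probability_of_measure (mT x)).
have me x B : measurable B -> m x B = \int[l x]_y k (x, y) B.
  by rewrite hm.
exists m; split; last split => //.
  move=> A mA; under eq_fun do rewrite hm.
  exact: measurable_kernel.
move=> x g g0 mg.
rewrite -(integral_kcomp (kernel_of hl) (kernel_of hk))//.
by apply: eq_measure_integral => A mA _; exact: hm.
Qed.

Lemma markov_cst {R : realType} {d1 d2} {X : measurableType d1}
    {Y : measurableType d2} (p : probability Y R) :
  markov_kernel (fun _ : X => p).
Proof. by move=> A mA; exact: measurable_cst. Qed.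

Lemma probability_bind {R : realType} {d2 d3}
    {Y : measurableType d2} {Z : measurableType d3}
    (nu : probability Y R) (k : Y -> probability Z R) :
  markov_kernel k ->
  exists m : probability Z R,
    (forall B, measurable B -> m B = \int[nu]_y k y B) /\
    forall g : Z -> \bar R, (forall z, 0 <= g z) -> measurable_fun setT g ->
      \int[m]_z g z = \int[nu]_y \int[k y]_z g z.
Proof.
move=> hk.
(* A measure is a kernel from the one-point space, so composition of kernels applies. *)
have hk' : markov_kernel (fun xy : unit * Y => k xy.2).
  move=> A mA.
  exact: (measurableT_comp (hk A mA) measurable_snd).
have [m [_ [mB mg]]] := markov_comp (@markov_cst _ _ _ unit _ nu) hk'.
by exists (m tt); split => [B mBB|g g0 mgg]; [exact: mB|exact: mg].
Qed.

(** Used twice: for the message of a code, with the encoder probabilities as weights, and for the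
    uniform average over coordinates. *)
Lemma markov_mixture {R : realType} {d1 d2} {X : measurableType d1}
    {Z : measurableType d2} (w : nat -> X -> R) (k : nat -> X -> probability Z R) :
  (forall z, measurable_fun setT (w z)) -> (forall z x, (0 <= w z x)%R) ->
  (forall x, \sum_(0 <= z <oo) (w z x)%:E = 1) ->
  (forall z, markov_kernel (k z)) ->
  exists m : X -> probability Z R, markov_kernel m /\
    (forall x B, measurable B ->
       m x B = \sum_(0 <= z <oo) ((w z x)%:E * k z x B)) /\
    forall x (g : Z -> \bar R), (forall z, 0 <= g z) -> measurable_fun setT g ->
      \int[m x]_z g z = \sum_(0 <= z <oo) ((w z x)%:E * \int[k z x]_y g y).
Proof.
move=> mw w0 w1 hk.
pose s x : {measure set Z -> \bar R} :=
  mseries (fun z => mscale (NngNum (w0 z x)) (k z x)) 0.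
have sE x A : s x A = \sum_(0 <= z <oo) ((w z x)%:E * k z x A) by [].
have sT x : s x setT = 1.
  rewrite sE -(w1 x); apply: eq_eseriesr => z _.
  by rewrite (probability_setT (k z x)) mule1.
have /choice[m hm] : forall x, exists p : probability Z R, forall A, p A = s x A.
  by move=> x; exact: (probability_of_measure (sT x)).
exists m; split; last split.
- move=> A mA; under eq_fun do rewrite hm sE.
  apply: ge0_emeasurable_sum => [z x _ _|z _].
    by rewrite mule_ge0// lee_fin.
  apply: emeasurable_funM; last exact: hk.
  by apply/measurable_EFinP.
- by move=> x B _; rewrite hm sE.
- move=> x g g0 mg.
  rewrite (eq_measure_integral (s x)); last by move=> A mA _; exact: hm.
  rewrite ge0_integral_measure_series//.
  by apply: eq_eseriesr => z _; rewrite ge0_integral_mscale.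
Qed.

Lemma measurable_rect {d} {T : measurableType d} n (A : 'I_n -> set T) :
  (forall i, measurable (A i)) ->
  measurable [set x : n.-tuple T | forall i, A i (tnth x i)].
Proof.
move=> mA.
rewrite (_ : [set x | _] =
  \big[setI/setT]_(i < n) ((fun x : n.-tuple T => tnth x i) @^-1` A i)).
  apply: bigsetI_measurable => i _; rewrite -[X in measurable X]setTI.
  exact: (@measurable_tnth _ T n i).
apply/seteqP; split => x /=.
  by move=> xA; rewrite -bigcap_seq => i _; exact: xA.
by rewrite -bigcap_seq => xA i; apply: xA => /=; exact: mem_index_enum.
Qed.

(** The product sigma-algebra comes with preimages of single coordinates as generators, which are
    not stable under intersection. Rectangles are, and so can feed the uniqueness theorem for
    measures. *)
Lemma tuple_rect_generated {d} {T : measurableType d} n :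
  @measurable _ (n.-tuple T) =
  <<s [set B | exists A : 'I_n -> set T, (forall i, measurable (A i)) /\
         B = [set x | forall i, A i (tnth x i)]] >>.
Proof.
apply/seteqP; split; last first.
  apply: smallest_sub; first exact: sigma_algebra_measurable.
  by move=> _ [A [mA ->]]; exact: measurable_rect.
apply: smallest_sub; first exact: smallest_sigma_algebra.
move=> B; rewrite -bigcup_seq => -[i /= _ [C mC <-]].
apply: sub_gen_smallest.
exists (fun j => if j == i then C else setT); split.
  by move=> j; case: ifP.
rewrite setTI; apply/seteqP; split => x /= Cx.
  by move=> j; case: eqP => // ->.
by have := Cx i; rewrite eqxx.
Qed.

Lemma tuple_probability_unique {R : realType} {d} {T : measurableType d} n
    (P Q : probability (n.-tuple T) R) :
  (forall A : 'I_n -> set T, (forall i, measurable (A i)) ->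
    P [set x | forall i, A i (tnth x i)] = Q [set x | forall i, A i (tnth x i)]) ->
  meq P Q.
Proof.
move=> PQ A mA.
apply: (measure_unique _ (fun _ => setT) (@tuple_rect_generated _ T n)) => //.
- move=> _ _ [A1 [mA1 ->]] [A2 [mA2 ->]].
  exists (fun i => A1 i `&` A2 i); split; first by move=> i; exact: measurableI.
  by apply/seteqP; split => x /=; [move=> [h1 h2] i|move=> h; split=> i; case: (h i)].
- move=> _; exists (fun _ => setT); split => //.
  by apply/seteqP; split.
- by rewrite bigcup_const.
- by move=> _ [A' [mA' ->]]; exact: PQ.
- by move=> _; rewrite (@le_lt_trans _ _ 1) ?ltry// probability_le1.
Qed.

Lemma is_prodn_unique {R : realType} {d} {T : measurableType d} n
    (mus : 'I_n -> probability T R) (P Q : probability (n.-tuple T) R) :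
  is_prodn mus P -> is_prodn mus Q -> meq P Q.
Proof.
by move=> hP hQ; apply: tuple_probability_unique => A mA; rewrite hP// hQ.
Qed.

Lemma meq_integral {R : realType} {d} {T : measurableType d}
    (P Q : probability T R) (g : T -> \bar R) :
  meq P Q -> \int[P]_x g x = \int[Q]_x g x.
Proof.
by move=> PQ; apply: eq_measure_integral => A mA _; rewrite [LHS]PQ.
Qed.

Lemma probability_pushforward {R : realType} {d1 d2} {S : measurableType d1}
    {T : measurableType d2} (P : probability S R) (f : S -> T) :
  measurable_fun setT f ->
  exists mu : probability T R, (forall A, mu A = P (f @^-1` A)) /\
    forall g : T -> \bar R, (forall z, 0 <= g z) -> measurable_fun setT g ->
      \int[mu]_z g z = \int[P]_x g (f x).
Proof.
move=> mf.
pose m := (pushforward P f : {measure set T -> \bar R}).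
have m1 : m mf setT = 1.
  by rewrite /m /= /pushforward preimage_setT probability_setT.
have [p hp] := probability_of_measure m1.
exists p; split; first by move=> A; rewrite hp.
move=> g g0 mg.
rewrite (eq_measure_integral (m mf)); last by move=> A mA _; exact: hp.
by rewrite ge0_integral_pushforward// => y _.
Qed.

Lemma marg_exists {R : realType} {d} {T : measurableType d} n
    (P : probability (n.-tuple T) R) t : exists mu, is_marg P t mu /\
  forall g : T -> \bar R, (forall z, 0 <= g z) -> measurable_fun setT g ->
     \int[mu]_z g z = \int[P]_x g (tnth x t).
Proof.
have [mu [muE mug]] := probability_pushforward P (@measurable_tnth _ T n t).
by exists mu; split => // A mA; rewrite muE.
Qed.

Lemma integral_indicT {R : realType} {d} {T : measurableType d}
    (mu : {measure set T -> \bar R}) (A : set T) :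
  measurable A -> \int[mu]_x (\1_A x)%:E = mu A.
Proof. by move=> mA; rewrite integral_indic// setIT. Qed.

Lemma integralZ_ge0 {R : realType} {d} {T : measurableType d}
    (mu : {measure set T -> \bar R}) (k : R) (f : T -> \bar R) :
  (0 <= k)%R -> (forall x, 0 <= f x) -> measurable_fun setT f ->
  \int[mu]_x (k%:E * f x) = k%:E * \int[mu]_x f x.
Proof. by move=> k0 f0 mf; rewrite ge0_integralZl. Qed.

Lemma emeasurable_indic {R : realType} {d} {T : measurableType d} (A : set T) :
  measurable A -> measurable_fun setT (fun x => (\1_A x)%:E : \bar R).
Proof. by move=> mA; apply/measurable_EFinP; exact: measurable_indic. Qed.

Lemma probability_integral_cst {R : realType} {d} {T : measurableType d}
    (P : probability T R) (c : \bar R) : \int[P]_x c = c.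
Proof.
by rewrite integral_cst// -[RHS]mule1; congr (_ * _); exact: probability_setT.
Qed.

(** * Standard spaces and shared randomness *)

Fixpoint bit_prefix (k : nat) (b : nat -> bool) : seq bool :=
  if k is k'.+1 then b k' :: bit_prefix k' b else [::].

Definition bit_cylinder (w : seq bool) : set (nat -> bool) :=
  [set b | bit_prefix (size w) b = w].

(** Cantor space. Two cylinders are nested or disjoint, so listing the empty set makes the
    generators stable under intersection. *)
Definition bit_space := g_sigma_algebraType
  [set B | B = set0 \/ exists w, B = bit_cylinder w].

Lemma size_bit_prefix k b : size (bit_prefix k b) = k.
Proof. by elim: k => //= k ->. Qed.

Lemma bit_prefix_drop k n b : bit_prefix k b = drop n (bit_prefix (n + k) b).
Proof. by elim: n => [|n IH]; rewrite ?drop0. Qed.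

Lemma bit_cylinder_setI v w :
  bit_cylinder v `&` bit_cylinder w = set0 \/
  exists u, bit_cylinder v `&` bit_cylinder w = bit_cylinder u.
Proof.
wlog vw : v w / (size v <= size w)%N => [H|].
  have [/H//|/ltnW/H] := leqP (size v) (size w).
  by rewrite setIC.
have [E|NE] := pselect (v = drop (size w - size v) w); [right|left].
  exists w; apply/seteqP; split => b /=; first by case.
  move=> bw; split => //; rewrite /bit_cylinder/=.
  by rewrite (bit_prefix_drop _ (size w - size v)) subnK// bw -E.
apply/seteqP; split => b //= -[bv bw]; apply: NE.
by rewrite -{1}bv (bit_prefix_drop _ (size w - size v)) subnK// bw.
Qed.

Lemma measurable_bit i : measurable ([set b | b i] : set bit_space).
Proof.
rewrite [X in measurable X](_ : _ =
  \bigcup_(w in [set w : seq bool | size w = i.+1 /\ head false w]) bit_cylinder w).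
  rewrite bigcup_mkcond; apply: countable_bigcupT_measurable => [|w]; first exact: countableP.
  case: ifPn => _ //; apply: sub_gen_smallest; right; by exists w.
apply/seteqP; split => b /=.
  by move=> bi; exists (bit_prefix i.+1 b); rewrite /bit_cylinder/= !size_bit_prefix.
by move=> [w [sw hw]]; rewrite /bit_cylinder/= sw => E; move: hw; rewrite -E.
Qed.

Lemma measurable_fun_bits {d} {T : measurableType d} (f : T -> bit_space) :
  (forall i, measurable [set x | f x i]) -> measurable_fun setT f.
Proof.
move=> mf; apply: (@measurability _ _ _ _ setT f
  [set B | B = set0 \/ exists w, B = bit_cylinder w]) => //.
move=> _ [_ [->|[w ->]] <-]; rewrite setTI; first by rewrite preimage_set0.
elim: w => [|b w IH].
  by rewrite (_ : _ @^-1` _ = setT)//; apply/seteqP.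
rewrite (_ : _ @^-1` _ = (f @^-1` bit_cylinder w) `&`
    (if b then [set x | f x (size w)] else ~` [set x | f x (size w)])).
  apply: measurableI => //; case: b => //; exact: measurableC.
apply/seteqP; split => x; rewrite /bit_cylinder/=.
  by move=> [<- ->]; split => //; case: ifPn => // /negP.
move=> [->]; case: b => [->//|/= /negP/negPf ->//].
Qed.

Section binary_expansion.
Context {R : realType} {d} {S : measurableType d}.
Variables (nu : probability S R) (E : nat -> set S).
Hypothesis mE : forall k, measurable (E k).

(** The itinerary of [s] through the sets [E k], which is the usual embedding in Cantor space when
    these sets separate points. *)
Definition set_bits (s : S) : bit_space := fun k => `[< E k s >].

Lemma measurable_set_bits : measurable_fun setT set_bits.
Proof.
apply: measurable_fun_bits => i.
rewrite (_ : [set x | _] = E i); first exact: mE.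
by apply/seteqP; split => s /= /asboolP.
Qed.

Definition bit_mass (w : seq bool) : R :=
  fine (nu (set_bits @^-1` bit_cylinder w)).

Lemma bit_massE w : (bit_mass w)%:E = nu (set_bits @^-1` bit_cylinder w).
Proof.
rewrite fineK// fin_num_measure// -[X in measurable X]setTI.
by apply: measurable_set_bits => //; apply: sub_gen_smallest; right; exists w.
Qed.

Lemma bit_mass_nil : bit_mass [::] = 1%R.
Proof.
apply: EFin_inj; rewrite bit_massE -(probability_setT nu); congr (nu _).
by apply/seteqP.
Qed.

Lemma bit_mass_ge0 w : (0 <= bit_mass w)%R.
Proof. exact: fine_ge0. Qed.

Lemma bit_mass_cons w :
  bit_mass w = (bit_mass (false :: w) + bit_mass (true :: w))%R.
Proof.
have mc v : measurable (set_bits @^-1` bit_cylinder v).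
  rewrite -[X in measurable X]setTI.
  by apply: measurable_set_bits => //; apply: sub_gen_smallest; right; exists v.
apply: EFin_inj; rewrite EFinD !bit_massE -measureU//; last first.
  apply/seteqP; split => // s; rewrite /bit_cylinder/= => -[[-> _] []//].
congr (nu _); apply/seteqP; split => s; rewrite /bit_cylinder/=.
  by move=> ->; case: (set_bits s _); [right|left].
by move=> [|] [].
Qed.

(* Words are read most recent bit first; the words of length [k] label
   consecutive subintervals [low w, low w + bit_mass w) of [0, 1). *)
Fixpoint bit_low (w : seq bool) : R :=
  if w is b :: w' then (bit_low w' + if b then bit_mass (false :: w') else 0)%R
  else 0%R.

(** Inverse transform sampling by successive splitting: the current interval is cut in proportion to
    the masses of its two extensions, and the new bit tells on which side of the cut [u] lies. *)
Fixpoint bit_word (k : nat) (u : R) : seq bool :=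
  if k is k'.+1 then
    (bit_low (bit_word k' u) + bit_mass (false :: bit_word k' u) <= u)%R
      :: bit_word k' u
  else [::].

Definition uniform_bits (u : R) : bit_space := fun k => head false (bit_word k.+1 u).

Lemma bit_prefix_uniform k u : bit_prefix k (uniform_bits u) = bit_word k u.
Proof. by elim: k => //= k ->. Qed.

Lemma bit_word_itv w u : (0 <= u < 1)%R ->
  bit_word (size w) u = w <-> (bit_low w <= u < bit_low w + bit_mass w)%R.
Proof.
move=> u01; elim: w => [|b w [IH1 IH2]] /=; first by rewrite bit_mass_nil add0r u01.
have m0 := bit_mass_ge0 (false :: w); have m1 := bit_mass_ge0 (true :: w).
have mE' := bit_mass_cons w.
split.
  move=> [bE wE]; move: bE; rewrite wE => <-.
  have /andP[l1 l2] := IH1 wE.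
have [c1|c2] := leP (bit_low w + bit_mass (false :: w))%R u.
    by rewrite c1 -addrA -mE'.
  by rewrite addr0 l1.
move=> /andP[l1 l2].
have wE : bit_word (size w) u = w.
  apply: IH2; apply/andP; split.
    by apply: le_trans l1; rewrite lerDl; case: b {l2}.
  apply: lt_le_trans l2 _; case: b {l1}.
    by rewrite -addrA -mE'.
  by rewrite /= addr0 lerD2l mE' lerDl.
rewrite wE; congr cons; case: b l1 l2 => [-> //|].
by rewrite addr0 => _; rewrite ltNge => /negPf.
Qed.

Lemma bit_low_itv w : (0 <= bit_low w /\ bit_low w + bit_mass w <= 1)%R.
Proof.
elim: w => [|b w [h0 h1]] /=; first by rewrite bit_mass_nil add0r.
have m0 := bit_mass_ge0 (false :: w); have m1 := bit_mass_ge0 (true :: w).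
have mE' := bit_mass_cons w.
case: b; split.
- by rewrite addr_ge0.
- by rewrite -addrA -mE'.
- by rewrite addr0.
- rewrite addr0; apply: le_trans h1; by rewrite lerD2l mE' lerDl.
Qed.


(** Both laws give a cylinder its [bit_mass], which is the length of the interval labelled by the
    word; cylinders are stable under intersection, so the laws coincide. *)
Lemma uniform_bits_law {d'} {U : measurableType d'} (lam : probability U R)
    (xi : U -> R) :
  (forall a, measurable [set u | (a <= xi u)%R]) ->
  (forall a b : R, (0 <= a)%R -> (a <= b)%R -> (b <= 1)%R ->
    lam [set u | (a <= xi u < b)%R] = (b - a)%:E) ->
  measurable_fun setT (uniform_bits \o xi : U -> bit_space) /\
  forall A : set bit_space, measurable A ->
    lam ((uniform_bits \o xi) @^-1` A) = nu (set_bits @^-1` A).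
Proof.
move=> mxi lamE.
have mword w : measurable [set u | bit_word (size w) (xi u) = w].
  elim: w => [|b w IH] /=.
    by rewrite (_ : [set u | _] = setT)//; apply/seteqP.
  set c := (bit_low w + bit_mass (false :: w))%R.
  rewrite (_ : [set u | _] = [set u | bit_word (size w) (xi u) = w] `&`
     (if b then [set u | (c <= xi u)%R] else ~` [set u | (c <= xi u)%R])).
    by apply: measurableI => //; case: b => //; exact: measurableC.
  apply/seteqP; split => u /=.
    move=> [<- wE]; split => //; rewrite wE -/c.
    by case: (boolP (c <= xi u)%R) => [//|/negP].
  move=> [wE]; rewrite wE -/c.
  by case: b => [->//|/= /negP/negPf ->].
have mbits : measurable_fun setT (uniform_bits \o xi : U -> bit_space).
  apply: measurable_fun_bits => i.
  rewrite (_ : [set x | _] = \bigcup_(w in [set w : seq bool | size w = i.+1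
      /\ head false w]) [set u | bit_word (size w) (xi u) = w]).
    rewrite bigcup_mkcond; apply: countable_bigcupT_measurable => [|w].
      exact: countableP.
    by case: ifPn.
  apply/seteqP; split => u /=.
    move=> h; have sz : size (bit_word i.+1 (xi u)) = i.+1.
      by rewrite -bit_prefix_uniform size_bit_prefix.
    by exists (bit_word i.+1 (xi u)) => //; rewrite /mkset sz.
  by move=> [w [sw hw]] /=; rewrite sw => wE; rewrite /uniform_bits wE.
split => // A mA.
have [p1 [p1E _]] := probability_pushforward lam mbits.
have [p2 [p2E _]] := probability_pushforward nu measurable_set_bits.
rewrite -p1E -p2E.
apply: (@measure_unique _ R bit_space
  [set B | B = set0 \/ exists w, B = bit_cylinder w] (fun _ => setT)
  _ _ _ _ p1 p2 _ _ A mA) => //.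
- move=> _ _ [->|[v ->]] [->|[w ->]].
  + by left; rewrite setI0.
  + by left; rewrite set0I.
  + by left; rewrite setI0.
  + have [->|[x ->]] := bit_cylinder_setI v w; first by left.
    by right; exists x.
- by move=> _; right; exists [::]; apply/seteqP.
- by rewrite bigcup_const.
- move=> _ [->|[w ->]]; first by rewrite !measure0.
  rewrite [LHS]p1E [RHS]p2E -bit_massE.
  have -> : (uniform_bits \o xi) @^-1` bit_cylinder w =
      [set u | bit_word (size w) (xi u) = w].
    by apply/seteqP; split => u; rewrite /bit_cylinder/= bit_prefix_uniform.
  have [l0 l1] := bit_low_itv w.
  have unitE : lam [set u | (0 <= xi u < 1)%R] = 1.
    by rewrite lamE// subr0.
  have m01 (a b : R) : measurable [set u | (a <= xi u < b)%R].
    rewrite (_ : [set u | _] = [set u | (a <= xi u)%R] `\` [set u | (b <= xi u)%R]).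
      exact: measurableD.
    apply/seteqP; split => u /=; first by move=> /andP[-> h]; rewrite leNgt h.
    by move=> [-> /negP]; rewrite -ltNge.
  (* The interval description of words is valid on [0, 1) only; this event has full mass. *)
  have eqw (W : set U) : measurable W ->
      lam W = lam (W `&` [set u | (0 <= xi u < 1)%R]).
    move=> mW; have {1}-> : W = (W `&` [set u | (0 <= xi u < 1)%R]) `|`
        (W `&` ~` [set u | (0 <= xi u < 1)%R]) by rewrite -setIUr setUv setIT.
    have mC := measurableC (m01 0%R 1%R).
    rewrite measureU//; [|exact: measurableI|exact: measurableI|].
      rewrite [X in _ + X](_ : _ = 0) ?adde0//.
      apply/eqP; rewrite eq_le measure_ge0 andbT.
      have <- : lam (~` [set u | (0 <= xi u < 1)%R]) = 0.
        by rewrite probability_setC// unitE subee.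
      by apply: le_measure; rewrite ?inE//; exact: measurableI.
    by rewrite setIACA setICr setI0.
  rewrite eqw//.
  have -> : [set u | bit_word (size w) (xi u) = w] `&` [set u | (0 <= xi u < 1)%R]
      = [set u | (bit_low w <= xi u < bit_low w + bit_mass w)%R].
    apply/seteqP; split => u /=; first by move=> [+ u01]; rewrite bit_word_itv.
    move=> h; have u01 : (0 <= xi u < 1)%R.
      case/andP: h => h1 h2; rewrite (le_trans l0 h1)/=.
      exact: lt_le_trans h2 l1.
    by split => //; apply/bit_word_itv.
  by rewrite lamE// ?lerDl ?bit_mass_ge0// addrC addKr.
- by move=> _; rewrite (@le_lt_trans _ _ 1) ?ltry// probability_le1.
Qed.

End binary_expansion.

(** Allows the real line to serve as the Polish space of the common randomness. *)
HB.instance Definition _ (R : realType) := Metric.on R^o.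

(* [S] is a measurable retract of the Cantor space; the section is given by the sets [E]. *)
Definition standard {d} (S : measurableType d) :=
  exists (E : nat -> set S) (G : bit_space -> S),
    [/\ forall k, measurable (E k), measurable_fun setT G &
        forall s, G (set_bits E s) = s].

Lemma measurable_bit_reindex (h : nat -> nat) :
  measurable_fun setT (fun b : bit_space => (fun i => b (h i)) : bit_space).
Proof. by apply: measurable_fun_bits => i; exact: (measurable_bit (h i)). Qed.

(** The bits are interleaved: even positions describe the first component, odd positions the
    second. *)
Lemma standard_prod {d1 d2} (S1 : measurableType d1) (S2 : measurableType d2) :
  standard S1 -> standard S2 -> standard (S1 * S2)%type.
Proof.
move=> [E1 [G1 [mE1 mG1 h1]]] [E2 [G2 [mE2 mG2 h2]]].
exists (fun k => if odd k then snd @^-1` E2 k./2 else fst @^-1` E1 k./2).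
exists (fun b => (G1 (fun i => b i.*2), G2 (fun i => b i.*2.+1))); split.
- move=> k; case: ifP => _; rewrite -[X in measurable X]setTI.
    exact: measurable_snd.
  exact: measurable_fst.
- apply/measurable_fun_pairP; split.
    exact: (measurableT_comp mG1 (measurable_bit_reindex double)).
  exact: (measurableT_comp mG2 (measurable_bit_reindex (fun i => i.*2.+1))).
- move=> [s1 s2]; congr pair; [rewrite -[RHS]h1|rewrite -[RHS]h2]; congr (_ _);
    apply/funext => i; rewrite /set_bits/=.
    by rewrite odd_double/= doubleK.
  by rewrite odd_double/= uphalf_double.
Qed.

Lemma polish_real (R : realType) : polish (R^o : pmetricType R).
Proof.
split; first by move=> F FF cF; exact: R_complete.
exists (range ratr); split; last exact: dense_rat.
by apply: sub_countable (card_image_le _ _) _; exact: countableP.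
Qed.

(** A point is coded by the small balls around a countable dense set that contain it. A code is read
    back as the unique point close to all its centers: completeness gives existence, vanishing radii
    give uniqueness. Codes that fail [Good], which no point produces, go to a default value. *)
Lemma polish_standard {R : realType} (X : pmetricType R) :
  polish X -> standard (borelT X).
Proof.
move=> [complX [D [/countable_injP[f finj] dD]]].
(* [s] enumerates [D] through the injection [f]; at indices outside the image it takes a default
   value. *)
pose s i : X := get [set x | D x /\ f x = i].
have sD x : D x -> s (f x) = x.
  move=> Dx; rewrite /s; case: xgetP => [y _ [Dy fE]|/(_ x)]; last by case.
  by apply: finj; rewrite ?inE.
have sdense (x : X) (e : R) : (0 < e)%R -> exists i, (mdist (s i) x < e)%R.
  move=> e0.
  have [y [/interior_subset yx Dy]] : (ball x e)° `&` D !=set0.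
    apply: dD; last exact: open_interior.
    by exists x; apply: nbhsx_ballx.
  exists (f y); rewrite sD// metric_sym.
  by move: yx; rewrite ballEmdist.
pose r m : R := (m.+1%:R^-1)%R.
have r0 m : (0 < r m)%R by rewrite /r invr_gt0 ltr0n.
have rsmall e : (0 < e)%R -> exists N, forall m, (N <= m)%N -> (r m < e)%R.
  move=> e0; exists (Num.trunc e^-1) => m Nm.
  rewrite /r -[ltRHS]invrK ltf_pV2 ?posrE ?invr_gt0 ?ltr0n//.
  apply: (lt_le_trans (truncnS_gt _)).
  by rewrite ler_nat ltnS.
pose code (i m : nat) : nat := pickle (i, m).
pose ix k : nat * nat := odflt (0%N, 0%N) (unpickle k).
have codeK i m : ix (code i m) = (i, m) by rewrite /ix /code pickleK.
(* Interiors make these sets open, hence measurable; a center within half the radius of the point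
   still qualifies. *)
pose E k : set (borelT X) := (ball (s (ix k).1) (r (ix k).2))°.
have EP i m x : E (code i m) x -> (mdist (s i) x < r m)%R.
  by rewrite /E codeK/= => /interior_subset; rewrite ballEmdist.
have Eex x m : exists i, E (code i m) x.
  have r2 : (0 < r m / 2)%R by rewrite divr_gt0.
  have [i si] := sdense x _ r2; exists i.
  rewrite /E codeK/= /interior.
  apply: filterS (nbhsx_ballx x _ r2) => y; rewrite !ballEmdist/= => xy.
  apply: le_lt_trans (metric_triangle _ x _) _.
  by rewrite [ltRHS]splitr ltrD.
(* Balls of every radius are present, and any two of them have compatible centers. Only countably
   many conditions on single bits are involved, so [Good] is measurable. *)
pose Good (b : nat -> bool) := (forall m, exists i, b (code i m)) /\
  (forall i j m m', b (code i m) -> b (code j m') ->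
     (mdist (s i) (s j) <= r m + r m')%R).
pose lim_of (b : nat -> bool) : set X :=
  [set x | forall i m, b (code i m) -> (mdist (s i) x <= r m)%R].
have lim_uniq b x y : Good b -> lim_of b x -> lim_of b y -> x = y.
  move=> [g1 _] hx hy; apply: mdist_positivity; apply/eqP.
  rewrite eq_le mdist_ge0 andbT; apply/ler_addgt0Pl => e e0; rewrite addr0.
  have [N /(_ N (leqnn _)) rN] := rsmall (e / 2)%R (divr_gt0 e0 (ltr0Sn _ _)).
  have [i bi] := g1 N.
  apply: le_trans (metric_triangle _ (s i) _) _.
  rewrite metric_sym [leRHS]splitr lerD//; apply: (le_trans _ (ltW rN)).
    exact: hx.
  exact: hy.
have lim_ex b : Good b -> exists x, lim_of b x.
  move=> [/choice[i bi] g2].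
  pose x n := s (i n).
  have cx : cauchy (x @ \oo).
    apply: cauchy_exP => e e0.
    have [N rN] := rsmall (e / 2)%R (divr_gt0 e0 (ltr0Sn _ _)).
    exists (x N), N => // n /= Nn; rewrite ballEmdist/=.
    apply: le_lt_trans (g2 _ _ _ _ (bi N) (bi n)) _.
    by rewrite [ltRHS]splitr ltrD// rN.
  have xl := complX _ (fmap_proper_filter x eventually_filter) cx; set l := lim _ in xl.
  exists l => j m bj; apply/ler_addgt0Pl => e e0.
  have [N rN] := rsmall (e / 2)%R (divr_gt0 e0 (ltr0Sn _ _)).
  have e2 : (0 < e / 2)%R by rewrite divr_gt0.
  have [M _ xM] := xl _ (nbhsx_ballx l _ e2).
  have := xM (maxn N M) (leq_maxr _ _); rewrite /= ballEmdist/= => lx.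
  apply: le_trans (metric_triangle _ (x (maxn N M)) _) _.
  rewrite [leRHS]addrC [e in leRHS]splitr addrA lerD//; last by rewrite metric_sym ltW.
  apply: le_trans (g2 _ _ _ _ bj (bi _)) _.
  by rewrite lerD2l ltW// rN// leq_maxl.
pose G (b : bit_space) : borelT X := if `[< Good b >] then get (lim_of b) else point.
have GP b : Good b -> lim_of b (G b).
  move=> gb; rewrite /G asboolT//.
  have [x hx] := lim_ex _ gb; exact: (getI hx).
have mE k : measurable (E k).
  by apply: sub_gen_smallest; exact: open_interior.
have mGood : measurable ([set b | Good b] : set bit_space).
  rewrite [X in measurable X](_ : _ =
    (\bigcap_m \bigcup_i [set b : bit_space | b (code i m)]) `&`
    (\bigcap_i \bigcap_j \bigcap_m \bigcap_m' (if (mdist (s i) (s j) <= r m + r m')%R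
       then setT else ~` ([set b : bit_space | b (code i m)] `&`
                          [set b : bit_space | b (code j m')])))).
    apply: measurableI.
      apply: bigcapT_measurable => m; apply: bigcupT_measurable => i.
      exact: measurable_bit.
    do 4 (apply: bigcapT_measurable => ?); case: ifP => // _.
    by apply: measurableC; apply: measurableI; exact: measurable_bit.
  apply/seteqP; split => b /=.
    move=> [g1 g2]; split.
      by move=> m _; have [i bi] := g1 m; exists i.
    move=> i _ j _ m _ m' _; case: ifPn => // /negP h [/= bi bj]; apply: h.
    exact: g2.
  move=> [g1 g2]; split.
    by move=> m; have [i _ bi] := g1 m I; exists i.
  move=> i j m m' bi bj.
  by have := g2 i I j I m I m' I; case: ifPn => // _ /=; case.
exists E, G; split => //.
- apply: (@measurability _ _ _ _ setT G (@open X)) => //.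
  move=> _ [U oU <-]; rewrite setTI.
  (* The limit of a good code lies in the open set [U] exactly when some selected closed ball is
     contained in [U], a countable union of bit events. All other codes share one image. *)
  rewrite [X in measurable X](_ : _ =
    ([set b | Good b] `&` \bigcup_i \bigcup_m
       (if `[< [set x | (mdist (s i) x <= r m)%R] `<=` U >]
        then [set b : bit_space | b (code i m)] else set0)) `|`
    (~` [set b | Good b] `&` (if `[< U point >] then setT else set0))).
    apply: measurableU; apply: measurableI => //.
    - do 2 (apply: bigcupT_measurable => ?); case: ifP => // _.
      exact: measurable_bit.
    - exact: measurableC.
    - by case: ifP.
  apply/seteqP; split => b /=.
    have [gb|ngb] := pselect (Good b); last first.
      rewrite /G asboolF// => Up; right; split => //.
      by rewrite asboolT.
    move=> UG; left; split => //.
    have [e /= e0 eU] : exists2 e : R, (0 < e)%R & ball (G b : X) e `<=` U.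
      have /nbhs_ballP[e /= e0 eU] : nbhs (G b : X) U by exact: open_nbhs_nbhs.
      by exists e.
    have [N /(_ N (leqnn _)) rN] := rsmall (e / 2)%R (divr_gt0 e0 (ltr0Sn _ _)).
    have [i bi] := gb.1 N.
    exists i => //; exists N => //.
    rewrite asboolT// => y /= sy; apply: eU; rewrite ballEmdist/=.
    apply: le_lt_trans (metric_triangle _ (s i) _) _.
    rewrite [ltRHS]splitr ltrD//.
      by rewrite metric_sym; apply: (le_lt_trans _ rN); exact: (GP _ gb).
    exact: le_lt_trans sy rN.
  move=> [[gb [i _ [m _]]]|[ngb]].
    case: asboolP => // h bi; apply: h => /=; exact: GP.
  by case: ifPn => [/asboolP Up _|_ []]; rewrite /G asboolF.
- move=> x.
  have gx : Good (set_bits E x).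
    split.
      by move=> m; have [i Ei] := Eex x m; exists i; apply/asboolP.
    move=> i j m m' /asboolP/EP h1 /asboolP/EP h2.
    apply: le_trans (metric_triangle _ x _) _.
    by rewrite lerD ?ltW// metric_sym.
  apply: (lim_uniq _ _ _ gx (GP _ gx)).
  by move=> i m /asboolP/EP/ltW.
Qed.

Notation real_borel R := (borelT (R^o : pmetricType R)).

Lemma real_borel_ray {R : realType} (a : R) :
  measurable ([set u | (a <= u)%R] : set (real_borel R)).
Proof.
rewrite [X in measurable X](_ : _ = ~` [set u : R^o | (u < a)%R]).
  by apply: measurableC; apply: sub_gen_smallest; exact: open_lt.
by apply/seteqP; split => u /=; [rewrite leNgt => /negP|move=> /negP; rewrite -leNgt].
Qed.

(** The uniform law is carried by the identity from one presentation of the Borel sets of the line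
    to another. *)
Lemma uniform_real_borel (R : realType) :
  exists lam : probability (real_borel R) R,
    forall a b : R, (0 <= a)%R -> (a <= b)%R -> (b <= 1)%R ->
      lam [set u | (a <= u < b)%R] = (b - a)%:E.
Proof.
have mid : measurable_fun setT (fun u : measurableTypeR R => u : real_borel R).
  apply: (@measurability _ _ (measurableTypeR R) (real_borel R) setT _ (@open (R^o : pmetricType R))) => //.
  by move=> _ [U oU <-]; rewrite setTI; exact: open_measurable.
have [lam [lamE _]] := probability_pushforward
  (uniform_prob (@ltr01 R) : probability (measurableTypeR R) R) mid.
exists lam => a b a0 ab b1; rewrite lamE /= /uniform_prob.
have -> : (fun u : measurableTypeR R => u : real_borel R) @^-1`
    [set u | (a <= u < b)%R] = `[a, b[%classic.
  by apply/seteqP; split => u /=; rewrite in_itv/=.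
rewrite (eq_integral (cst 1)); last first.
  move=> x; rewrite inE/= in_itv/= => /andP[ax xb].
  by rewrite /uniform_pdf (le_trans a0 ax)/= (le_trans (ltW xb) b1) subr0 invr1.
rewrite integral_cst//= mul1e lebesgue_measure_itv/= lte_fin.
case: ltP => [//|ba]; have -> : a = b by apply/eqP; rewrite eq_le ab ba.
by rewrite subrr.
Qed.

(** One uniform number yields a sample [V] of [mu] and an independent number [W] with the law of the
    original, because [mu \x lam] lives on a standard space. As [lam] is chosen before [mu], the
    number [W] can be split again. *)
Lemma uniform_split (R : realType) :
  exists lam : probability (real_borel R) R,
  forall d (T : measurableType d) (mu : probability T R), standard T ->
  exists (V : real_borel R -> T) (W : real_borel R -> real_borel R),
    [/\ measurable_fun setT V, measurable_fun setT W &
      forall g : T * real_borel R -> \bar R,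
      (forall z, 0 <= g z) -> measurable_fun setT g ->
      \int[lam]_u g (V u, W u) = \int[mu]_x \int[lam]_u g (x, u)].
Proof.
have [lam lamE] := uniform_real_borel R.
exists lam => d T mu sT.
have [E [G [mE mG GK]]] := standard_prod sT (polish_standard (polish_real R)).
pose nu : probability (T * real_borel R)%type R := mu \x lam.
have [mb lawb] := @uniform_bits_law R _ _ nu E mE _ (real_borel R) lam id
  (@real_borel_ray R) lamE.
pose f : real_borel R -> T * real_borel R := G \o (uniform_bits nu E \o id).
have mf : measurable_fun setT f := measurableT_comp mG mb.
(* [G] is a left inverse of the itinerary map, so it carries the law of the itinerary back to
   [nu]. *)
have fE A : measurable A -> lam (f @^-1` A) = nu A.
  move=> mA; have mGA : measurable (G @^-1` A).
    by rewrite -[X in measurable X]setTI; exact: mG.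
  rewrite (lawb _ mGA); congr (nu _).
  by apply/seteqP; split => s /=; rewrite GK.
exists (fst \o f), (snd \o f); split.
- exact: measurableT_comp.
- exact: measurableT_comp.
- move=> g g0 mg.
  have [p [pE pg]] := probability_pushforward lam mf.
  transitivity (\int[p]_z g z).
    rewrite pg//; apply: eq_integral => u _.
    by rewrite -surjective_pairing.
  rewrite (@meq_integral _ _ _ p nu); last by move=> A mA; exact: etrans (pE A) (fE A mA).
  by rewrite fubini_tonelli1.
Qed.

Lemma emeasurable_prod {R : realType} {d} {T : measurableType d} (I : Type) (s : seq I)
    (f : I -> T -> \bar R) :
  (forall i, measurable_fun setT (f i)) ->
  measurable_fun setT (fun x => \prod_(i <- s) f i x).
Proof.
move=> mf; elim: s => [|i s IH].
  by under eq_fun do rewrite big_nil; exact: measurable_cst.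
by under eq_fun do rewrite big_cons; exact: emeasurable_funM.
Qed.

(** * Independent samples from one uniform variable *)

Section iid_sequence.
Context {R : realType} {d} {T : measurableType d}.
Variables (lam : probability (real_borel R) R) (mu : probability T R).
Variables (V : real_borel R -> T) (W : real_borel R -> real_borel R).
Hypothesis mV : measurable_fun setT V.
Hypothesis mW : measurable_fun setT W.
Hypothesis lawVW : forall g : T * real_borel R -> \bar R,
  (forall z, 0 <= g z) -> measurable_fun setT g ->
  \int[lam]_u g (V u, W u) = \int[mu]_x \int[lam]_u g (x, u).

(** Sample [i] is taken after [i] renewals of the seed, which makes the family i.i.d. without an
    infinite product space. *)
Definition iid_seq (i : nat) (u : real_borel R) : T := V (iter i W u).

Lemma measurable_iid_seq i : measurable_fun setT (iid_seq i).
Proof.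
apply: (@measurableT_comp _ _ _ _ _ _ V) => //.
elim: i => [|i IH] /=; first exact: measurable_id.
exact: measurableT_comp.
Qed.

Lemma iid_integral_cons (f : T -> \bar R) (h : real_borel R -> \bar R) :
  (forall x, 0 <= f x) -> measurable_fun setT f ->
  (forall u, 0 <= h u) -> measurable_fun setT h ->
  \int[lam]_u (f (V u) * h (W u)) = \int[mu]_x f x * \int[lam]_u h u.
Proof.
move=> f0 mf h0 mh.
rewrite (lawVW (g := fun z => f z.1 * h z.2))/=; last 2 first.
- by move=> z; rewrite mule_ge0.
- by apply: emeasurable_funM; exact: measurableT_comp.
rewrite -ge0_integralZr//; last exact: integral_ge0.
by apply: eq_integral => x _; rewrite ge0_integralZl.
Qed.

(** The form needed for rejection sampling: [c] is the chance of refusing a proposal and [h]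
    evaluates the first one kept. *)
Lemma iid_integral_geometric (c h : T -> \bar R) j :
  (forall x, 0 <= c x) -> measurable_fun setT c ->
  (forall x, 0 <= h x) -> measurable_fun setT h ->
  \int[lam]_u (\prod_(i < j) c (iid_seq i u) * h (iid_seq j u)) =
  (\int[mu]_x c x) ^+ j * \int[mu]_x h x.
Proof.
move=> c0 mc h0 mh; elim: j => [|j IH].
  rewrite expe0 mul1e; have := iid_integral_cons h0 mh (fun=> lee01) (measurable_cst 1).
  rewrite integral_cst//= mul1e probability_setT mule1 => <-.
  by apply: eq_integral => u _; rewrite big_ord0 mul1e mule1.
rewrite expeS -muleA -IH -iid_integral_cons//; last 2 first.
- by move=> u; rewrite mule_ge0// prode_ge0.
- apply: emeasurable_funM; last exact: (measurableT_comp mh (measurable_iid_seq j)).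
  apply: emeasurable_prod => i _; exact: (measurableT_comp mc (measurable_iid_seq i)).
apply: eq_integral => u _; rewrite big_ord_recl muleA; congr (_ * _ * _).
  by apply: eq_bigr => i _; rewrite /iid_seq iterSr.
by rewrite /iid_seq iterSr.
Qed.

Lemma iid_integral_prod n (g : 'I_n -> T -> \bar R) :
  (forall i x, 0 <= g i x) -> (forall i, measurable_fun setT (g i)) ->
  \int[lam]_u (\prod_(i < n) g i (iid_seq i u)) = \prod_(i < n) \int[mu]_x g i x.
Proof.
elim: n g => [|n IH] g g0 mg.
  under eq_integral do rewrite big_ord0.
  by rewrite big_ord0 integral_cst//= mul1e probability_setT.
rewrite big_ord_recl -(IH (fun i => g (lift ord0 i)))// -iid_integral_cons//; last 2 first.
- by move=> u; rewrite prode_ge0.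
- apply: emeasurable_prod => i _.
  exact: (measurableT_comp (mg _) (measurable_iid_seq i)).
apply: eq_integral => u _; rewrite big_ord_recl; congr (_ * _).
by apply: eq_bigr => i _; rewrite /iid_seq /= -iterSr.
Qed.

End iid_sequence.

Lemma prodn_indic {R : realType} {T : Type} n (A : 'I_n -> set T) (x : n.-tuple T) :
  (\1_[set x : n.-tuple T | forall i, A i (tnth x i)] x)%:E =
  \prod_(i < n) (\1_(A i) (tnth x i))%:E :> \bar R.
Proof.
rewrite prodEFin; congr EFin.
have [h|h] := pselect (forall i, A i (tnth x i)).
  rewrite indicE mem_set// big1// => i _.
  by rewrite indicE mem_set//; exact: h.
rewrite indicE memNset//; move/existsNP: h => [i Ai].
by rewrite (bigD1 i)//= indicE memNset ?mul0r.
Qed.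

(** The product measure is realized as the law of the first [n] terms of [iid_seq], which hands down
    the product formula for integrals. *)
Lemma prodn_exists {R : realType} {d} {T : measurableType d} (mu : probability T R) n :
  standard T -> exists P : probability (n.-tuple T) R, is_prodn (fun _ => mu) P /\
    forall g : 'I_n -> T -> \bar R,
    (forall i x, 0 <= g i x) -> (forall i, measurable_fun setT (g i)) ->
    \int[P]_x (\prod_(i < n) g i (tnth x i)) = \prod_(i < n) \int[mu]_x g i x.
Proof.
move=> sT; have [lam /(_ _ _ mu sT)[V [W [mV mW VW]]]] := uniform_split R.
pose f u : n.-tuple T := [tuple iid_seq V W i u | i < n].
have mf : measurable_fun setT f.
  apply/measurable_fun_tnthP => i.
  rewrite (_ : _ \o _ = iid_seq V W i); first exact: measurable_iid_seq.
  by apply/funext => u /=; rewrite tnth_mktuple.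
have [P [PE Pg]] := probability_pushforward lam mf.
have PP (g : 'I_n -> T -> \bar R) :
    (forall i x, 0 <= g i x) -> (forall i, measurable_fun setT (g i)) ->
    \int[P]_x (\prod_(i < n) g i (tnth x i)) = \prod_(i < n) \int[mu]_x g i x.
  move=> g0 mg; rewrite Pg; last 2 first.
  - by move=> z; rewrite prode_ge0.
  - apply: emeasurable_prod => i _.
    exact: (measurableT_comp (mg i) (measurable_tnth i)).
  rewrite -(iid_integral_prod mV mW VW)//.
  by apply: eq_integral => u _; apply: eq_bigr => i _; rewrite tnth_mktuple.
exists P; split => // A mA.

have mR := measurable_rect mA.
transitivity (\int[P]_x (\1_[set x : n.-tuple T | forall i, A i (tnth x i)] x)%:E).
  by rewrite integral_indic// setIT.
transitivity (\int[P]_x (\prod_(i < n) (\1_(A i) (tnth x i))%:E)).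
  by apply: eq_integral => x _; rewrite prodn_indic.
rewrite (PP (fun i x => (\1_(A i) x)%:E)); last 2 first.
- by move=> i x; rewrite lee_fin.
- by move=> i; apply/measurable_EFinP; exact: measurable_indic.
rewrite -[RHS]prodEFin; apply: eq_bigr => i _.
rewrite integral_indic// setIT fineK//; exact: fin_num_measure.
Qed.

(** * Relative entropy *)

Definition is_partition {d} {S : measurableType d} k (A : 'I_k -> set S) :=
  (forall i, measurable (A i)) /\ (forall i j, i != j -> A i `&` A j = set0) /\
  \big[setU/set0]_(i < k) A i = setT.

Lemma ln_le_subr1 {R : realType} (x : R) : (0 < x)%R -> (ln x <= x - 1)%R.
Proof.
move=> x0; rewrite lerBrDl -[leRHS]lnK ?posrE//.
exact: expR_ge1Dx.
Qed.

(** The Fenchel-Young inequality for t ln t, obtained from ln t <= t - 1 at t = q e^a / p. *)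
Lemma kl_term_ge {R : realType} (p q : \bar R) (a : R) :
  (0 <= fine p)%R -> (0 <= fine q)%R ->
  (fine p * a + fine p - fine q * expR a)%:E <= kl_term p q.
Proof.
rewrite /kl_term; move: (fine p) (fine q) => {}p {}q p0 q0.
case: eqP => [->|/eqP pN0].
  by rewrite mul0r !add0r lee_fin oppr_le0 mulr_ge0// expR_ge0.
case: eqP => [->|/eqP qN0]; first exact: leey.
have {}p0 : (0 < p)%R by rewrite lt_neqAle eq_sym pN0.
have {}q0 : (0 < q)%R by rewrite lt_neqAle eq_sym qN0.
have t0 : (0 < q * expR a / p)%R by rewrite divr_gt0// mulr_gt0// expR_gt0.
have h := ln_le_subr1 t0.
rewrite lee_fin lnM ?posrE ?invr_gt0// lnV ?posrE//.
rewrite !lnM ?posrE ?invr_gt0 ?expR_gt0// ?mulr_gt0 ?expR_gt0// expRK lnV ?posrE// in h.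
have : (p * (ln q + a - ln p) <= p * (q * expR a / p - 1))%R by rewrite ler_pM2l.
have -> : (p * (q * expR a / p - 1) = q * expR a - p)%R by field; rewrite gt_eqF.
lra.
Qed.

(** The supremum over [a] recovers the relative entropy: the optimal [a i] is ln (p_i / q_i). Where
    p_i = 0 this is minus infinity, and a very negative value is used instead at the price of an
    arbitrarily small error. *)
Lemma sum_kl_term_le {R : realType} k (p q : 'I_k -> \bar R) (c : R) :
  (forall i, 0 <= fine (p i))%R -> (forall i, 0 <= fine (q i))%R ->
  (\sum_(i < k) fine (p i) = 1)%R ->
  (forall a : 'I_k -> R,
     (\sum_(i < k) (fine (p i) * a i - fine (q i) * expR (a i)) + 1 <= c)%R) ->
  \sum_(i < k) kl_term (p i) (q i) <= c%:E.
Proof.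
move=> p0 q0 p1 H.
have ac i : fine (q i) = 0%R -> fine (p i) = 0%R.
  move=> qi; apply/eqP; apply: contraT => pN0.
  have pi0 : (0 < fine (p i))%R by rewrite lt_neqAle eq_sym pN0 p0.
  pose K := (\sum_(j < k | j != i) (fine (p j) * 0 - fine (q j) * expR 0))%R.
  (* If q_i = 0 < p_i, raising [a i] alone is not penalized; this value pushes the left side above
     [c]. *)
  have := H (fun j => if j == i then (`|c - K| / fine (p i))%R else 0%R).
  rewrite (bigD1 i)//= eqxx qi mul0r subr0.
  under eq_bigr => j /negPf -> do over.
  rewrite -/K mulrC divfK//.
  have := ler_norm (c - K)%R; lra.
pose t i := (if fine (p i) == 0 then 0 else fine (p i) * ln (fine (p i) / fine (q i)))%R.
have tE i : kl_term (p i) (q i) = (t i)%:E.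
  rewrite /kl_term /t; case: eqP => // /eqP pN0.
  by case: eqP => // /ac /eqP; rewrite (negPf pN0).
under eq_bigr do rewrite tE.
rewrite sumEFin lee_fin; apply/ler_addgt0Pl => e e0.
pose Q := (\sum_(i < k) fine (q i) + 1)%R.
have Q0 : (0 < Q)%R by rewrite ltr_wpDl// sumr_ge0.
(* With e^s = [e / Q], the indices where p_i = 0 contribute at most [e] in total. *)
pose s := ln (e / Q).
have := H (fun i => if fine (p i) == 0%R then s else ln (fine (p i) / fine (q i))).
have : (\sum_(i < k) (t i - fine (p i) - fine (q i) * (e / Q)) <=
  \sum_(i < k) (fine (p i) * (if fine (p i) == 0%R then s else ln (fine (p i) / fine (q i)))
   - fine (q i) * expR (if fine (p i) == 0%R then s else ln (fine (p i) / fine (q i)))))%R.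
  apply: ler_sum => i _; rewrite /t; case: eqP => [->|/eqP pN0].
    by rewrite !mul0r subr0 /s lnK// posrE divr_gt0.
  have qN0 : fine (q i) != 0%R by apply: contra pN0 => /eqP/ac/eqP.
  have pi0 : (0 < fine (p i))%R by rewrite lt_neqAle eq_sym pN0 p0.
  have qi0 : (0 < fine (q i))%R by rewrite lt_neqAle eq_sym qN0 q0.
  rewrite lnK ?posrE ?divr_gt0// [(fine (q i) * (fine (p i) / _))%R]mulrCA divff// mulr1.
  by rewrite gerBl mulr_ge0// divr_ge0// ltW.
rewrite !sumrB p1 -mulr_suml.
have : (\sum_(i < k) fine (q i) * (e / Q) <= e)%R.
  rewrite -mulr_suml mulrA ler_pdivrMr// mulrC ler_pM2l// /Q.
  by rewrite lerDl.
rewrite -mulr_suml.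
lra.
Qed.

Lemma partition_sum_probability {R : realType} {d} {S : measurableType d}
    (P : probability S R) k (A : 'I_k -> set S) :
  is_partition A -> (\sum_(i < k) fine (P (A i)) = 1)%R.
Proof.
move=> [mA [dA cA]]; apply: EFin_inj; rewrite -sumEFin.
under eq_bigr do rewrite fineK ?fin_num_measure//.
rewrite -(probability_setT P) -cA [RHS]measure_bigsetU_ord//.
by apply/trivIsetP => i j _ _; exact: dA.
Qed.

(** The variational bound for simple test functions, linear in [P] and in [Q]; the 1 is the total
    mass of [P]. *)
Lemma KL_ge {R : realType} {d} {S : measurableType d} (P Q : probability S R)
    k (A : 'I_k -> set S) (a : 'I_k -> R) : is_partition A ->
  (\sum_(i < k) (fine (P (A i)) * a i - fine (Q (A i)) * expR (a i)) + 1)%:E <= KL P Q.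
Proof.
move=> pA; have p1 := partition_sum_probability P pA.
apply: (@le_trans _ _ (\sum_(i < k) kl_term (P (A i)) (Q (A i)))).
  rewrite -p1 -big_split/= -sumEFin; apply: lee_sum => i _.
  by rewrite addrAC kl_term_ge// fine_ge0.
apply: ereal_sup_ubound; exists k, A; case: pA => mA [dA cA].
by do !split.
Qed.

Lemma KL_le {R : realType} {d} {S : measurableType d} (P Q : probability S R) (c : R) :
  (forall k (A : 'I_k -> set S) (a : 'I_k -> R), is_partition A ->
    (\sum_(i < k) (fine (P (A i)) * a i - fine (Q (A i)) * expR (a i)) + 1 <= c)%R) ->
  KL P Q <= c%:E.
Proof.
move=> H; apply: ge_ereal_sup => _ [k [A [mA [dA [cA ->]]]]].
have pA : is_partition A by [].
apply: sum_kl_term_le => [i|i||a]; rewrite ?fine_ge0//.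
  exact: partition_sum_probability pA.
exact: H.
Qed.

Lemma KL_ext {R : realType} {d} {S : measurableType d} (P Q P' Q' : set S -> \bar R) :
  (forall A, measurable A -> P A = P' A) -> (forall A, measurable A -> Q A = Q' A) ->
  KL P Q = KL P' Q'.
Proof.
move=> hP hQ; congr (ereal_sup _); apply/seteqP; split => s /= [k [A [mA [dA [cA ->]]]]];
  exists k, A; do !split => //; apply: eq_bigr => i _; rewrite ?hP ?hQ//.
Qed.

Lemma joint_probability {R : realType} {d1 d2} {T1 : measurableType d1}
    {T2 : measurableType d2} (pX : probability T1 R) (k : T1 -> probability T2 R) :
  markov_kernel k -> exists J : probability (T1 * T2)%type R,
  forall g : T1 * T2 -> \bar R, (forall z, 0 <= g z) -> measurable_fun setT g ->
      \int[J]_z g z = \int[pX]_x \int[k x]_y g (x, y).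
Proof.
move=> hk.
have mpair (x : T1) : measurable_fun setT (fun y : T2 => (x, y)).
  exact: pair1_measurable.
have /choice[k' hk'] : forall x, exists k' : probability (T1 * T2)%type R,
    (forall A, k' A = k x ((fun y => (x, y)) @^-1` A)) /\
    forall g : T1 * T2 -> \bar R, (forall z, 0 <= g z) -> measurable_fun setT g ->
      \int[k']_z g z = \int[k x]_y g (x, y).
  by move=> x; exact: probability_pushforward.
have mk' : markov_kernel k'.
  move=> A mA.
  rewrite (_ : (fun x => _) = fun x => \int[k x]_y (\1_A (x, y))%:E).
    apply: (markov_integral_measurable (g := fun z => (\1_A z)%:E)) => //.
    by apply/measurable_EFinP; exact: measurable_indic.
  apply/funext => x; rewrite (hk' x).1.
  rewrite -integral_indicT//.
  by rewrite -[X in measurable X]setTI; exact: mpair.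
have [J [_ Jg]] := probability_bind pX mk'.
by exists J => g g0 mg; rewrite Jg//; apply: eq_integral => x _; rewrite (hk' x).2.
Qed.

(** [mutual_info] is built from bare set functions; here they are identified with genuine
    probabilities whose integrals are iterated integrals. *)
Lemma mutual_info_KL {R : realType} {d} {T : measurableType d}
    (pX pY : probability T R) (k : T -> probability T R) :
  markov_kernel k -> meq pY (fun B => \int[pX]_x k x B) ->
  exists J Q : probability (T * T)%type R,
    [/\ forall g : T * T -> \bar R, (forall z, 0 <= g z) -> measurable_fun setT g ->
          \int[J]_z g z = \int[pX]_x \int[k x]_y g (x, y),
        forall g : T * T -> \bar R, (forall z, 0 <= g z) -> measurable_fun setT g ->
          \int[Q]_z g z = \int[pX]_x \int[pY]_y g (x, y) &
        mutual_info pX k = KL J Q].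
Proof.
move=> hk pYE; have [J Jg] := joint_probability pX hk.
exists J, (pX \x pY); split => //.
  by move=> g g0 mg; rewrite fubini_tonelli1.
apply: KL_ext => A mA.
- transitivity (\int[J]_z (\1_A z)%:E); last by rewrite integral_indicT.
  rewrite Jg//; last by apply/measurable_EFinP; exact: measurable_indic.
  apply: eq_integral => x _.
  rewrite (_ : [set y | A (x, y)] = (fun y => (x, y)) @^-1` A)//.
  rewrite -integral_indicT//.
  by rewrite -[X in measurable X]setTI; exact: pair1_measurable.
- rewrite /product_measure1; apply: eq_integral => x _ /=.
  rewrite -pYE /xsection; first by congr (pY _); apply/seteqP; split => y /=; rewrite inE.
  by rewrite -[X in measurable X]setTI; exact: pair1_measurable.
Qed.

(** * Densities and their levels *)

Lemma KL_density {R : realType} {d} {S : measurableType d} (J Q : probability S R) (c : R) :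
  KL J Q <= c%:E -> exists f : S -> R,
    [/\ measurable_fun setT f, forall z, (0 <= f z)%R &
        forall g : S -> \bar R, (forall z, 0 <= g z) -> measurable_fun setT g ->
          \int[J]_z g z = \int[Q]_z ((f z)%:E * g z)].
Proof.
move=> KLc.
have dom : J `<< Q.
  apply/null_content_dominatesP => A mA QA.
  (* A set with Q A = 0 < J A is excluded by the partition into [A] and its complement, with test
     value (|c| + 1) / J A on [A]. *)
  have pA : is_partition (fun i : 'I_2 => if i == ord0 then A else ~` A).
    split; first by move=> i; case: ifP => // _; exact: measurableC.
    split.
      by move=> [[|[|//]] ?] [[|[|//]] ?] //= _; rewrite ?setICr ?setICl.
    by rewrite !big_ord_recl big_ord0/= setU0 setUv.
  apply/eqP; rewrite eq_le measure_ge0 andbT leNgt; apply/negP => JA.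
  have fJA : (0 < fine (J A))%R by rewrite fine_gt0// JA ltey_eq fin_num_measure.
  pose s := ((`|c| + 1) / fine (J A))%R.
  have := le_trans (KL_ge J Q (fun i => if i == ord0 then s else 0%R) pA) KLc.
  rewrite lee_fin !big_ord_recl big_ord0/= QA/= mul0r subr0 mulr0 add0r expR0 addr0 mulr1.
  rewrite /s mulrCA divff ?gt_eqF// mulr1.
  have : (fine (Q (~` A)) <= 1)%R.
    by rewrite -lee_fin fineK ?fin_num_measure ?probability_le1//; exact: measurableC.
  have := ler_norm c; lra.
pose g0 := Radon_Nikodym_SigmaFinite.f J Q.
have g00 := Radon_Nikodym_SigmaFinite.f_ge0 dom.
have gfin := Radon_Nikodym_SigmaFinite.f_fin_num dom.
have mg := measurable_int _ (Radon_Nikodym_SigmaFinite.f_integrable dom).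
exists (fine \o g0); split.
- exact: measurableT_comp.
- by move=> z; exact: fine_ge0.
- move=> g gge0 mgg.
  rewrite -(Radon_Nikodym_SigmaFinite.change_of_variables dom)//.
  by apply: eq_integral => z _; rewrite muleC /= fineK.
Qed.

Lemma measurable_natP {d} {S : measurableType d} (m : S -> nat) :
  (forall l, measurable [set z | (m z <= l)%N]) -> measurable_fun setT m.
Proof.
move=> ml _ Y _; rewrite setTI.
have m1 l : measurable [set z | m z = l].
  case: l => [|l].
    by have := ml 0%N; congr measurable; apply/seteqP; split => z /=;
      [rewrite leqn0 => /eqP|move=> ->].
  rewrite (_ : [set z | _] = [set z | (m z <= l.+1)%N] `\` [set z | (m z <= l)%N]).
    exact: measurableD.
  apply/seteqP; split => z /=; first by move=> ->; rewrite leqnn ltnn.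
  by move=> [h1 /negP]; rewrite -ltnNge => h2; apply/eqP; rewrite eqn_leq h1.
rewrite (_ : _ @^-1` _ = \bigcup_(l in Y) [set z | m z = l]); last first.
  by apply/seteqP; split => z /=; [exists (m z)|move=> [l Yl /= ->]].
by rewrite bigcup_mkcond; apply: bigcupT_measurable => l; case: ifP.
Qed.

(* The label is the index of the multiplicative level [e^(delta (l - 1) - b), e^(delta l - b)]
   of the density, with all values below [e^-b] in level 0. *)
Lemma density_label {R : realType} {d} {S : measurableType d} (J Q : probability S R)
    (f : S -> R) (c delta b : R) :
  KL J Q <= c%:E -> measurable_fun setT f -> (forall z, (0 <= f z)%R) ->
  (forall g : S -> \bar R, (forall z, 0 <= g z) -> measurable_fun setT g ->
          \int[J]_z g z = \int[Q]_z ((f z)%:E * g z)) ->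
  (0 < delta)%R ->
  exists m : S -> nat, [/\ measurable_fun setT m,
    forall z, (f z <= expR (delta * (m z)%:R - b))%R &
    \int[J]_z ((m z)%:R)%:E <= ((c - 1 + expR delta + expR (- b) + b) / delta)%:E].
Proof.
move=> KLc mf f0 fJ d0.
have ex z : exists l, (f z <= expR (delta * l%:R - b))%R.
  exists (Num.trunc ((f z + b) / delta)).+1.
  apply: le_trans (expR_ge1Dx _).
  have := truncnS_gt ((f z + b) / delta)%R.
  rewrite ltr_pdivrMr// mulrC => h; lra.
pose m z := ex_minn (ex z).
have mP z l : (m z <= l)%N = (f z <= expR (delta * l%:R - b))%R.
  rewrite /m; case: ex_minnP => i fi imin; apply/idP/idP => [il|]; last exact: imin.
  apply: le_trans fi _; rewrite ler_expR lerD2r ler_pM2l//.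
  by rewrite ler_nat.
have mm : measurable_fun setT m.
  apply: measurable_natP => l; under eq_set do rewrite mP.
  rewrite -[X in measurable X]setTI.
  exact: (measurable_fun_le measurableT mf (measurable_cst _)).
exists m; split => //; first by move=> z; rewrite -mP.
have mfun (h : nat -> R) : measurable_fun setT (fun z => (h (m z))%:E).
  by apply/measurable_EFinP; exact: (measurableT_comp (g := m)).
set K := ((c - 1 + expR delta + expR (- b) + b) / delta)%R.
(* Relative entropy tests finite partitions only, so the label is capped at [N]; monotone
   convergence removes the cap at the end. *)
have trunc_le N : \int[J]_z ((minn (m z) N)%:R)%:E <= K%:E.
  pose A (i : 'I_N.+1) := [set z | minn (m z) N = i].
  have mA i : measurable (A i).
    rewrite -[X in measurable X]setTI.
    exact: (mm measurableT [set l | minn l N = i]).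
  have pA : is_partition A.
    split => //; split.
      move=> i j /eqP ij; apply/seteqP; split => z //= -[zi zj]; apply: ij.
      by apply: val_inj; rewrite /= -zi -zj.
    apply/seteqP; split => // z _; rewrite -bigcup_seq /=.
    exists (inord (minn (m z) N)); first by rewrite /= mem_index_enum.
    by rewrite /A/= inordK// ltnS geq_minr.
  have mind i : measurable_fun setT (fun z => (\1_(A i) z)%:E : \bar R).
    exact: emeasurable_indic.
  have JE : \int[J]_z ((minn (m z) N)%:R)%:E =
      (\sum_(i < N.+1) (i%:R * fine (J (A i))))%:E.
    transitivity (\int[J]_z \sum_(i < N.+1) (i%:R%:E * (\1_(A i) z)%:E)).
      apply: eq_integral => z _.
      have iN : (minn (m z) N < N.+1)%N by rewrite ltnS geq_minr.
      rewrite (bigD1 (Ordinal iN))//= big1 ?adde0.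
        by rewrite indicE mem_set// mule1.
      move=> i /eqP ii; rewrite indicE memNset ?mule0//= => zi.
      by apply: ii; apply: val_inj.
    rewrite ge0_integral_sum//; last by move=> i; exact: emeasurable_funM.
    rewrite -sumEFin; apply: eq_bigr => i _.
    rewrite integralZ_ge0//.
    by rewrite integral_indicT// EFinM fineK// fin_num_measure.
  rewrite JE lee_fin.
  (* The test value on cell [i] is the logarithm of its level bound. The J-part is then [delta]
     times the mean label minus [b], and the Q-part is at most e^delta + e^(-b) by [Qle] below. *)
  have := le_trans (KL_ge J Q (fun i => delta * i%:R - b)%R pA) KLc.
  rewrite lee_fin => kl.
  have p1 := partition_sum_probability J pA.
  have Qle (i : 'I_N.+1) : (fine (Q (A i)) * expR (delta * i%:R - b) <=
      expR delta * fine (J (A i)) + (if i == ord0 then expR (- b) else 0))%R.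
    case: eqP => [->|/eqP i0].
      rewrite mulr0 add0r ler_wpDl ?mulr_ge0 ?expR_ge0 ?fine_ge0//.
      rewrite ger_pMl ?expR_gt0//.
      by rewrite -lee_fin fineK ?fin_num_measure ?probability_le1.
    rewrite addr0 -lee_fin EFinM EFinM !fineK ?fin_num_measure//.
    have fi0 z : 0 <= (f z)%:E * (\1_(A i) z)%:E :> \bar R.
      by rewrite mule_ge0 ?lee_fin.
    have mfi : measurable_fun setT (fun z => (f z)%:E * (\1_(A i) z)%:E : \bar R).
      by apply: emeasurable_funM; [exact/measurable_EFinP|exact: emeasurable_indic].
    rewrite -[J _]integral_indicT// fJ//.
    rewrite -[Q _]integral_indicT// muleC -!integralZ_ge0 ?expR_ge0//.
    apply: ge0_le_integral => //.
    1,2: exact: emeasurable_funM.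
    - move=> z _; rewrite indicE; case: (boolP (z \in A i)) => [|_]; last by rewrite !mule0.
      rewrite inE /A/= !mule1 -EFinM lee_fin => zi.
      (* The label is minimal, so the density exceeds the previous level; this also holds in the
         capped cell, where the label is at least [i]. *)
      have : ~~ (m z <= i.-1)%N.
        rewrite -ltnNge prednK ?lt0n//.
        by rewrite -zi geq_minl.
      rewrite mP -ltNge => /ltW fi.
      apply: (@le_trans _ _ (expR delta * expR (delta * i.-1%:R - b))%R); last first.
        by rewrite ler_pM2l ?expR_gt0.
      rewrite -expRD ler_expR.
      have -> : (i : nat)%:R = (i.-1%:R + 1 :> R)%R by rewrite natr1 prednK// lt0n.
      lra.
  have : (\sum_(i < N.+1) (fine (Q (A i)) * expR (delta * i%:R - b)) <=
          expR delta + expR (- b))%R.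
    apply: le_trans (ler_sum _ (fun i _ => Qle i)) _.
    by rewrite big_split/= -mulr_sumr p1 mulr1 lerD2l -big_mkcond/= (big_pred1 ord0).
  move: kl; rewrite sumrB.
  have -> : (\sum_(i < N.+1) fine (J (A i)) * (delta * i%:R - b) =
     delta * (\sum_(i < N.+1) i%:R * fine (J (A i))) - b)%R.
    rewrite -[b in RHS]mulr1 -p1 !mulr_sumr -sumrB; apply: eq_bigr => i _; ring.
  rewrite /K ler_pdivlMr//.
  set x := (\sum_(i < N.+1) _ * _)%R; set y := (\sum_(i < N.+1) _)%R.
  lra.
have mE z : ((m z)%:R)%:E = limn (fun N => ((minn (m z) N)%:R)%:E : \bar R).
  apply/esym/cvg_lim => //; apply: cvg_near_cst.
  by exists (m z) => // N /= mN; rewrite (minn_idPl mN).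
under eq_integral do rewrite mE.
rewrite monotone_convergence//.
- apply: lime_le; last by apply: nearW.
  apply: ereal_nondecreasing_is_cvgn => N M NM.
  apply: ge0_le_integral => //.
  + exact: (mfun (fun l => (minn l N)%:R)).
  + exact: (mfun (fun l => (minn l M)%:R)).
  + move=> z _; rewrite lee_fin ler_nat leq_min geq_minl/=.
    by rewrite (leq_trans (geq_minr _ _)).
- by move=> N; exact: (mfun (fun l => (minn l N)%:R)).
- move=> z _ N M NM; rewrite lee_fin ler_nat leq_min geq_minl/=.
  by rewrite (leq_trans (geq_minr _ _)).
Qed.

Lemma measurable_fun_section1 {R : realType} {d1 d2} {T1 : measurableType d1}
    {T2 : measurableType d2} (g : T1 * T2 -> \bar R) (x : T1) :
  measurable_fun setT g -> measurable_fun setT (fun y => g (x, y)).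
Proof. by move=> mg; apply: (measurableT_comp mg); exact: pair1_measurable. Qed.

(** A density of the joint law integrates to 1 over y for almost every x only. On the exceptional
    null set it is replaced by 1, the density of the output law itself, so that there is a channel
    to simulate at every x while no joint integral changes. *)
Lemma mutual_info_density {R : realType} {d} {T : measurableType d}
    (pX pY : probability T R) (k : T -> probability T R) (c delta b : R) :
  markov_kernel k -> meq pY (fun B => \int[pX]_x k x B) ->
  mutual_info pX k <= c%:E -> (0 < delta)%R ->
  exists (f : T * T -> R) (m : T * T -> nat),
    [/\ measurable_fun setT f, forall z, (0 <= f z)%R,
        forall x, \int[pY]_y (f (x, y))%:E = 1 &
        forall g : T * T -> \bar R, (forall z, 0 <= g z) -> measurable_fun setT g ->
          \int[pX]_x \int[k x]_y g (x, y) =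
          \int[pX]_x \int[pY]_y ((f (x, y))%:E * g (x, y))] /\
    [/\ measurable_fun setT m,
        forall z, (f z <= expR (delta * (m z)%:R - b))%R &
        \int[pX]_x \int[pY]_y ((f (x, y))%:E * (m (x, y))%:R%:E) <=
          ((c - 1 + expR delta + expR (- b) + b) / delta)%:E].
Proof.
move=> hk pYE MIc d0.
have [J [Q [Jg QE MIE]]] := mutual_info_KL hk pYE.
rewrite MIE in MIc.
have [f1 [mf1 f10 f1J]] := @KL_density _ _ _ J Q c MIc.
have ef10 z : 0 <= (f1 z)%:E by rewrite lee_fin.
have mef1 : measurable_fun setT (fun z => (f1 z)%:E) by exact/measurable_EFinP.
pose h x := \int[pY]_y (f1 (x, y))%:E.
have mh : measurable_fun setT h.
  exact: (measurable_fun_fubini_tonelli_F _ mef1 ef10).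
have h0 x : 0 <= h x by apply: integral_ge0.
pose G := [set x | h x = 1].
have mG : measurable G.
  by rewrite -[X in measurable X]setTI; exact: (mh measurableT [set 1]).
(* The first marginal of [J] is [pX], so [h] has integral pX A over every measurable [A]. *)
have hG : {ae pX, forall x, setT x -> h x = cst 1 x}.
  have h1 : \int[pX]_x h x = 1.
    transitivity (\int[Q]_z (f1 z)%:E); first by rewrite QE.
    rewrite -(probability_setT J) -[RHS]integral_indicT// f1J//; last exact: emeasurable_indic.
    by apply: eq_integral => z _; rewrite indicT mule1.
  have ih : pX.-integrable setT h.
    apply/integrableP; split => //.
    under eq_integral do rewrite gee0_abs//.
    by rewrite h1 ltry.
  apply: integral_ae_eq => // A _ mA.
  transitivity (\int[pX]_x (h x * (\1_A x)%:E)).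
    by rewrite integral_mkcond; apply: eq_integral => x _; rewrite epatch_indic.
  have mA1 : measurable_fun setT (fun z : T * T => (\1_A z.1)%:E : \bar R).
    exact: (measurableT_comp (emeasurable_indic mA) measurable_fst).
  transitivity (\int[J]_z (\1_A z.1)%:E).
    rewrite f1J//.
    rewrite QE//; last 2 first.
    - by move=> z; rewrite mule_ge0// lee_fin.
    - exact: emeasurable_funM.
    apply: eq_integral => x _ /=.
    rewrite -ge0_integralZr//.
    exact: (measurable_fun_section1 x mef1).
  rewrite Jg//.
  rewrite integral_cst// mul1e -integral_indicT//.
  apply: eq_integral => x _ /=.
  by rewrite integral_cst//= probability_setT mule1.
pose f z := (\1_G z.1 * f1 z + \1_(~` G) z.1)%R.
have mf : measurable_fun setT f.
  apply: measurable_funD.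
    apply: measurable_funM => //.
    by apply: (measurableT_comp (measurable_indic mG)).
  by apply: (measurableT_comp (measurable_indic (measurableC mG))).
have f0 z : (0 <= f z)%R by rewrite addr_ge0// mulr_ge0.
have fG x y : G x -> f (x, y) = f1 (x, y).
  by move=> Gx; rewrite /f/= !indicE mem_set// memNset ?addr0 ?mul1r//; apply.
have fNG x y : ~ G x -> f (x, y) = 1%R.
  by move=> Gx; rewrite /f/= !indicE memNset// mem_set// mul0r add0r.
have fJ (g : T * T -> \bar R) : (forall z, 0 <= g z) -> measurable_fun setT g ->
    \int[J]_z g z = \int[Q]_z ((f z)%:E * g z).
  move=> g0 mg; rewrite f1J//.
  have mf1g : measurable_fun setT (fun z => (f1 z)%:E * g z) by exact: emeasurable_funM.
  have mfg : measurable_fun setT (fun z => (f z)%:E * g z).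
    by apply: emeasurable_funM => //; exact/measurable_EFinP.
  have f1g0 z : 0 <= (f1 z)%:E * g z by rewrite mule_ge0.
  have fg0 z : 0 <= (f z)%:E * g z by rewrite mule_ge0// lee_fin.
  rewrite (QE _ f1g0 mf1g) (QE _ fg0 mfg).
  apply: ge0_ae_eq_integral => //.
  - exact: (measurable_fun_fubini_tonelli_F _ mf1g f1g0).
  - exact: (measurable_fun_fubini_tonelli_F _ mfg fg0).
  - by move=> x _; exact: integral_ge0.
  - by move=> x _; exact: integral_ge0.
  - apply: filterS hG => x /(_ I) hx _.
    by apply: eq_integral => y _; rewrite fG.
have [m [mm fm Em]] := density_label b MIc mf f0 fJ d0.
have mem : measurable_fun setT (fun z => (m z)%:R%:E : \bar R).
  by apply/measurable_EFinP; exact: (measurableT_comp (g := m)).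
have fE (g : T * T -> \bar R) : (forall z, 0 <= g z) -> measurable_fun setT g ->
    \int[J]_z g z = \int[pX]_x \int[pY]_y ((f (x, y))%:E * g (x, y)).
  move=> g0 mg; rewrite fJ// QE//.
    by move=> z; rewrite mule_ge0// lee_fin.
  by apply: emeasurable_funM => //; exact/measurable_EFinP.
exists f, m; split; split => //.
- move=> x; have [Gx|Gx] := pselect (G x).
    by under eq_integral do rewrite fG//; exact: Gx.
  under eq_integral do rewrite fNG//.
  by rewrite integral_cst//= mul1e probability_setT.
- by move=> g g0 mg; rewrite -Jg// fE.
- by rewrite -(fE (fun z => (m z)%:R%:E)).
Qed.

(** * Channel simulation by rejection sampling *)

Lemma nneseries_le {R : realType} (f : nat -> \bar R) (c : \bar R) :
  (forall i, 0 <= f i) -> (forall n, \sum_(0 <= i < n) f i <= c) ->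
  \sum_(0 <= i <oo) f i <= c.
Proof.
move=> f0 fc; apply: lime_le; last exact: nearW.
exact: is_cvg_nneseries.
Qed.

Lemma nneseries_recS {R : realType} (f : nat -> \bar R) :
  (forall i, 0 <= f i) ->
  \sum_(0 <= i <oo) f i = f 0%N + \sum_(0 <= i <oo) f i.+1.
Proof.
move=> f0; rewrite nneseries_recl//; congr (_ + _).
by rewrite -(nneseries_addn 1)//; apply: eq_eseriesr => i _; rewrite addn1.
Qed.

Lemma nneseriesZr {R : realType} (f : nat -> \bar R) (c : \bar R) :
  (forall i, 0 <= f i) -> 0 <= c ->
  \sum_(0 <= i <oo) (f i * c) = (\sum_(0 <= i <oo) f i) * c.
Proof.
move=> f0 c0; rewrite -!ge0_integral_count//; last by move=> i; rewrite mule_ge0.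
by rewrite ge0_integralZr.
Qed.

(** Messages are natural numbers, while the code has to send a level together with a sample
    index. *)
Lemma nneseries_pair {R : realType} : exists e : nat -> nat * nat,
  forall g : nat -> nat -> \bar R, (forall i j, 0 <= g i j) ->
    \sum_(0 <= z <oo) g (e z).1 (e z).2 =
    \sum_(0 <= i <oo) \sum_(0 <= j <oo) g i j.
Proof.
have /card_set_bijP[e be] : ([set: nat] #= [set: nat * nat])%card.
  by rewrite card_eq_sym; exact: card_nat2.
exists e => g g0.
rewrite nneseries_esumT//.
rewrite -(reindex_esum _ _ _ (fun p => g p.1 p.2) be).
have -> : [set: nat * nat] = [set: nat] `*`` (fun=> [set: nat]) by apply/seteqP.
rewrite -esum_esum// nneseries_esumT//; last by move=> i; exact: nneseries_ge0.
by apply: eq_esum => i _; rewrite nneseries_esumT.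
Qed.

Lemma nneseries_geometric {R : realType} (a : R) : (0 < a)%R -> (a <= 1)%R ->
  \sum_(0 <= j <oo) ((1 - a) ^+ j)%:E = (a^-1)%:E.
Proof.
move=> a0 a1.
have h : (`|1 - a| < 1)%R by rewrite ger0_norm ?subr_ge0//; lra.
have /cvg_lim <- // : (fun n => \sum_(0 <= j < n) ((1 - a) ^+ j)%:E) @ \oo --> (a^-1)%:E.
under eq_fun do rewrite sumEFin.
apply: cvg_EFin; first exact: nearW.
have := @cvg_geometric_series _ 1%R _ h.
rewrite opprB addrCA subrr addr0 mul1r.
by apply: cvg_trans; apply: near_eq_cvg; apply: nearW => n /=;
  rewrite /series/=; apply: eq_bigr => i _; rewrite mul1r.
Qed.

(** Up to the factor [a], this is the mean 1 / a of the number of trials until the first success.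
    The partial sums have a closed form with a nonnegative remainder. *)
Lemma geometric_mean_le {R : realType} (a : R) : (0 < a)%R -> (a <= 1)%R ->
  \sum_(0 <= j <oo) ((1 - a) ^+ j * j.+1%:R)%:E <= ((a * a)^-1)%:E.
Proof.
move=> a0 a1.
apply: nneseries_le => [i|n].
  by rewrite lee_fin mulr_ge0// exprn_ge0// subr_ge0.
rewrite sumEFin lee_fin.
have -> : (\sum_(0 <= i < n) (1 - a) ^+ i * i.+1%:R =
    (a * a)^-1 - (1 - a) ^+ n * ((a * a)^-1 + n%:R / a))%R.
  elim: n => [|n IH]; first by rewrite big_geq// expr0 mul0r addr0 mul1r subrr.
  rewrite big_nat_recr//= IH exprS -natr1; field.
  by rewrite gt_eqF.
rewrite gerBl mulr_ge0 ?exprn_ge0 ?subr_ge0// addr_ge0 ?invr_ge0 ?mulr_ge0 ?invr_ge0//; exact: ltW.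
Qed.

(** The chance that one of the first [n] trials succeeds, decomposed by the first success. *)
Lemma stick_breaking {R : realType} (a : nat -> R) n :
  (\sum_(0 <= j < n) (\prod_(i < j) (1 - a i)) * a j = 1 - \prod_(i < n) (1 - a i))%R.
Proof.
elim: n => [|n IH]; first by rewrite big_geq// big_ord0 subrr.
by rewrite big_nat_recr//= IH big_ord_recr/=; ring.
Qed.

(* Telescoping, of total mass at most 1; its tail is heavy enough that [- ln] grows only like
   [ln M + 2 ln (j / M)], so that an index of mean about [M] costs about [ln M] nats. *)
Definition tele_weight {R : realType} (M : R) (j : nat) : R :=
  (M / ((M + j%:R) * (M + j.+1%:R)))%R.

Lemma tele_weight_gt0 {R : realType} (M : R) j : (0 < M)%R -> (0 < tele_weight M j)%R.
Proof. by move=> M0; rewrite divr_gt0// mulr_gt0// ltr_wpDr. Qed.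

Lemma tele_weight_sum {R : realType} (M : R) n : (0 < M)%R ->
  (\sum_(0 <= j < n) tele_weight M j <= 1)%R.
Proof.
move=> M0.
have -> : (\sum_(0 <= j < n) tele_weight M j = 1 - M / (M + n%:R))%R.
  elim: n => [|n IH]; first by rewrite big_geq// addr0 divff ?subrr// gt_eqF.
  rewrite big_nat_recr//= IH /tele_weight -natr1; field.
  by apply/andP; split; rewrite gt_eqF// ?ltr_wpDr// ?addr_ge0.
by rewrite gerBl divr_ge0 ?ltW// ltr_wpDr.
Qed.

Lemma tele_weight_le1 {R : realType} (M : R) j : (0 < M)%R -> (tele_weight M j <= 1)%R.
Proof.
move=> M0; rewrite /tele_weight ler_pdivrMr ?mul1r; last first.
  by rewrite mulr_gt0// ltr_wpDr.
have j0 : (0 <= j%:R :> R)%R by [].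
have M2 : (0 <= M * M)%R by rewrite mulr_ge0 ?ltW.
have Mj : (0 <= M * j%:R)%R by apply: mulr_ge0 => //; exact: ltW.
have j2 : (0 <= j%:R * j%:R :> R)%R by rewrite mulr_ge0.
rewrite -natr1 (_ : (M + j%:R) * (M + (j%:R + 1)) =
  M + (M * M + 2 * (M * j%:R) + j%:R * j%:R + j%:R))%R; last ring.
lra.
Qed.

(* Linearizing the logarithm at [1 / v] makes the bound affine in the index [j]. *)
Lemma ln_tele_weight {R : realType} (mu v : R) j : (0 < v)%R -> (v <= 1)%R ->
  (- ln (tele_weight (expR mu) j) <=
   mu + 2 * - ln v + 2 * v / expR mu * j.+1%:R)%R.
Proof.
move=> v0 v1; set M := expR mu; have M0 : (0 < M)%R := expR_gt0 _.
have Mj i : (0 < M + i%:R)%R by rewrite ltr_wpDr.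
have tE : (- ln (tele_weight M j) = ln (M + j%:R) + ln (M + j.+1%:R) - mu)%R.
  rewrite /tele_weight lnM ?posrE ?invr_gt0 ?mulr_gt0//.
  rewrite lnV ?posrE ?mulr_gt0// lnM ?posrE// /M expRK; ring.
have jj : (ln (M + j%:R) <= ln (M + j.+1%:R))%R.
  by rewrite ler_ln ?posrE// lerD2l ler_nat.
have lE : (ln (M + j.+1%:R) = mu - ln v + ln (v * (1 + j.+1%:R / M)))%R.
  have -> : (M + j.+1%:R = M * (1 + j.+1%:R / M))%R by field; rewrite gt_eqF.
  have h0 : (0 < 1 + j.+1%:R / M)%R by rewrite ltr_wpDr// divr_ge0// ltW.
  by rewrite !lnM ?posrE// /M expRK; ring.
have := @ln_le_subr1 _ (v * (1 + j.+1%:R / M)).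
rewrite pmulr_rgt0// => /(_ _)/wrap[].
  by rewrite ltr_wpDr// divr_ge0// ltW.
rewrite tE; move: jj; rewrite lE.
have -> : (2 * v / M * j.+1%:R = 2 * (v * (j.+1%:R / M)))%R by ring.
rewrite mulrDr mulr1.
lra.
Qed.

Section channel_simulation.
Context {R : realType} {dS dT dU : measure_display} {S : measurableType dS}
  {T : measurableType dT} {U : measurableType dU}.
Variables (pS : probability S R) (mu : probability T R) (lam : probability U R).
Variable Y : nat -> U -> T.
Hypothesis mY : forall i, measurable_fun setT (Y i).
Hypothesis lawY : forall (c h : T -> \bar R) j,
  (forall x, 0 <= c x) -> measurable_fun setT c ->
  (forall x, 0 <= h x) -> measurable_fun setT h ->
  \int[lam]_u (\prod_(i < j) c (Y i u) * h (Y j u)) =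
  (\int[mu]_x c x) ^+ j * \int[mu]_x h x.
Variables (F : S * T -> R) (L : S * T -> nat) (lM : nat -> R).
Hypothesis mF : measurable_fun setT F.
Hypothesis F0 : forall z, (0 <= F z)%R.
Hypothesis F1 : forall x, \int[mu]_y (F (x, y))%:E = 1.
Hypothesis mL : measurable_fun setT L.
Hypothesis FM : forall z, (F z <= expR (lM (L z)))%R.

(** The part of the density on one level. It is not normalized, but it obeys the bound of its own
    level, so that every level has its own rejection sampler. *)
Definition level_density l z : R := (F z * (L z == l)%:R)%R.

Lemma level_density_ge0 l z : (0 <= level_density l z)%R.
Proof. by rewrite mulr_ge0. Qed.

Lemma level_density_le l z : (level_density l z <= expR (lM l))%R.
Proof.
rewrite /level_density; case: eqP => [<-|_]; first by rewrite mulr1.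
by rewrite mulr0 expR_ge0.
Qed.

Lemma measurable_level_density l : measurable_fun setT (level_density l).
Proof.
apply: measurable_funM => //.
by apply: (@measurableT_comp _ _ _ _ _ _ (fun n : nat => (n == l)%:R : R) _ L).
Qed.

Lemma level_density_sum z (g : nat -> \bar R) : (forall l, 0 <= g l) ->
  \sum_(0 <= l <oo) ((level_density l z)%:E * g l) = (F z)%:E * g (L z).
Proof.
move=> g0; rewrite (nneseriesD1 (n := L z))//; last first.
  by move=> l _; rewrite mule_ge0// lee_fin level_density_ge0.
rewrite eseries0 ?adde0; first by rewrite /level_density eqxx mulr1.
by move=> l _ /andP[_ /negPf h]; rewrite /level_density eq_sym h mulr0 mul0e.
Qed.

(** The probability with which the encoder draws level [l] on input [x]. *)
Definition level_mass l x : R := fine (\int[mu]_y (level_density l (x, y))%:E).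

Lemma measurable_level_section l x :
  measurable_fun setT (fun y => (level_density l (x, y))%:E).
Proof.
apply: (@measurable_fun_section1 _ _ _ _ _ (fun z => (level_density l z)%:E)).
by apply/measurable_EFinP; exact: measurable_level_density.
Qed.

Lemma level_massE l x : (level_mass l x)%:E = \int[mu]_y (level_density l (x, y))%:E.
Proof.
rewrite fineK// ge0_fin_numE; last by apply: integral_ge0 => y _; rewrite lee_fin level_density_ge0.
apply: le_lt_trans (ltry 1%R); rewrite -(F1 x); apply: ge0_le_integral => //.
- by move=> y _; rewrite lee_fin level_density_ge0.
- exact: measurable_level_section.
- apply: (@measurable_fun_section1 _ _ _ _ _ (fun z => (F z)%:E)).
  exact/measurable_EFinP.
- move=> y _; rewrite lee_fin ler_piMr//; by case: eqP.
Qed.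

Lemma level_mass_ge0 l x : (0 <= level_mass l x)%R.
Proof.
by rewrite -lee_fin level_massE; apply: integral_ge0 => y _; rewrite lee_fin level_density_ge0.
Qed.

Lemma level_mass_sum x : \sum_(0 <= l <oo) (level_mass l x)%:E = 1.
Proof.
under eq_eseriesr do rewrite level_massE.
rewrite -integral_nneseries//; last 2 first.
- by move=> l; exact: measurable_level_section.
- by move=> l y _; rewrite lee_fin level_density_ge0.
rewrite -(F1 x); apply: eq_integral => y _.
rewrite -[RHS]mule1 -(level_density_sum _ (g := cst 1))//.
by apply: eq_eseriesr => l _; rewrite mule1.
Qed.

Lemma measurable_level_mass l : measurable_fun setT (level_mass l).
Proof.
apply: measurableT_comp => //.
apply: (@measurable_fun_fubini_tonelli_F _ _ _ _ _ mu (fun z => (level_density l z)%:E)).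
  by apply/measurable_EFinP; exact: measurable_level_density.
by move=> z; rewrite lee_fin level_density_ge0.
Qed.

Definition accept l z : R := (level_density l z / expR (lM l))%R.

Lemma accept_ge0 l z : (0 <= accept l z)%R.
Proof. by rewrite divr_ge0 ?level_density_ge0 ?expR_ge0. Qed.

Lemma accept_le1 l z : (accept l z <= 1)%R.
Proof. by rewrite ler_pdivrMr ?expR_gt0// mul1r level_density_le. Qed.

Lemma measurable_accept l : measurable_fun setT (accept l).
Proof. by apply: measurable_funM => //; exact: measurable_level_density. Qed.

(** The chance, given the codebook, that proposal [j] is the first one accepted. The acceptance
    coins belong to the encoder kernel and are averaged out. *)
Definition select l j (xu : S * U) : R :=
  ((\prod_(i < j) (1 - accept l (xu.1, Y i xu.2))) * accept l (xu.1, Y j xu.2))%R.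

Lemma select_ge0 l j xu : (0 <= select l j xu)%R.
Proof.
rewrite mulr_ge0 ?accept_ge0// prodr_ge0// => i _.
by rewrite subr_ge0 accept_le1.
Qed.

Lemma select_sum_le1 l xu n : (\sum_(0 <= j < n) select l j xu <= 1)%R.
Proof.
rewrite (stick_breaking (fun j => accept l (xu.1, Y j xu.2))) gerBl prodr_ge0// => i _.
by rewrite subr_ge0 accept_le1.
Qed.

Lemma measurable_sample i : measurable_fun setT (fun xu : S * U => (xu.1, Y i xu.2)).
Proof.
apply/measurable_fun_pairP; split; first exact: measurable_fst.
exact: (measurableT_comp (mY i) measurable_snd).
Qed.

Lemma measurable_select l j : measurable_fun setT (select l j).
Proof.
apply: measurable_funM; last first.
  exact: (measurableT_comp (measurable_accept l) (measurable_sample j)).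
apply: measurable_prod => i _.
apply: measurable_funB => //.
exact: (measurableT_comp (measurable_accept l) (measurable_sample i)).
Qed.

Definition accept_mean l x : R := (level_mass l x / expR (lM l))%R.

Lemma accept_meanE l x : \int[mu]_y (accept l (x, y))%:E = (accept_mean l x)%:E.
Proof.
rewrite /accept_mean mulrC EFinM level_massE -integralZ_ge0.
- by apply: eq_integral => y _; rewrite /accept mulrC EFinM.
- by rewrite invr_ge0 expR_ge0.
- by move=> y; rewrite lee_fin level_density_ge0.
- exact: measurable_level_section.
Qed.

Lemma measurable_accept_section l x : measurable_fun setT (fun y => accept l (x, y)).
Proof. exact: (measurableT_comp (measurable_accept l) (pair1_measurable x)). Qed.

Lemma reject_meanE l x : \int[mu]_y (1 - accept l (x, y))%:E = (1 - accept_mean l x)%:E.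
Proof.
have h : \int[mu]_y (1 - accept l (x, y))%:E + (accept_mean l x)%:E = 1.
  rewrite -accept_meanE -ge0_integralD//; last 4 first.
  - by move=> y _; rewrite lee_fin subr_ge0 accept_le1.
  - apply/measurable_EFinP; apply: measurable_funB => //.
    exact: measurable_accept_section.
  - by move=> y _; rewrite lee_fin accept_ge0.
  - by apply/measurable_EFinP; exact: measurable_accept_section.
  under eq_integral do rewrite -EFinD subrK.
  by rewrite integral_cst//= mul1e probability_setT.
by rewrite EFinB -h addeK.
Qed.

Lemma accept_mean_le1 l x : (accept_mean l x <= 1)%R.
Proof.
rewrite -subr_ge0 -lee_fin -reject_meanE; apply: integral_ge0 => y _.
by rewrite lee_fin subr_ge0 accept_le1.
Qed.

Lemma select_law l j x (h : T -> \bar R) : (forall y, 0 <= h y) -> measurable_fun setT h ->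
  \int[lam]_u ((select l j (x, u))%:E * h (Y j u)) =
  ((1 - accept_mean l x) ^+ j / expR (lM l))%:E *
    \int[mu]_y ((level_density l (x, y))%:E * h y).
Proof.
move=> h0 mh.
have mah : measurable_fun setT (fun y => (accept l (x, y))%:E * h y).
  apply: emeasurable_funM => //; apply/measurable_EFinP.
  exact: measurable_accept_section.
rewrite EFinM -muleA -integralZ_ge0; last 3 first.
- by rewrite invr_ge0 expR_ge0.
- by move=> y; rewrite mule_ge0// lee_fin level_density_ge0.
- by apply: emeasurable_funM => //; exact: measurable_level_section.
rewrite EFin_expe -reject_meanE.
rewrite (_ : \int[mu]_x0 (_ * (_ * _)) = \int[mu]_y ((accept l (x, y))%:E * h y)); last first.
  by apply: eq_integral => y _; rewrite /accept muleA -EFinM mulrC.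
rewrite -(@lawY (fun y => (1 - accept l (x, y))%:E) _ j)//; last 3 first.
- by move=> y; rewrite lee_fin subr_ge0 accept_le1.
- apply/measurable_EFinP; apply: measurable_funB => //.
  exact: measurable_accept_section.
- by move=> y; rewrite mule_ge0// lee_fin accept_ge0.
apply: eq_integral => u _.
by rewrite /select/= EFinM prodEFin muleA.
Qed.

(** On a level of mass 0 the geometric series in [select_series] has ratio 1, and the case must be
    treated apart. *)
Lemma level_null l x (h : T -> \bar R) : (forall y, 0 <= h y) -> measurable_fun setT h ->
  level_mass l x = 0%R -> \int[mu]_y ((level_density l (x, y))%:E * h y) = 0.
Proof.
move=> h0 mh pi0.
have ld0 y : 0 <= (level_density l (x, y))%:E :> \bar R by rewrite lee_fin level_density_ge0.
have ae0 : ae_eq mu setT (fun y => (level_density l (x, y))%:E) (cst 0).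
  apply/ae_eq_integral_abs => //; first exact: measurable_level_section.
  under eq_integral do rewrite gee0_abs//.
  by rewrite -level_massE pi0.
rewrite (ge0_ae_eq_integral (g := cst 0))//.
- exact: integral0.
- by apply: emeasurable_funM => //; exact: measurable_level_section.
- by move=> y _; rewrite mule_ge0.
- by apply: filterS ae0 => y hy _; rewrite hy// mul0e.
Qed.

Lemma select_series l x (h : T -> \bar R) : (forall y, 0 <= h y) -> measurable_fun setT h ->
  \sum_(0 <= j <oo) \int[lam]_u ((level_mass l x * select l j (x, u))%:E * h (Y j u)) =
  \int[mu]_y ((level_density l (x, y))%:E * h y).
Proof.
move=> h0 mh.
have I0 : 0 <= \int[mu]_y ((level_density l (x, y))%:E * h y).
  by apply: integral_ge0 => y _; rewrite mule_ge0// lee_fin level_density_ge0.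
have E j : \int[lam]_u ((level_mass l x * select l j (x, u))%:E * h (Y j u)) =
    (accept_mean l x * (1 - accept_mean l x) ^+ j)%:E *
    \int[mu]_y ((level_density l (x, y))%:E * h y).
  under eq_integral do rewrite EFinM -muleA.
  rewrite integralZ_ge0 ?level_mass_ge0//; last 2 first.
  - by move=> u; rewrite mule_ge0// lee_fin select_ge0.
  - apply: emeasurable_funM; last exact: measurableT_comp.
    by apply/measurable_EFinP; apply: (measurableT_comp (measurable_select l j)).
  rewrite select_law// muleA -EFinM; congr (_%:E * _).
  by rewrite /accept_mean; ring.
under eq_eseriesr do rewrite E.
have [pi0|piN0] := eqVneq (level_mass l x) 0%R.
  rewrite level_null//; under eq_eseriesr do rewrite mule0.
  by rewrite eseries0.
have am0 : (0 < accept_mean l x)%R.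
  by rewrite divr_gt0 ?expR_gt0// lt_neqAle eq_sym piN0 level_mass_ge0.
have q0 j : (0 <= (1 - accept_mean l x) ^+ j)%R.
  by rewrite exprn_ge0// subr_ge0 accept_mean_le1.
rewrite nneseriesZr//; last by move=> j; rewrite lee_fin; apply: mulr_ge0 => //; exact: ltW.
under eq_eseriesr do rewrite EFinM.
rewrite nneseriesZl//; last by move=> j _; rewrite lee_fin.
by rewrite nneseries_geometric ?accept_mean_le1// -EFinM divff ?gt_eqF// mul1e.
Qed.

Lemma level_density_integral_sum x (h : T -> \bar R) :
  (forall y, 0 <= h y) -> measurable_fun setT h ->
  \sum_(0 <= l <oo) \int[mu]_y ((level_density l (x, y))%:E * h y) =
  \int[mu]_y ((F (x, y))%:E * h y).
Proof.
move=> h0 mh; rewrite -integral_nneseries//; last 2 first.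
- by move=> l; apply: emeasurable_funM => //; exact: measurable_level_section.
- by move=> l y _; rewrite mule_ge0// lee_fin level_density_ge0.
by apply: eq_integral => y _; rewrite (level_density_sum _ (g := fun=> h y)).
Qed.

Lemma level_mass_weighted_sum x (a : nat -> R) : (forall l, (0 <= a l)%R) ->
  \sum_(0 <= l <oo) (level_mass l x * a l)%:E =
  \int[mu]_y ((F (x, y))%:E * (a (L (x, y)))%:E).
Proof.
move=> a0.
transitivity (\sum_(0 <= l <oo) \int[mu]_y ((level_density l (x, y))%:E * (a l)%:E)).
  apply: eq_eseriesr => l _; rewrite EFinM level_massE muleC -integralZ_ge0//.
  - by apply: eq_integral => y _; rewrite muleC.
  - by move=> y; rewrite lee_fin level_density_ge0.
  - exact: measurable_level_section.
rewrite -integral_nneseries//; last 2 first.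
- by move=> l; apply: emeasurable_funM => //; exact: measurable_level_section.
- by move=> l y _; rewrite mule_ge0// lee_fin ?level_density_ge0.
apply: eq_integral => y _; apply: (level_density_sum _ (g := fun l => (a l)%:E)).
by move=> l; rewrite lee_fin.
Qed.

Lemma select_mean l j x :
  \int[lam]_u (level_mass l x * select l j (x, u))%:E =
  (level_mass l x * (accept_mean l x * (1 - accept_mean l x) ^+ j))%:E.
Proof.
under eq_integral do rewrite EFinM.
rewrite integralZ_ge0 ?level_mass_ge0//; last 2 first.
- by move=> u; rewrite lee_fin select_ge0.
- by apply/measurable_EFinP; apply: (measurableT_comp (measurable_select l j)).
rewrite EFinM; congr (_ * _).
transitivity (\int[lam]_u ((select l j (x, u))%:E * cst 1 (Y j u))).
  by apply: eq_integral => u _; rewrite mule1.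
rewrite (select_law _ _ _ (h := cst 1))//.
under eq_integral do rewrite mule1.
by rewrite -level_massE -EFinM /accept_mean; congr EFin; ring.
Qed.

(** The mean number of proposals is e^(lM l) divided by [level_mass l x]. Weighted by the
    probability of the level it is e^(lM l) whatever [x] is: rare levels wait long but are drawn
    seldom. *)
Lemma select_cost_le l x (al be : R) : (0 <= al)%R -> (0 <= be)%R ->
  \sum_(0 <= j <oo) ((al + be * j.+1%:R)%:E *
    \int[lam]_u (level_mass l x * select l j (x, u))%:E) <=
  (level_mass l x * al + be * expR (lM l))%:E.
Proof.
move=> al0 be0.
have pi0 := level_mass_ge0 l x.
under eq_eseriesr do rewrite select_mean -EFinM.
have [piE|piN0] := eqVneq (level_mass l x) 0%R.
  rewrite eseries0; first by rewrite lee_fin piE mul0r add0r mulr_ge0// expR_ge0.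
  by move=> j _ _; rewrite piE mul0r mulr0.
have pi1 : (0 < level_mass l x)%R by rewrite lt_neqAle eq_sym piN0.
have am0 : (0 < accept_mean l x)%R by rewrite divr_gt0 ?expR_gt0.
have am1 := accept_mean_le1 l x.
set a := accept_mean l x in am0 am1 *; set p := level_mass l x in pi0 pi1 *.
have q0 j : (0 <= (1 - a) ^+ j)%R by rewrite exprn_ge0// subr_ge0.
have E j : ((al + be * j.+1%:R) * (p * (a * (1 - a) ^+ j)))%:E =
   (p * al * a)%:E * ((1 - a) ^+ j)%:E +
   (p * be * a)%:E * ((1 - a) ^+ j * j.+1%:R)%:E.
  by rewrite -!EFinM -EFinD; congr EFin; ring.
under eq_eseriesr do rewrite E.
rewrite nneseriesD//; last 2 first.
- by move=> j _; rewrite -EFinM lee_fin !mulr_ge0// ltW.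
- by move=> j _; rewrite -EFinM lee_fin !mulr_ge0// ltW.
rewrite !nneseriesZl//; last 2 first.
- by move=> j _; rewrite lee_fin mulr_ge0.
- by move=> j _; rewrite lee_fin.
rewrite nneseries_geometric// EFinD; apply: leeD.
  by rewrite -EFinM lee_fin mulfK// gt_eqF.
apply: (@le_trans _ _ ((p * be * a)%:E * ((a * a)^-1)%:E)).
  apply: lee_wpmul2l; first by rewrite lee_fin !mulr_ge0// ltW.
  exact: geometric_mean_le.
rewrite -EFinM lee_fin.
have -> : (p = a * expR (lM l))%R by rewrite /a /accept_mean divfK// gt_eqF// expR_gt0.
rewrite le_eqVlt; apply/orP; left; apply/eqP; field.
by rewrite gt_eqF.
Qed.

Variable e : nat -> nat * nat.
Hypothesis eP : forall g : nat -> nat -> \bar R, (forall i j, 0 <= g i j) ->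
  \sum_(0 <= z <oo) g (e z).1 (e z).2 = \sum_(0 <= i <oo) \sum_(0 <= j <oo) g i j.

Definition enc_tail z (xu : S * U) : R :=
  (level_mass (e z).1 xu.1 * select (e z).1 (e z).2 xu)%R.

Lemma enc_tail_ge0 z xu : (0 <= enc_tail z xu)%R.
Proof. by rewrite mulr_ge0 ?level_mass_ge0 ?select_ge0. Qed.

Lemma measurable_enc_tail z : measurable_fun setT (enc_tail z).
Proof.
apply: measurable_funM; last exact: measurable_select.
exact: (measurableT_comp (measurable_level_mass _) measurable_fst).
Qed.

Lemma enc_tail_sum_le1 xu : \sum_(0 <= z <oo) (enc_tail z xu)%:E <= 1.
Proof.
rewrite (eP (g := fun l j => (level_mass l xu.1 * select l j xu)%:E)); last first.
  by move=> l j; rewrite lee_fin mulr_ge0 ?level_mass_ge0 ?select_ge0.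
rewrite -(level_mass_sum xu.1); apply: lee_nneseries => l.
  move=> _ _; apply: nneseries_ge0 => j _ _.
  by rewrite lee_fin mulr_ge0 ?level_mass_ge0 ?select_ge0.
move=> _; under eq_eseriesr do rewrite EFinM.
rewrite nneseriesZl; last by move=> j _; rewrite lee_fin select_ge0.
rewrite -[leRHS]mule1; apply: lee_wpmul2l; first by rewrite lee_fin level_mass_ge0.
apply: nneseries_le => [j|n]; first by rewrite lee_fin select_ge0.
by rewrite sumEFin lee_fin select_sum_le1.
Qed.

(* Message 0 is only sent when no proposal is ever accepted. *)
Definition enc (z : nat) (xu : S * U) : R :=
  if z is z'.+1 then enc_tail z' xu
  else (1 - fine (\sum_(0 <= z <oo) (enc_tail z xu)%:E))%R.

Lemma enc_tail_sum_ge0 xu : 0 <= \sum_(0 <= z <oo) (enc_tail z xu)%:E.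
Proof. by apply: nneseries_ge0 => z _ _; rewrite lee_fin enc_tail_ge0. Qed.

Lemma enc_tail_sum_fin xu : \sum_(0 <= z <oo) (enc_tail z xu)%:E \is a fin_num.
Proof.
rewrite ge0_fin_numE ?enc_tail_sum_ge0//.
exact: le_lt_trans (enc_tail_sum_le1 _) (ltry _).
Qed.

Lemma enc_ge0 z xu : (0 <= enc z xu)%R.
Proof.
case: z => [|z] /=; last exact: enc_tail_ge0.
by rewrite subr_ge0 -lee_fin fineK ?enc_tail_sum_fin// enc_tail_sum_le1.
Qed.

Lemma enc_sum xu : \sum_(0 <= z <oo) (enc z xu)%:E = 1.
Proof.
rewrite nneseries_recS/=; last by move=> z; rewrite lee_fin enc_ge0.
by rewrite EFinB fineK ?enc_tail_sum_fin// subeK// enc_tail_sum_fin.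
Qed.

Lemma measurable_enc z : measurable_fun setT (enc z).
Proof.
case: z => [|z]; last exact: measurable_enc_tail.
apply: measurable_funB => //; apply: measurableT_comp => //.
apply: ge0_emeasurable_sum => [z xu _ _|z _]; first by rewrite lee_fin enc_tail_ge0.
by apply/measurable_EFinP; exact: measurable_enc_tail.
Qed.

Lemma measurable_enc_section z x : measurable_fun setT (fun u => (enc z (x, u))%:E).
Proof.
apply/measurable_EFinP.
exact: (measurableT_comp (measurable_enc z) (pair1_measurable x)).
Qed.

(** Index 0 for message 0 is a default value; on average over the codebook that message has
    probability 0, by [enc0_null]. *)
Definition sample_index (z : nat) : nat := if z is z'.+1 then (e z').2 else 0%N.

Definition dec (z : nat) (u : U) : probability T R := dirac (Y (sample_index z) u).

Lemma markov_dec z : markov_kernel (dec z).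
Proof.
move=> A mA; rewrite /dec.
apply: (measurableT_comp (emeasurable_indic mA) (mY (sample_index z))).
Qed.

Lemma enc_tail_law x (h : T -> \bar R) : (forall y, 0 <= h y) -> measurable_fun setT h ->
  \int[lam]_u (\sum_(0 <= z <oo) ((enc_tail z (x, u))%:E * h (Y (e z).2 u))) =
  \int[mu]_y ((F (x, y))%:E * h y).
Proof.
move=> h0 mh; rewrite integral_nneseries//; last 2 first.
- move=> z; apply: emeasurable_funM; last exact: measurableT_comp.
  exact: (measurable_enc_section z.+1).
- by move=> z u _; rewrite mule_ge0// lee_fin enc_tail_ge0.
rewrite (eP (g := fun l j =>
  \int[lam]_u ((level_mass l x * select l j (x, u))%:E * h (Y j u)))); last first.
  move=> l j; apply: integral_ge0 => u _.
  by rewrite mule_ge0// lee_fin mulr_ge0 ?level_mass_ge0 ?select_ge0.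
by rewrite -level_density_integral_sum//; apply: eq_eseriesr => l _; rewrite select_series.
Qed.

(** With h = 1, [enc_tail_law] gives the other messages mean total mass 1, so nothing is left for
    message 0. *)
Lemma enc0_null x : \int[lam]_u (enc 0 (x, u))%:E = 0.
Proof.
have h : \int[lam]_u (enc 0 (x, u))%:E + 1 = 1.
  have {1}<- : \int[lam]_u (\sum_(0 <= z <oo) (enc_tail z (x, u))%:E) = 1.
    rewrite -[RHS](F1 x).
    transitivity (\int[lam]_u (\sum_(0 <= z <oo)
        ((enc_tail z (x, u))%:E * cst 1 (Y (e z).2 u)))).
      apply: eq_integral => u _; apply: eq_eseriesr => z _.
      by rewrite mule1.
    rewrite enc_tail_law//.
    by apply: eq_integral => y _; rewrite mule1.
  rewrite -ge0_integralD//; last 4 first.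
  - by move=> u _; rewrite lee_fin enc_ge0.
  - exact: measurable_enc_section.
  - by move=> u _; exact: enc_tail_sum_ge0.
  - apply: ge0_emeasurable_sum => [z u _ _|z _]; first by rewrite lee_fin enc_tail_ge0.
    exact: (measurable_enc_section z.+1).
  transitivity (\int[lam]_u (cst 1 u)); last first.
    by rewrite integral_cst// mul1e; exact: probability_setT.
  apply: eq_integral => u _; rewrite /cst -(enc_sum (x, u)) [RHS]nneseries_recS// => z.
  by rewrite lee_fin enc_ge0.
have fin : \int[lam]_u (enc 0 (x, u))%:E \is a fin_num.
  rewrite ge0_fin_numE; last by apply: integral_ge0 => u _; rewrite lee_fin enc_ge0.
  by rewrite (@le_lt_trans _ _ 1) ?ltry// -[leRHS]h leeDl.
by move: h; rewrite -(fineK fin) -EFinD => -[] /(canRL (addrK _)) ->; rewrite subrr.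
Qed.

Lemma enc0_null_mul x (h : U -> \bar R) : (forall u, 0 <= h u) -> measurable_fun setT h ->
  \int[lam]_u ((enc 0 (x, u))%:E * h u) = 0.
Proof.
move=> h0 mh.
have ae0 : ae_eq lam setT (fun u => (enc 0 (x, u))%:E) (cst 0).
  apply/ae_eq_integral_abs => //; first exact: measurable_enc_section.
  rewrite -[RHS](enc0_null x); apply: eq_integral => u _.
  by rewrite gee0_abs// lee_fin enc_ge0.
rewrite (ge0_ae_eq_integral (g := cst 0))//.
- exact: integral0.
- by apply: emeasurable_funM => //; exact: measurable_enc_section.
- by move=> y _; rewrite mule_ge0// lee_fin enc_ge0.
- by apply: filterS ae0 => y hy _; rewrite hy// mul0e.
Qed.

Lemma simulation_law x (h : T -> \bar R) : (forall y, 0 <= h y) -> measurable_fun setT h ->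
  \int[lam]_u (\sum_(0 <= z <oo) ((enc z (x, u))%:E * \int[dec z u]_y h y)) =
  \int[mu]_y ((F (x, y))%:E * h y).
Proof.
move=> h0 mh.
have E z u : \int[dec z u]_y h y = h (Y (sample_index z) u).
  by rewrite /dec integral_dirac// diracT mul1e.
have t0 z u : 0 <= (enc z (x, u))%:E * h (Y (sample_index z) u).
  by rewrite mule_ge0// lee_fin enc_ge0.
have mt z : measurable_fun setT (fun u => (enc z (x, u))%:E * h (Y (sample_index z) u)).
  by apply: emeasurable_funM; [exact: measurable_enc_section|exact: measurableT_comp].
under eq_integral => u _.
  under eq_eseriesr do rewrite E.
  rewrite nneseries_recS//; over.
rewrite ge0_integralD//; last 2 first.
- by move=> u _; exact: nneseries_ge0.
- by apply: ge0_emeasurable_sum => // z u _ _.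
rewrite enc0_null_mul ?add0e; last 2 first.
- by [].
- exact: measurableT_comp.
exact: enc_tail_law.
Qed.

(** The cost of message 0 has no affine bound, but its mean probability is 0; the other messages are
    charged level by level through [select_cost_le]. *)
Lemma enc_cost_le x (c : nat -> R) (al be : nat -> R) :
  (forall z, (0 <= c z)%R) -> (forall l, (0 <= al l)%R) -> (forall l, (0 <= be l)%R) ->
  (forall z, (c z.+1 <= al (e z).1 + be (e z).1 * (e z).2.+1%:R)%R) ->
  \int[lam]_u (\sum_(0 <= z <oo) ((enc z (x, u))%:E * (c z)%:E)) <=
  \sum_(0 <= l <oo) (level_mass l x * al l + be l * expR (lM l))%:E.
Proof.
move=> c0 al0 be0 cle.
have t0 z u : 0 <= (enc z (x, u))%:E * (c z)%:E.
  by rewrite mule_ge0 ?lee_fin ?enc_ge0.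
have mt z : measurable_fun setT (fun u => (enc z (x, u))%:E * (c z)%:E).
  by apply: emeasurable_funM => //; exact: measurable_enc_section.
rewrite integral_nneseries// nneseries_recS; last by move=> z; exact: integral_ge0.
rewrite enc0_null_mul ?add0e; last 2 first.
- by move=> u; rewrite lee_fin.
- exact: measurable_cst.
have ab0 l j : (0 <= al l + be l * j.+1%:R)%R by rewrite addr_ge0// mulr_ge0.
apply: (@le_trans _ _ (\sum_(0 <= z <oo) ((al (e z).1 + be (e z).1 * (e z).2.+1%:R)%:E *
    \int[lam]_u (level_mass (e z).1 x * select (e z).1 (e z).2 (x, u))%:E))).
  apply: lee_nneseries => [z _ _|z _]; first exact: integral_ge0.
  rewrite -integralZ_ge0//; last 2 first.
  - by move=> u; rewrite lee_fin; exact: (enc_tail_ge0 z (x, u)).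
  - exact: (measurable_enc_section z.+1).
  apply: ge0_le_integral => //.
  - by apply: emeasurable_funM => //; exact: (measurable_enc_section z.+1).
  - move=> u _; rewrite muleC; apply: lee_wpmul2r.
      by rewrite lee_fin; exact: (enc_tail_ge0 z (x, u)).
    by rewrite lee_fin.
rewrite (eP (g := fun l j => (al l + be l * j.+1%:R)%:E *
    \int[lam]_u (level_mass l x * select l j (x, u))%:E)); last first.
  move=> l j; rewrite mule_ge0 ?lee_fin//; apply: integral_ge0 => u _.
  by rewrite lee_fin mulr_ge0 ?level_mass_ge0 ?select_ge0.
apply: lee_nneseries => [l _ _|l _]; last exact: select_cost_le.
apply: nneseries_ge0 => j _ _.
rewrite mule_ge0 ?lee_fin//; apply: integral_ge0 => u _.
by rewrite lee_fin mulr_ge0 ?level_mass_ge0 ?select_ge0.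
Qed.

(** * Entropy of the message *)

Definition msg_prob z u : \bar R := \int[pS]_x (enc z (x, u))%:E.

Lemma msg_prob_ge0 z u : 0 <= msg_prob z u.
Proof. by apply: integral_ge0 => x _; rewrite lee_fin enc_ge0. Qed.

Lemma measurable_enc_section2 z u : measurable_fun setT (fun x => (enc z (x, u))%:E).
Proof.
apply/measurable_EFinP.
exact: (measurableT_comp (measurable_enc z) (pair2_measurable u)).
Qed.

Lemma msg_prob_sum u : \sum_(0 <= z <oo) msg_prob z u = 1.
Proof.
rewrite -integral_nneseries//; last 2 first.
- by move=> z; exact: measurable_enc_section2.
- by move=> z x _; rewrite lee_fin enc_ge0.
under eq_integral do rewrite enc_sum.
by rewrite integral_cst//= mul1e probability_setT.
Qed.

Lemma msg_prob_le1 z u : msg_prob z u <= 1.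
Proof.
rewrite -(msg_prob_sum u) (nneseriesD1 (n := z))//; last by move=> k _; exact: msg_prob_ge0.
by rewrite leeDl//; apply: nneseries_ge0 => k _ _; exact: msg_prob_ge0.
Qed.

Lemma measurable_msg_prob z : measurable_fun setT (msg_prob z).
Proof.
apply: (@measurable_fun_fubini_tonelli_G _ _ _ _ _ pS (fun z' => (enc z z')%:E)).
  by apply/measurable_EFinP; exact: measurable_enc.
by move=> xu; rewrite lee_fin enc_ge0.
Qed.

Variables (kap : R) (v : nat -> R).
Hypothesis kap0 : (0 <= kap)%R.
Hypothesis lMkap : forall l, (0 <= lM l + kap)%R.
Hypothesis v0 : forall l, (0 < v l)%R.
Hypothesis v1 : forall l, (v l <= 1)%R.
Hypothesis vsum : \sum_(0 <= l <oo) (v l)%:E <= 1.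

(* Sub-probability weights (up to the constant 2) that do not depend on the shared randomness:
   by Gibbs' inequality [- ln msg_weight] bounds the conditional entropy of the message. *)
Definition msg_weight z : R :=
  if z is z'.+1 then (v (e z').1 * tele_weight (expR (lM (e z').1)) (e z').2)%R
  else 1%R.

Lemma msg_weight_gt0 z : (0 < msg_weight z)%R.
Proof. by case: z => //= z; rewrite mulr_gt0 ?tele_weight_gt0 ?expR_gt0. Qed.

Lemma msg_weight_le1 z : (msg_weight z <= 1)%R.
Proof.
case: z => //= z; rewrite -[leRHS]mul1r; apply: ler_pM => //.
- exact: ltW.
- exact/ltW/tele_weight_gt0/expR_gt0.
- exact/tele_weight_le1/expR_gt0.
Qed.

Lemma msg_weight_sum : \sum_(0 <= z <oo) (msg_weight z)%:E <= 2%:E.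
Proof.
rewrite nneseries_recS/=; last by move=> z; rewrite lee_fin ltW ?msg_weight_gt0.
rewrite (_ : 2%:E = 1 + 1 :> \bar R)//; apply: leeD => //.
have t0 l j : (0 <= v l * tele_weight (expR (lM l)) j)%R.
  by rewrite mulr_ge0 ?ltW ?tele_weight_gt0 ?expR_gt0.
rewrite (eP (g := fun l j => (v l * tele_weight (expR (lM l)) j)%:E)); last first.
  by move=> l j; rewrite lee_fin.
apply: le_trans vsum; apply: lee_nneseries => [l _ _|l _].
  by apply: nneseries_ge0 => j _ _; rewrite lee_fin.
under eq_eseriesr do rewrite EFinM.
rewrite nneseriesZl; last by move=> j _; rewrite lee_fin ltW ?tele_weight_gt0 ?expR_gt0.
rewrite -[leRHS]mule1; apply: lee_wpmul2l; first by rewrite lee_fin ltW.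
apply: nneseries_le => [j|n]; first by rewrite lee_fin ltW ?tele_weight_gt0 ?expR_gt0.
by rewrite sumEFin lee_fin tele_weight_sum ?expR_gt0.
Qed.

(** Gibbs' inequality term by term; the slack [w] will be summed over all messages. *)
Lemma negplogp_le (p : \bar R) (w : R) : (0 <= fine p)%R -> (0 < w)%R ->
  negplogp p <= (fine p * - ln w + w)%:E.
Proof.
move=> p0 w0; rewrite /negplogp lee_fin; move: (fine p) p0 => {}p p0.
have [->|pN0] := eqVneq p 0%R; first by rewrite !mul0r oppr0 mul0r add0r ltW.
have {}p0 : (0 < p)%R by rewrite lt_neqAle eq_sym pN0.
have := @ln_le_subr1 _ (w / p); rewrite divr_gt0// => /(_ isT).
rewrite lnM ?posrE ?invr_gt0// lnV ?posrE// => h.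
have : (p * (ln w - ln p) <= p * (w / p - 1))%R by rewrite ler_pM2l.
have -> : (p * (w / p - 1) = w - p)%R by field; rewrite gt_eqF.
lra.
Qed.

Lemma negplogp_ge0 (p : \bar R) : 0 <= p -> p <= 1 -> 0 <= negplogp p.
Proof.
move=> p0 p1; rewrite /negplogp lee_fin mulNr oppr_ge0 mulr_ge0_le0 ?fine_ge0//.
apply: ln_le0; rewrite -lee_fin fineK// ge0_fin_numE//.
exact: le_lt_trans p1 (ltry _).
Qed.

Lemma measurable_negplogp {d'} {V : measurableType d'} (p : V -> \bar R) :
  measurable_fun setT p -> measurable_fun setT (fun x => negplogp (p x)).
Proof.
move=> mp; apply/measurable_EFinP; apply: measurable_funM.
  by apply: measurableT_comp => //; exact: measurableT_comp.
by apply: (measurableT_comp (@measurable_ln R)); exact: measurableT_comp.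
Qed.

(** In the constant 4, one half bounds the total [msg_weight] and the other half the sum of 2 [v l].
    The factor 3 is 1 for the weight of the level and 2 from [ln_tele_weight]. The shift [kap]
    offsets [lM], which may be negative, so that the integrand stays nonnegative. *)
Lemma simulation_entropy :
  \int[lam]_u (\sum_(0 <= z <oo) negplogp (\int[pS]_x (enc z (x, u))%:E)) + kap%:E <=
  4%:E + \int[pS]_x \int[mu]_y ((F (x, y))%:E *
      (3 * - ln (v (L (x, y))) + lM (L (x, y)) + kap)%:E).
Proof.
pose c z : R := (- ln (msg_weight z) + kap)%R.
have c0 z : (0 <= c z)%R.
  rewrite addr_ge0// oppr_ge0 ln_le0// msg_weight_le1//.
pose al l : R := (3 * - ln (v l) + lM l + kap)%R.
(* This slope, multiplied by the e^(lM l) of [enc_cost_le], becomes 2 [v l], which is summable over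
   the levels. *)
pose be l : R := (2 * v l / expR (lM l))%R.
have al0 l : (0 <= al l)%R.
  by rewrite /al -addrA addr_ge0// mulr_ge0// oppr_ge0 ln_le0.
have be0 l : (0 <= be l)%R by rewrite divr_ge0 ?expR_ge0// mulr_ge0// ltW.
have cle z : (c z.+1 <= al (e z).1 + be (e z).1 * (e z).2.+1%:R)%R.
  rewrite /c /= lnM ?posrE ?tele_weight_gt0 ?expR_gt0//.
  have := @ln_tele_weight _ (lM (e z).1) (v (e z).1) (e z).2 (v0 _) (v1 _).
  rewrite /al /be.
  set t := (_ / _ * _.+1%:R)%R; set t' := ln (tele_weight _ _); lra.
have E0 x : \int[lam]_u (\sum_(0 <= z <oo) ((enc z (x, u))%:E * (c z)%:E)) <=
    2%:E + \int[mu]_y ((F (x, y))%:E * (al (L (x, y)))%:E).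
  apply: le_trans (enc_cost_le x c0 al0 be0 cle) _.
  under eq_eseriesr => l _.
    rewrite (_ : be l * expR (lM l) = 2 * v l)%R; last first.
      by rewrite /be divfK// gt_eqF ?expR_gt0.
    rewrite EFinD; over.
  rewrite nneseriesD//; last 2 first.
  - by move=> l _; rewrite lee_fin mulr_ge0 ?level_mass_ge0.
  - by move=> l _; rewrite lee_fin mulr_ge0 ?ltW.
  rewrite addeC level_mass_weighted_sum//; apply: leeD => //.
  under eq_eseriesr do rewrite EFinM.
  rewrite nneseriesZl; last by move=> l _; rewrite lee_fin ltW.
  by rewrite -[leRHS]mule1; apply: lee_wpmul2l.
have mp z := measurable_msg_prob z.
have p0 z u := msg_prob_ge0 z u.
have p1 z u := msg_prob_le1 z u.
have pfin z u : msg_prob z u \is a fin_num.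
  by rewrite ge0_fin_numE//; exact: le_lt_trans (p1 z u) (ltry _).
have np0 z u : 0 <= negplogp (msg_prob z u) by exact: negplogp_ge0.
have w0 z : 0 <= (msg_weight z)%:E by rewrite lee_fin ltW// msg_weight_gt0.
have pc0 z u : 0 <= msg_prob z u * (c z)%:E by rewrite mule_ge0// lee_fin.
have mpc z : measurable_fun setT (fun u => msg_prob z u * (c z)%:E).
  exact: emeasurable_funM.
have pk0 z u : 0 <= msg_prob z u * kap%:E by rewrite mule_ge0// lee_fin.
have Hu u : \sum_(0 <= z <oo) negplogp (msg_prob z u) + kap%:E <=
    2%:E + \sum_(0 <= z <oo) (msg_prob z u * (c z)%:E).
  (* The constant is spread over the messages in proportion to their probabilities. *)
  have {1}-> : kap%:E = \sum_(0 <= z <oo) (msg_prob z u * kap%:E).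
    by rewrite nneseriesZr// msg_prob_sum mul1e.
  rewrite -nneseriesD//.
  apply: (@le_trans _ _ (\sum_(0 <= z <oo) ((msg_weight z)%:E + msg_prob z u * (c z)%:E))).
    apply: lee_nneseries => [z _ _|z _]; first by rewrite adde_ge0.
    rewrite -(fineK (pfin z u)) -!EFinM.
    apply: (@le_trans _ _ ((fine (msg_prob z u) * - ln (msg_weight z) + msg_weight z)%:E
        + (fine (msg_prob z u) * kap)%:E)).
      rewrite leeD2r// fineK//; apply: negplogp_le; first exact: fine_ge0.
      exact: msg_weight_gt0.
    by rewrite -!EFinD lee_fin /c; lra.
  by rewrite nneseriesD// leeD2r// msg_weight_sum.
have -> : \int[lam]_u (\sum_(0 <= z <oo) negplogp (\int[pS]_x (enc z (x, u))%:E)) + kap%:E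
   = \int[lam]_u (\sum_(0 <= z <oo) negplogp (msg_prob z u) + kap%:E).
  rewrite ge0_integralD//.
  - by rewrite probability_integral_cst.
  - by move=> u _; exact: nneseries_ge0.
  - apply: ge0_emeasurable_sum => // z _; exact: measurable_negplogp.
have msum : measurable_fun setT (fun u => \sum_(0 <= z <oo) (msg_prob z u * (c z)%:E)).
  exact: ge0_emeasurable_sum.
apply: (@le_trans _ _ (\int[lam]_u (2%:E + \sum_(0 <= z <oo) (msg_prob z u * (c z)%:E)))).
  apply: ge0_le_integral => //.
  - by move=> u _; rewrite adde_ge0//; exact: nneseries_ge0.
  - apply: emeasurable_funD => //.
    apply: ge0_emeasurable_sum => // z _; exact: measurable_negplogp.
  - exact: emeasurable_funD.
rewrite ge0_integralD//; last by move=> u _; exact: nneseries_ge0.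
rewrite probability_integral_cst.
rewrite (_ : 4%:E = 2%:E + 2%:E :> \bar R); last by rewrite -EFinD; congr EFin; ring.
rewrite -addeA leeD2l//.
have mec z : measurable_fun setT (fun xu : S * U => (enc z xu)%:E * (c z)%:E).
  by apply: emeasurable_funM => //; apply/measurable_EFinP; exact: measurable_enc.
have ec0 z xu : 0 <= (enc z xu)%:E * (c z)%:E by rewrite mule_ge0 ?lee_fin ?enc_ge0.
have mS : measurable_fun setT (fun xu => \sum_(0 <= z <oo) ((enc z xu)%:E * (c z)%:E)).
  exact: ge0_emeasurable_sum.
have S0 xu : 0 <= \sum_(0 <= z <oo) ((enc z xu)%:E * (c z)%:E) by exact: nneseries_ge0.
have -> : \int[lam]_u (\sum_(0 <= z <oo) (msg_prob z u * (c z)%:E)) =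
    \int[lam]_u \int[pS]_x (\sum_(0 <= z <oo) ((enc z (x, u))%:E * (c z)%:E)).
  apply: eq_integral => u _; rewrite integral_nneseries//; last first.
    move=> z; exact: (measurableT_comp (mec z) (pair2_measurable u)).
  apply: eq_eseriesr => z _; rewrite ge0_integralZr//.
  - exact: measurable_enc_section2.
  - by move=> x _; rewrite lee_fin enc_ge0.
  - by rewrite lee_fin.
have := @fubini_tonelli _ _ _ _ _ pS lam _ mS S0; rewrite /= => <-.
have mFa : measurable_fun setT (fun z => (F z)%:E * (al (L z))%:E).
  apply: emeasurable_funM; apply/measurable_EFinP => //.
  exact: (measurableT_comp (g := L)).
have Fa0 z : 0 <= (F z)%:E * (al (L z))%:E by rewrite mule_ge0 ?lee_fin.
have mFa2 := measurable_fun_fubini_tonelli_F (m2 := mu) _ mFa Fa0.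
apply: (@le_trans _ _ (\int[pS]_x (2%:E + \int[mu]_y ((F (x, y))%:E * (al (L (x, y)))%:E)))).
  apply: ge0_le_integral => //.
  - by move=> x _; exact: integral_ge0.
  - exact: (measurable_fun_fubini_tonelli_F (m2 := lam) _ mS S0).
  - exact: emeasurable_funD.
rewrite ge0_integralD//; last by move=> x _; exact: integral_ge0.
by rewrite probability_integral_cst.
Qed.

End channel_simulation.

(** * Converse *)

Lemma markov_pushforward {R : realType} {d1 d2 d3} {S : measurableType d1}
    {T : measurableType d2} {A : measurableType d3} (K : S -> probability S R)
    (phi : A -> S) (f : S -> T) :
  markov_kernel K -> measurable_fun setT phi -> measurable_fun setT f ->
  exists k : A -> probability T R, markov_kernel k /\
    forall a (g : T -> \bar R), (forall z, 0 <= g z) -> measurable_fun setT g ->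
      \int[k a]_z g z = \int[K (phi a)]_y g (f y).
Proof.
move=> hK mphi mf.
have /choice[k hk] a := probability_pushforward (K (phi a)) mf.
exists k; split; last by move=> a; exact: (hk a).2.
move=> B mB; under eq_fun do rewrite (hk _).1.
apply: (measurableT_comp (f := fun s => K s (f @^-1` B))) => //.
by apply: hK; rewrite -[X in measurable X]setTI; exact: mf.
Qed.

(** The finite average is run as a countable mixture with weight 0 from [n] on. *)
Lemma uniform_mixture {R : realType} {d1 d2} {X : measurableType d1}
    {T : measurableType d2} n (k : 'I_n -> X -> probability T R) :
  (0 < n)%N -> (forall t, markov_kernel (k t)) ->
  exists m : X -> probability T R, markov_kernel m /\
    (forall x B, measurable B -> m x B = (n%:R^-1)%:E * \sum_(t < n) k t x B) /\
    forall x (g : T -> \bar R), (forall z, 0 <= g z) -> measurable_fun setT g ->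
      \int[m x]_y g y = (n%:R^-1)%:E * \sum_(t < n) \int[k t x]_y g y.
Proof.
move=> n0 hk.
pose w (z : nat) (x : X) : R := if (z < n)%N then n%:R^-1%R else 0%R.
pose kk (z : nat) : X -> probability T R :=
  if insub z is Some t then k t else k (Ordinal n0).
have w0 z x : (0 <= w z x)%R by rewrite /w; case: ifP; rewrite ?invr_ge0.
have sumE x (f : nat -> \bar R) : (forall z, 0 <= f z) ->
    \sum_(0 <= z <oo) ((w z x)%:E * f z) = (n%:R^-1)%:E * \sum_(t < n) f t.
  move=> f0; rewrite (nneseries_split 0 n); last first.
    by move=> z _; rewrite mule_ge0// lee_fin.
  rewrite add0n eseries0 ?adde0; last first.
    by move=> z nz _; rewrite /w ltnNge nz/= mul0e.
  rewrite big_mkord ge0_sume_distrr//.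
  by apply: eq_bigr => i _; rewrite /w ltn_ord.
have w1 x : \sum_(0 <= z <oo) (w z x)%:E = 1.
  transitivity (\sum_(0 <= z <oo) ((w z x)%:E * cst 1 z)).
    by apply: eq_eseriesr => z _; rewrite mule1.
  rewrite sumE// sumEFin -EFinM; congr EFin.
  by rewrite sumr_const card_ord mulVf// pnatr_eq0 -lt0n.
have mkk z : markov_kernel (kk z).
  by rewrite /kk; case: insubP => [t _ _|_]; exact: hk.
have kkE (t : 'I_n) : kk t = k t by rewrite /kk valK.
have [m [mm [mB mg]]] := markov_mixture (fun z => measurable_cst _) w0 w1 mkk.
exists m; split => //; split.
- move=> x B mBB; rewrite mB// sumE//; congr (_ * _).
  by apply: eq_bigr => t _; rewrite kkE.
- move=> x g g0 mgg; rewrite mg// sumE//; last by move=> z; exact: integral_ge0.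
  by congr (_ * _); apply: eq_bigr => t _; rewrite kkE.
Qed.

Section tuple_update.
Context {R : realType} {d} {T : measurableType d} {n : nat}.
Variables (pX : probability T R) (pXn : probability (n.-tuple T) R).
Hypothesis pXnE : is_prodn (fun _ => pX) pXn.

(** Replaces conditioning on one coordinate of an i.i.d. block: coordinate [t] is overwritten by a
    prescribed letter, the others come from an independent block. *)
Definition tuple_update (t : 'I_n) (xx : T * n.-tuple T) : n.-tuple T :=
  [tuple if i == t then xx.1 else tnth xx.2 i | i < n].

Lemma measurable_tuple_update t : measurable_fun setT (tuple_update t).
Proof.
apply/measurable_fun_tnthP => i.
case: (eqVneq i t) => [->|it].
  rewrite (_ : _ \o _ = fst); first exact: measurable_fst.
  by apply/funext => xx /=; rewrite tnth_mktuple eqxx.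
rewrite (_ : _ \o _ = (fun x => tnth x i) \o snd).
  exact: (measurableT_comp (measurable_tnth i) measurable_snd).
by apply/funext => xx /=; rewrite tnth_mktuple (negPf it).
Qed.

Lemma tuple_update_law t (g : n.-tuple T -> \bar R) :
  (forall x, 0 <= g x) -> measurable_fun setT g ->
  \int[pX]_x \int[pXn]_x' g (tuple_update t (x, x')) = \int[pXn]_x g x.
Proof.
move=> g0 mg.
have mu := measurable_tuple_update t.
have mgu : measurable_fun setT (g \o tuple_update t) by exact: measurableT_comp.
transitivity (\int[pX \x pXn]_z g (tuple_update t z)).
  by rewrite fubini_tonelli1.
have [p [pE pg]] := probability_pushforward (pX \x pXn : probability _ R) mu.
rewrite -pg//; apply: meq_integral.
apply: tuple_probability_unique => A mA.
rewrite [LHS]pE pXnE//.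
have -> : tuple_update t @^-1` [set x | forall i, A i (tnth x i)] =
    A t `*` [set x | forall i, (if i == t then setT else A i) (tnth x i)].
  apply/seteqP; split => -[x x'] /=.
    move=> h; split; first by have := h t; rewrite tnth_mktuple eqxx.
    by move=> i; have := h i; rewrite tnth_mktuple; case: ifP.
  move=> [h1 h2] i; rewrite tnth_mktuple.
  by have := h2 i; case: (eqVneq i t) => [->|].
rewrite [LHS]product_measure1E//; last first.
  by apply: (measurable_rect (A := fun i => if i == t then setT else A i)) => i; case: ifP.
have /= -> := pXnE (A := fun i => if i == t then setT else A i); last by move=> i; case: ifP.
rewrite (bigD1 t)//= eqxx probability_setT/= mul1r.
rewrite [in RHS](bigD1 t)//= EFinM fineK ?fin_num_measure//.
by congr (_ * _%:E); apply: eq_bigr => i /negPf ->.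
Qed.

(** For each [t], a fresh block with x written at coordinate [t] goes through [K] and output
    coordinate [t] is kept; the uniform mixture over [t] acts as a time-sharing variable. *)
Lemma single_letter_kernel (K : n.-tuple T -> probability (n.-tuple T) R) :
  (0 < n)%N -> markov_kernel K ->
  exists k : T -> probability T R, markov_kernel k /\
    forall g : T * T -> \bar R, (forall z, 0 <= g z) -> measurable_fun setT g ->
      \int[pX]_x \int[k x]_y g (x, y) =
      (n%:R^-1)%:E * \sum_(t < n) \int[pXn]_x \int[K x]_y g (tnth x t, tnth y t).
Proof.
move=> n0 hK.
have h t : exists kt : T -> probability T R, markov_kernel kt /\
    forall x (g : T -> \bar R), (forall z, 0 <= g z) -> measurable_fun setT g ->
      \int[kt x]_z g z = \int[pXn]_x' \int[K (tuple_update t (x, x'))]_y g (tnth y t).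
  have [k' [mk' k'g]] := markov_pushforward hK (measurable_tuple_update t) (measurable_tnth t).
  have [kt [mkt [_ ktg]]] := markov_comp (@markov_cst _ _ _ T _ pXn) mk'.
  exists kt; split => // x g g0 mg; rewrite ktg//.
  by apply: eq_integral => x' _; rewrite k'g.
have [kt hkt] := choice h.
have nn0 : (0 <= n%:R^-1 :> R)%R by rewrite invr_ge0.
have [k [mk [_ kg]]] := uniform_mixture n0 (fun t => (hkt t).1).
exists k; split => // g g0 mg.
have mgx x : measurable_fun setT (fun y => g (x, y)) by exact: measurable_fun_section1.
pose G (t : 'I_n) x := \int[K x]_y g (tnth x t, tnth y t).
have mpair t : measurable_fun setT
    (fun xy : n.-tuple T * n.-tuple T => (tnth xy.1 t, tnth xy.2 t)).
  apply/measurable_fun_pairP; split.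
    exact: (measurableT_comp (measurable_tnth t) measurable_fst).
  exact: (measurableT_comp (measurable_tnth t) measurable_snd).
have mG t : measurable_fun setT (G t).
  apply: (@markov_integral_measurable _ _ _ _ _ K
    (fun xy => g (tnth xy.1 t, tnth xy.2 t))) => //.
  exact: (measurableT_comp mg (mpair t)).
have G0 t x : 0 <= G t x by exact: integral_ge0.
have mkg t : measurable_fun setT (fun x => \int[kt t x]_y g (x, y)).
  by apply: markov_integral_measurable => //; exact: (hkt t).1.
have kg0 t x : 0 <= \int[kt t x]_y g (x, y) by exact: integral_ge0.
under eq_integral do rewrite kg//.
rewrite integralZ_ge0//; last 2 first.
- by move=> x; exact: sume_ge0.
- by apply: emeasurable_sum => t _; exact: mkg.
congr (_ * _); rewrite ge0_integral_sum//.
apply: eq_bigr => t _.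
rewrite -(tuple_update_law t (g := G t))//.
apply: eq_integral => x _; rewrite (hkt t).2//.
by apply: eq_integral => x' _; rewrite /G tnth_mktuple eqxx.
Qed.

End tuple_update.

Lemma code_kernel {R : realType} {dS dT dU} {S : measurableType dS}
    {T : measurableType dT} {U : measurableType dU} (pQ : probability U R)
    (enc : nat -> S * U -> R) (dec : nat -> U -> probability T R) :
  (forall z, measurable_fun setT (enc z)) -> (forall z xq, (0 <= enc z xq)%R) ->
  (forall xq, \sum_(0 <= z <oo) (enc z xq)%:E = 1) ->
  (forall z, markov_kernel (dec z)) ->
  exists K : S -> probability T R, markov_kernel K /\
    (forall x B, measurable B ->
      K x B = \int[pQ]_q \sum_(0 <= z <oo) ((enc z (x, q))%:E * dec z q B)) /\
    forall x (g : T -> \bar R), (forall y, 0 <= g y) -> measurable_fun setT g ->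
      \int[K x]_y g y =
      \int[pQ]_q \sum_(0 <= z <oo) ((enc z (x, q))%:E * \int[dec z q]_y g y).
Proof.
move=> menc enc0 enc1 hdec.
have hdec' z : markov_kernel (fun xq : S * U => dec z xq.2).
  by move=> B mB; exact: (measurableT_comp (hdec z B mB) measurable_snd).
have [m [hm [mB mg]]] := markov_mixture menc enc0 enc1 hdec'.
have [K [hK [KB Kg]]] := markov_comp (@markov_cst _ _ _ S _ pQ) hm.
exists K; split => //; split.
- by move=> x B mBB; rewrite KB//; apply: eq_integral => q _; rewrite mB.
- by move=> x g g0 mgg; rewrite Kg//; apply: eq_integral => q _; rewrite mg.
Qed.

Section converse_inequality.
Context {R : realType} {dS dT dU : measure_display} {S : measurableType dS}
  {T : measurableType dT} {U : measurableType dU}.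
Variables (pS : probability S R) (pQ : probability U R).
Variables (enc : nat -> S * U -> R) (dec : nat -> U -> probability T R).
Hypothesis menc : forall z, measurable_fun setT (enc z).
Hypothesis enc0 : forall z xq, (0 <= enc z xq)%R.
Hypothesis enc1 : forall xq, \sum_(0 <= z <oo) (enc z xq)%:E = 1.
Hypothesis hdec : forall z, markov_kernel (dec z).
Variables (W : S * T -> R) (C : R).
Hypothesis mW : measurable_fun setT W.
Hypothesis W0 : forall z, (0 < W z)%R.
Hypothesis W1 : forall y, \int[pS]_x (W (x, y))%:E = 1.
Hypothesis C1 : (1 <= C)%R.
Hypothesis WC : forall z, (`|ln (W z)| <= C)%R.

Let p z q : \bar R := \int[pS]_x (enc z (x, q))%:E.

Let menc2 z q : measurable_fun setT (fun x => (enc z (x, q))%:E).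
Proof.
by apply/measurable_EFinP; exact: (measurableT_comp (menc z) (pair2_measurable q)).
Qed.

Let L0 z : (0 <= ln (W z) + C)%R.
Proof. by have := WC z; rewrite ler_norml => /andP[h _]; lra. Qed.

Let mL : measurable_fun setT (fun z => (ln (W z) + C)%:E).
Proof.
apply/measurable_EFinP; apply: measurable_funD => //.
exact: (measurableT_comp (@measurable_ln R) mW).
Qed.

Let mL2 y : measurable_fun setT (fun x => (ln (W (x, y)) + C)%:E).
Proof. exact: (measurableT_comp mL (pair2_measurable y)). Qed.

Let p_ge0 z q : 0 <= p z q.
Proof. by apply: integral_ge0 => x _; rewrite lee_fin. Qed.

Let enc_le1 z xq : (enc z xq <= 1)%R.
Proof.
rewrite -lee_fin -(enc1 xq) (nneseriesD1 (n := z))//; last by move=> k _; rewrite lee_fin.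
by rewrite leeDl//; apply: nneseries_ge0 => k _ _; rewrite lee_fin.
Qed.

Let p_le1 z q : p z q <= 1.
Proof.
rewrite -[leRHS](probability_integral_cst pS); apply: ge0_le_integral => //.
all: by move=> x _; rewrite lee_fin.
Qed.

Let p_fin z q : p z q \is a fin_num.
Proof. by rewrite ge0_fin_numE//; exact: le_lt_trans (p_le1 z q) (ltry _). Qed.

(* For fixed message, common randomness and output, the encoder is a density bounded by 1, so
   Jensen's inequality for [ln] bounds the log-likelihood by [- p ln p]. *)
Let jensen z q y :
  \int[pS]_x ((enc z (x, q))%:E * (ln (W (x, y)) + C)%:E) <=
  negplogp (p z q) + C%:E * p z q.
Proof.
set P := fine (p z q).
have PE : P%:E = p z q by rewrite fineK.
have P0 : (0 <= P)%R by exact: fine_ge0.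
have P1 : (P <= 1)%R by rewrite -lee_fin PE.
rewrite /negplogp -/P -PE -EFinM -EFinD.
have mEL : measurable_fun setT (fun x => (enc z (x, q))%:E * (ln (W (x, y)) + C)%:E).
  exact: emeasurable_funM.
have EL0 x : 0 <= (enc z (x, q))%:E * (ln (W (x, y)) + C)%:E.
  by rewrite mule_ge0// lee_fin.
(* For P = 0 there is no ln P to compare with, but the encoder then vanishes almost everywhere and
   ln W + C <= 2 C. *)
have [Pz|PN0] := eqVneq P 0%R.
  rewrite Pz mulr0 mulNr mul0r oppr0 addr0.
  apply: (@le_trans _ _ (\int[pS]_x ((2 * C)%:E * (enc z (x, q))%:E))).
    apply: ge0_le_integral => //.
    - exact: emeasurable_funM.
    - move=> x _; rewrite muleC; apply: lee_wpmul2r; first by rewrite lee_fin.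
      rewrite lee_fin; have := WC (x, y); rewrite ler_norml => /andP[_ h]; lra.
  rewrite integralZ_ge0//; last 2 first.
  - have := C1; lra.
  - by move=> x; rewrite lee_fin.
  by rewrite -/(p z q) -PE Pz mule0.
have {}P0 : (0 < P)%R by rewrite lt_neqAle eq_sym PN0.
have lP : (0 <= - ln P)%R by rewrite oppr_ge0 ln_le0.
have mW2 : measurable_fun setT (fun x => (W (x, y))%:E).
  by apply/measurable_EFinP; exact: (measurableT_comp mW (pair2_measurable y)).
(* The tangent inequality ln (P W) <= P W - 1 is multiplied by the encoder probability, which is at
   most 1. Since [W] integrates to 1, the terms - P and P cancel. *)
apply: (@le_trans _ _ (\int[pS]_x ((- ln P - 1 + C)%:E * (enc z (x, q))%:E +
    P%:E * (W (x, y))%:E))).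
  apply: ge0_le_integral => //.
  - by apply: emeasurable_funD; exact: emeasurable_funM.
  - move=> x _; rewrite -!EFinM -EFinD lee_fin.
    have := @ln_le_subr1 _ (P * W (x, y))%R; rewrite mulr_gt0// => /(_ isT).
    rewrite lnM ?posrE// => h.
    have e0 := enc0 z (x, q); have e1 := enc_le1 z (x, q).
    have PW : (0 <= P * W (x, y))%R by rewrite mulr_ge0 ?ltW.
    nra.
rewrite ge0_integralD//; last 4 first.
- by move=> x _; rewrite mule_ge0 ?lee_fin//; have := C1; lra.
- exact: emeasurable_funM.
- by move=> x _; rewrite mule_ge0 ?lee_fin// ltW.
- exact: emeasurable_funM.
rewrite integralZ_ge0//; last 2 first.
- by have := C1; lra.
- by move=> x; rewrite lee_fin.
rewrite integralZ_ge0 ?W1//; last 2 first.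
- exact: ltW.
- by move=> x; rewrite lee_fin ltW.
rewrite -/(p z q) -PE mule1 -EFinM -EFinD lee_fin; lra.
Qed.

(** Given the message and the common randomness, the law of the output no longer depends on x. Hence
    x can be integrated first, and [jensen] bounds the result uniformly in the output. *)
Lemma converse_inequality (K : S -> probability T R) :
  (forall x (g : T -> \bar R), (forall y, 0 <= g y) -> measurable_fun setT g ->
      \int[K x]_y g y =
      \int[pQ]_q \sum_(0 <= z <oo) ((enc z (x, q))%:E * \int[dec z q]_y g y)) ->
  \int[pS]_x \int[K x]_y (ln (W (x, y)) + C)%:E <=
  \int[pQ]_q (\sum_(0 <= z <oo) negplogp (\int[pS]_x (enc z (x, q))%:E)) + C%:E.
Proof.
move=> KE.
have hdec' z : markov_kernel (fun xq : S * U => dec z xq.2).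
  by move=> B mB; exact: (measurableT_comp (hdec z mB) measurable_snd).
pose D z (xq : S * U) := \int[dec z xq.2]_y (ln (W (xq.1, y)) + C)%:E.
have mD z : measurable_fun setT (D z).
  apply: (@markov_integral_measurable _ _ _ _ _ (fun xq : S * U => dec z xq.2)
    (fun xqy => (ln (W (xqy.1.1, xqy.2)) + C)%:E)).
  - exact: hdec'.
  - by move=> z'; rewrite lee_fin.
  - apply: (measurableT_comp (f := fun z => (ln (W z) + C)%:E)) => //.
    apply/measurable_fun_pairP; split; last exact: measurable_snd.
    exact: (measurableT_comp measurable_fst measurable_fst).
have D0 z xq : 0 <= D z xq by apply: integral_ge0 => y _; rewrite lee_fin.
have meD z : measurable_fun setT (fun xq : S * U => (enc z xq)%:E * D z xq).
  by apply: emeasurable_funM => //; exact/measurable_EFinP.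
have eD0 z xq : 0 <= (enc z xq)%:E * D z xq by rewrite mule_ge0// lee_fin.
have mS : measurable_fun setT (fun xq => \sum_(0 <= z <oo) ((enc z xq)%:E * D z xq)).
  exact: ge0_emeasurable_sum.
have S0 xq : 0 <= \sum_(0 <= z <oo) ((enc z xq)%:E * D z xq) by exact: nneseries_ge0.
have -> : \int[pS]_x \int[K x]_y (ln (W (x, y)) + C)%:E =
    \int[pS]_x \int[pQ]_q \sum_(0 <= z <oo) ((enc z (x, q))%:E * D z (x, q)).
  apply: eq_integral => x _; rewrite KE//.
  - by move=> y; rewrite lee_fin.
  - exact: (measurable_fun_section1 x mL).
have := @fubini_tonelli _ _ _ _ _ pS pQ _ mS S0; rewrite /= => ->.
have np0 z q : 0 <= negplogp (p z q) by exact: negplogp_ge0.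
have mp z : measurable_fun setT (p z).
  apply: (@measurable_fun_fubini_tonelli_G _ _ _ _ _ pS (fun xq => (enc z xq)%:E)).
    exact/measurable_EFinP.
  by move=> xq; rewrite lee_fin.
have C0 : (0 <= C)%R by have := C1; lra.
have p1 q : \sum_(0 <= z <oo) p z q = 1.
  rewrite -integral_nneseries//; last by move=> z x _; rewrite lee_fin.
  under eq_integral do rewrite enc1.
  by rewrite probability_integral_cst.
have mnp : measurable_fun setT (fun q => \sum_(0 <= z <oo) negplogp (p z q)).
  by apply: ge0_emeasurable_sum => // z _; exact: measurable_negplogp.
rewrite -[X in _ <= _ + X](probability_integral_cst pQ) -ge0_integralD//; last first.
  by move=> q _; apply: nneseries_ge0 => z _ _; exact: np0.
apply: ge0_le_integral => //.
- by move=> q _; exact: integral_ge0.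
- exact: (measurable_fun_fubini_tonelli_G (m1 := pS) _ mS S0).
- exact: emeasurable_funD.
move=> q _.
rewrite integral_nneseries//; last first.
  by move=> z; exact: (measurableT_comp (meD z) (pair2_measurable q)).
rewrite -[C%:E]mule1 -(p1 q) -nneseriesZl// -nneseriesD//; last 2 first.
- by move=> z _ _; exact: np0.
- by move=> z _ _; rewrite mule_ge0.
apply: lee_nneseries => [z _ _|z _]; first exact: integral_ge0.
have mEL : measurable_fun setT (fun xy : S * T => (enc z (xy.1, q))%:E * (ln (W xy) + C)%:E).
  apply: emeasurable_funM => //.
  exact: (measurableT_comp (menc2 z q) measurable_fst).
have EL0 xy : 0 <= (enc z (xy.1, q))%:E * (ln (W xy) + C)%:E.
  by rewrite mule_ge0 ?lee_fin.
have -> : \int[pS]_x ((enc z (x, q))%:E * D z (x, q)) =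
    \int[pS]_x \int[dec z q]_y ((enc z (x, q))%:E * (ln (W (x, y)) + C)%:E).
  apply: eq_integral => x _; rewrite integralZ_ge0//.
  - by move=> y; rewrite lee_fin.
  - exact: (measurable_fun_section1 x mL).
have := @fubini_tonelli _ _ _ _ _ pS (dec z q) _ mEL EL0; rewrite /= => ->.
rewrite -[leRHS](probability_integral_cst (dec z q)); apply: ge0_le_integral => //.
- by move=> y _; apply: integral_ge0 => x _; exact: (EL0 (x, y)).
- exact: (measurable_fun_fubini_tonelli_G (m1 := pS) _ mEL EL0).
Qed.

End converse_inequality.

Lemma uniform_average {R : realType} {d} {T : measurableType d} n
    (nu : 'I_n -> probability T R) : (0 < n)%N ->
  exists m : probability T R, forall B, measurable B ->
    m B = (n%:R^-1)%:E * \sum_(t < n) nu t B.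
Proof.
move=> n0.
have [m [_ [mB _]]] := uniform_mixture n0 (fun t => @markov_cst _ _ _ unit _ (nu t)).
by exists (m tt) => B mBB; rewrite mB.
Qed.

(** Two-point convexity is iterated by splitting off the first of n + 2 terms with weight 1 / (n +
    2). *)
Lemma convex_average {R : realType} {d} {T : measurableType d}
    (dv : probability T R -> probability T R -> \bar R) n
    (mu m : probability T R) (nu : 'I_n.+1 -> probability T R) :
  is_divergence dv -> convex_snd dv ->
  (forall B, measurable B -> m B = (n.+1%:R^-1)%:E * \sum_(t < n.+1) nu t B) ->
  dv mu m <= (n.+1%:R^-1)%:E * \sum_(t < n.+1) dv mu (nu t).
Proof.
move=> [dv0 [_ dvext]] cdv.
elim: n m nu => [|n IH] m nu mE.
  rewrite big_ord_recl big_ord0 invr1 mul1e adde0.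
  rewrite (dvext _ mu _ (nu ord0))// => B mB.
  by rewrite mE// big_ord_recl big_ord0 invr1 mul1e adde0.
have [m' m'E] := uniform_average (fun t : 'I_n.+1 => nu (lift ord0 t)) (ltn0Sn n).
pose l : R := (n.+2%:R^-1)%R.
have n2 : (0 < n.+2%:R :> R)%R by rewrite ltr0n.
have l0 : (0 <= l)%R by rewrite invr_ge0.
have l1 : (l <= 1)%R by rewrite invf_le1// ler1n.
have lE : ((1 - l) * n.+1%:R^-1 = l)%R.
  have : (0 < n.+1%:R :> R)%R by rewrite ltr0n.
  rewrite /l -[n.+2%:R]natr1; move: (n.+1%:R : R) => N N0; field.
  by apply/andP; split; rewrite gt_eqF//; lra.
have l1' : (0 <= 1 - l)%R by rewrite subr_ge0.
have h : meq m (fun A => l%:E * nu ord0 A + (1 - l)%:E * m' A).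
  move=> B mB; rewrite mE// m'E// muleA -EFinM lE big_ord_recl.
  by rewrite ge0_muleDr// sume_ge0.
apply: (le_trans (cdv mu _ _ _ l _ h)); first by rewrite l0.
rewrite big_ord_recl ge0_muleDr//; last by rewrite sume_ge0.
rewrite leeD2l// -/l -[X in _ <= X%:E * _]lE EFinM -muleA.
apply: lee_wpmul2l; first by rewrite lee_fin.
exact: IH.
Qed.

(** Once y^n is fixed, [W] factors over the coordinates of x^n, so only the source has to be
    memoryless and the outputs may be dependent. The bound [c] becomes n c on the block and returns
    to [c] after division by n. *)
Lemma single_letter_information {R : realType} {d dU} {T : measurableType d}
    {U : measurableType dU} n (pX : probability T R) (pXn : probability (n.-tuple T) R)
    (pQ : probability U R) (enc : nat -> n.-tuple T * U -> R)
    (dec : nat -> U -> probability (n.-tuple T) R)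
    (K : n.-tuple T -> probability (n.-tuple T) R) (k : T -> probability T R)
    (u : T * T -> R) (c : R) :
  (0 < n)%N ->
  (forall g : 'I_n -> T -> \bar R, (forall i x, 0 <= g i x) ->
    (forall i, measurable_fun setT (g i)) ->
    \int[pXn]_x (\prod_(i < n) g i (tnth x i)) = \prod_(i < n) \int[pX]_x g i x) ->
  (forall z, measurable_fun setT (enc z)) -> (forall z xq, (0 <= enc z xq)%R) ->
  (forall xq, \sum_(0 <= z <oo) (enc z xq)%:E = 1) ->
  (forall z, markov_kernel (dec z)) ->
  markov_kernel K ->
  (forall x (g : n.-tuple T -> \bar R), (forall y, 0 <= g y) -> measurable_fun setT g ->
      \int[K x]_y g y =
      \int[pQ]_q \sum_(0 <= z <oo) ((enc z (x, q))%:E * \int[dec z q]_y g y)) ->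
  (forall g : T * T -> \bar R, (forall z, 0 <= g z) -> measurable_fun setT g ->
      \int[pX]_x \int[k x]_y g (x, y) =
      (n%:R^-1)%:E * \sum_(t < n) \int[pXn]_x \int[K x]_y g (tnth x t, tnth y t)) ->
  measurable_fun setT u -> (forall z, (0 < u z)%R) ->
  (forall y, \int[pX]_x (u (x, y))%:E = 1) ->
  (1 <= c)%R -> (forall z, (`|ln (u z)| <= c)%R) ->
  \int[pX]_x \int[k x]_y (ln (u (x, y)) + c)%:E <=
  (n%:R^-1)%:E * \int[pQ]_q
    (\sum_(0 <= z <oo) negplogp (\int[pXn]_x (enc z (x, q))%:E)) + c%:E.
Proof.
move=> n0 prodE menc enc0 enc1 hdec hK KE kE mu u0 u1 c1 uc.
have nn0 : (0 <= n%:R^-1 :> R)%R by rewrite invr_ge0.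
have uc0 z : (0 <= ln (u z) + c)%R.
  by have := uc z; rewrite ler_norml => /andP[h _]; lra.
have mlu : measurable_fun setT (fun z => (ln (u z) + c)%:E).
  apply/measurable_EFinP; apply: measurable_funD => //.
  exact: (measurableT_comp (@measurable_ln R) mu).
rewrite (kE (fun z => (ln (u z) + c)%:E))//.
have mpair t : measurable_fun setT
    (fun xy : n.-tuple T * n.-tuple T => (tnth xy.1 t, tnth xy.2 t)).
  apply/measurable_fun_pairP; split.
    exact: (measurableT_comp (measurable_tnth t) measurable_fst).
  exact: (measurableT_comp (measurable_tnth t) measurable_snd).
pose W (xy : n.-tuple T * n.-tuple T) : R := (\prod_(t < n) u (tnth xy.1 t, tnth xy.2 t))%R.
have mW : measurable_fun setT W.
  by apply: measurable_prod => t _; exact: (measurableT_comp mu (mpair t)).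
have W0 xy : (0 < W xy)%R by apply: prodr_gt0 => t _.
have W1 y : \int[pXn]_x (W (x, y))%:E = 1.
  under eq_integral do rewrite -prodEFin.
  rewrite (prodE (fun t x => (u (x, tnth y t))%:E)).
  - by rewrite big1.
  - by move=> t x; rewrite lee_fin ltW.
  - move=> t; apply/measurable_EFinP.
    exact: (measurableT_comp mu (pair2_measurable (tnth y t))).
have lnW xy : ln (W xy) = (\sum_(t < n) ln (u (tnth xy.1 t, tnth xy.2 t)))%R.
  rewrite /W; elim: (index_enum _) => [|t s IH]; first by rewrite !big_nil ln1.
  by rewrite !big_cons lnM ?posrE// ?IH// prodr_gt0.
have n1 : (1 <= n%:R :> R)%R by rewrite ler1n.
have C1 : (1 <= n%:R * c)%R by nra.
have WC xy : (`|ln (W xy)| <= n%:R * c)%R.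
  rewrite lnW (le_trans (ler_norm_sum _ _ _))//.
  apply: (le_trans (ler_sum _ (fun t _ => uc _))).
  by rewrite sumr_const card_ord mulr_natl.
have conv := converse_inequality menc enc0 enc1 hdec mW W0 W1 C1 WC KE.
have h t x : 0 <= \int[K x]_y (ln (u (tnth x t, tnth y t)) + c)%:E.
  by apply: integral_ge0 => y _; rewrite lee_fin.
rewrite -ge0_integral_sum//; last first.
  move=> t; apply: (@markov_integral_measurable _ _ _ _ _ K
    (fun xy => (ln (u (tnth xy.1 t, tnth xy.2 t)) + c)%:E)) => //.
    by move=> z; rewrite lee_fin.
  exact: (measurableT_comp mlu (mpair t)).
have -> : \int[pXn]_x (\sum_(t < n) \int[K x]_y (ln (u (tnth x t, tnth y t)) + c)%:E) =
    \int[pXn]_x \int[K x]_y (ln (W (x, y)) + n%:R * c)%:E.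
  apply: eq_integral => x _; rewrite -ge0_integral_sum//; last 2 first.
  - by move=> t; exact: (measurable_fun_section1 x (measurableT_comp mlu (mpair t))).
  - by move=> t y _; rewrite lee_fin.
  apply: eq_integral => y _; rewrite sumEFin; congr EFin.
  by rewrite big_split/= lnW sumr_const card_ord mulr_natl.
apply: (@le_trans _ _ ((n%:R^-1)%:E * (\int[pQ]_q
    (\sum_(0 <= z <oo) negplogp (\int[pXn]_x (enc z (x, q))%:E)) + (n%:R * c)%:E))).
  by apply: lee_wpmul2l => //; rewrite lee_fin.
rewrite muleDr//; last exact: fin_num_adde_defl.
by rewrite leeD2l// -EFinM lee_fin mulKf// pnatr_eq0 -lt0n.
Qed.

(* It suffices to test bounded likelihood ratios because [KL] is a supremum over finite
   partitions; adding [c] keeps the integrands nonnegative. *)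
Lemma mutual_info_le {R : realType} {d} {T : measurableType d} (pX : probability T R)
    (k : T -> probability T R) (r : R) : markov_kernel k ->
  (forall (u : T * T -> R) (c : R),
    measurable_fun setT u -> (forall z, (0 < u z)%R) ->
    (forall y, \int[pX]_x (u (x, y))%:E = 1) ->
    (1 <= c)%R -> (forall z, (`|ln (u z)| <= c)%R) ->
    \int[pX]_x \int[k x]_y (ln (u (x, y)) + c)%:E <= r%:E + c%:E) ->
  mutual_info pX k <= r%:E.
Proof.
move=> hk H.
have [pY [pYE pYg]] := probability_bind pX hk.
have [J [Q [Jg Qg ->]]] := mutual_info_KL hk pYE.
apply: KL_le => N A a [mA [dA cA]].
pose B : R := (\sum_(i < N) `|a i|)%R.
have B0 : (0 <= B)%R by rewrite sumr_ge0.
have aB i : (`|a i| <= B)%R by rewrite /B (bigD1 i)//= lerDl sumr_ge0.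
(* The simple function with value [a i] on [A i]; [ef] is its exponential, written as a sum so that
   it integrates cell by cell. *)
pose f z : R := (\sum_(i < N) a i * \1_(A i) z)%R.
pose ef z : R := (\sum_(i < N) expR (a i) * \1_(A i) z)%R.
have pick z : exists i, [/\ A i z, f z = a i & ef z = expR (a i)].
  have : [set: T * T] z by [].
  rewrite -cA -bigcup_seq => -[i /= _ zi]; exists i.
  have nz j : j != i -> ~ A j z.
    move=> ji zj; suff : (A j `&` A i) z by rewrite dA.
    by [].
  split => //; rewrite /f /ef (bigD1 i)//= big1 ?addr0.
  - by rewrite indicE mem_set// mulr1.
  - by move=> j ji; rewrite indicE memNset ?mulr0//; exact: nz.
  - by rewrite indicE mem_set// mulr1.
  - by move=> j ji; rewrite indicE memNset ?mulr0//; exact: nz.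
have efE z : ef z = expR (f z) by have [i [_ -> ->]] := pick z.
have fB z : (`|f z| <= B)%R by have [i [_ -> _]] := pick z.
have mind i : measurable_fun setT (\1_(A i) : T * T -> R) by exact: measurable_indic.
have mf : measurable_fun setT f.
  by apply: measurable_sum => i; exact: measurable_funM.
have mef : measurable_fun setT ef.
  by apply: measurable_sum => i; exact: measurable_funM.
have eef : measurable_fun setT (fun z => (ef z)%:E) by exact/measurable_EFinP.
have ef0 z : (0 < ef z)%R by rewrite efE expR_gt0.
have ef0E z : 0 <= (ef z)%:E by rewrite lee_fin ltW.
have efl z : (expR (- B) <= ef z)%R.
  by rewrite efE ler_expR; have := fB z; rewrite ler_norml => /andP[].
have efu z : (ef z <= expR B)%R.
  by rewrite efE ler_expR; have := fB z; rewrite ler_norml => /andP[].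
pose hE y : \bar R := \int[pX]_x (ef (x, y))%:E.
have mhE : measurable_fun setT hE.
  exact: (measurable_fun_fubini_tonelli_G (m1 := pX) _ eef ef0E).
have efy y : measurable_fun setT (fun x => (ef (x, y))%:E).
  exact: (measurableT_comp eef (pair2_measurable y)).
have hEl y : (expR (- B))%:E <= hE y.
  rewrite -[leLHS](probability_integral_cst pX); apply: ge0_le_integral => //.
  - by move=> x _; rewrite lee_fin.
have hEu y : hE y <= (expR B)%:E.
  rewrite -[leRHS](probability_integral_cst pX); apply: ge0_le_integral => //.
  by move=> x _; rewrite lee_fin.
have hEf y : hE y \is a fin_num.
  rewrite ge0_fin_numE; first exact: le_lt_trans (hEu y) (ltry _).
  by apply: le_trans (hEl y); rewrite lee_fin expR_ge0.
pose h y : R := fine (hE y).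
have hhE y : (h y)%:E = hE y by rewrite fineK.
have hl y : (expR (- B) <= h y)%R by rewrite -lee_fin hhE.
have hu y : (h y <= expR B)%R by rewrite -lee_fin hhE.
have h0 y : (0 < h y)%R by apply: lt_le_trans (hl y); exact: expR_gt0.
have mh : measurable_fun setT h by exact: measurableT_comp.
(* Dividing e^f by its mean over x for fixed y makes it an admissible likelihood ratio. *)
pose u z : R := expR (f z - ln (h z.2)).
have u0 z : (0 < u z)%R by exact: expR_gt0.
have lnu z : ln (u z) = (f z - ln (h z.2))%R by rewrite expRK.
have mlh : measurable_fun setT (fun z : T * T => ln (h z.2)).
  apply: (measurableT_comp (@measurable_ln R)).
  exact: (measurableT_comp mh measurable_snd).
have mu : measurable_fun setT u.
  by apply: measurableT_comp => //; exact: measurable_funB.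
have lhB y : (- B <= ln (h y) <= B)%R.
  by rewrite -[(- B)%R]expRK -[X in (_ <= _ <= X)%R]expRK !ler_ln ?posrE ?expR_gt0// hl hu.
have u1 y : \int[pX]_x (u (x, y))%:E = 1.
  transitivity (\int[pX]_x ((expR (- ln (h y)))%:E * (ef (x, y))%:E)).
    by apply: eq_integral => x _; rewrite /u expRD mulrC -efE EFinM.
  rewrite integralZ_ge0 ?expR_ge0// -/(hE y) -hhE -EFinM expRN lnK ?posrE//.
  by rewrite mulVf// gt_eqF.
pose c : R := (2 * B + expR B + 1)%R.
have eB0 : (0 < expR B)%R by exact: expR_gt0.
have c1 : (1 <= c)%R by rewrite /c; lra.
have uc z : (`|ln (u z)| <= c)%R.
  rewrite lnu /c ler_norml; have := lhB z.2; have := fB z; rewrite ler_norml.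
  by move=> /andP[? ?] /andP[? ?]; apply/andP; split; lra.
have X1 := H u c mu u0 u1 c1 uc.
have mlu : measurable_fun setT (fun z => (ln (u z) + c)%:E).
  apply/measurable_EFinP; apply: measurable_funD => //.
  exact: (measurableT_comp (@measurable_ln R) mu).
have uc0 z : 0 <= (ln (u z) + c)%:E.
  by rewrite lee_fin; have := uc z; rewrite ler_norml => /andP[? ?]; lra.
rewrite -(Jg (fun z => (ln (u z) + c)%:E))// in X1.
have mhz : measurable_fun setT (fun z : T * T => (h z.2)%:E).
  by apply/measurable_EFinP; exact: (measurableT_comp mh measurable_snd).
have hz0 (z : T * T) : 0 <= (h z.2)%:E by rewrite lee_fin ltW.
have J1 := partition_sum_probability J (conj mA (conj dA cA)).
have sumE (P : probability (T * T)%type R) (b : 'I_N -> R) : (forall i, (0 <= b i)%R) ->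
    \int[P]_z (\sum_(i < N) b i * \1_(A i) z)%:E =
    (\sum_(i < N) b i * fine (P (A i)))%:E.
  move=> b0; under eq_integral do rewrite -sumEFin.
  rewrite ge0_integral_sum//; last 2 first.
  - by move=> i; apply/measurable_EFinP; exact: measurable_funM.
  - by move=> i z _; rewrite lee_fin mulr_ge0.
  rewrite -sumEFin; apply: eq_bigr => i _.
  under eq_integral do rewrite EFinM.
  rewrite integralZ_ge0//; last exact/measurable_EFinP.
  by rewrite integral_indicT// EFinM fineK// fin_num_measure.
have Jh : \int[J]_z (h z.2)%:E = (\sum_(i < N) expR (a i) * fine (Q (A i)))%:E.
  rewrite Jg// -(pYg (fun y => (h y)%:E))//; last 2 first.
  - by move=> y; rewrite lee_fin ltW.
  - exact/measurable_EFinP.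
  rewrite -sumE; last by move=> i; exact: expR_ge0.
  rewrite Qg//.
  have := @fubini_tonelli _ _ _ _ _ pX pY _ eef ef0E; rewrite /= => ->.
  by apply: eq_integral => y _; rewrite hhE.
have Jf : \int[J]_z (f z + (B + 2 + expR B + B))%:E =
    (\sum_(i < N) fine (J (A i)) * a i + (B + 2 + expR B + B))%:E.
  pose b i : R := (a i + (B + 2 + expR B + B))%R.
  have b0 i : (0 <= b i)%R.
    by rewrite /b; have := aB i; rewrite ler_norml => /andP[? ?]; lra.
  rewrite (eq_integral (fun z => (\sum_(i < N) b i * \1_(A i) z)%:E)); last first.
    move=> z _; congr EFin; have [i [zi -> _]] := pick z.
    rewrite (bigD1 i)//= big1 ?addr0; first by rewrite indicE mem_set// mulr1.
    move=> j ji; rewrite indicE memNset ?mulr0// => zj.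
    suff : (A j `&` A i) z by rewrite dA.
    by [].
  rewrite sumE//; congr EFin.
  under eq_bigr do rewrite /b mulrDl.
  rewrite big_split/= -mulr_sumr J1 mulr1; congr (_ + _)%R.
  by apply: eq_bigr => i _; rewrite mulrC.
(* f <= ln u + h - 1 because ln h <= h - 1; the constant on the left is c + 1. The J-mean of [h] is
   the Q-mean of e^f, which supplies the term - sum q e^a of the variational formula. *)
have key : \int[J]_z (f z + (B + 2 + expR B + B))%:E <=
    \int[J]_z (ln (u z) + c)%:E + \int[J]_z (h z.2)%:E.
  rewrite -ge0_integralD//; apply: ge0_le_integral => //.
  - move=> z _; rewrite lee_fin; have := fB z; rewrite ler_norml => /andP[? ?]; lra.
  - by apply/measurable_EFinP; exact: measurable_funD.
  - exact: emeasurable_funD.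
  - move=> z _; rewrite -EFinD lee_fin lnu /c.
    have := @ln_le_subr1 _ (h z.2) (h0 _); lra.
have := le_trans key (leeD2r _ X1).
rewrite Jf Jh -!EFinD lee_fin /c sumrB.
have -> : (\sum_(i < N) fine (Q (A i)) * expR (a i) = \sum_(i < N) expR (a i) * fine (Q (A i)))%R.
  by apply: eq_bigr => i _; rewrite mulrC.
lra.
Qed.

Lemma RDP_le_rate {R : realType} {d dU} {T : measurableType d} {U : measurableType dU}
    (pX : probability T R) (Delta : T -> T -> R)
    (dX : probability T R -> probability T R -> \bar R) n
    (pXn pXhn : probability (n.+1.-tuple T) R) (pQ : probability U R)
    (enc : nat -> n.+1.-tuple T * U -> R)
    (dec : nat -> U -> probability (n.+1.-tuple T) R) (dnn : \bar R) (D P r : R) :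
  measurable_fun setT (fun xy : T * T => Delta xy.1 xy.2) ->
  (forall x y, (0 <= Delta x y)%R) ->
  is_divergence dX -> convex_snd dX ->
  is_prodn (fun _ => pX) pXn ->
  (forall g : 'I_n.+1 -> T -> \bar R, (forall i x, 0 <= g i x) ->
    (forall i, measurable_fun setT (g i)) ->
    \int[pXn]_x (\prod_(i < n.+1) g i (tnth x i)) = \prod_(i < n.+1) \int[pX]_x g i x) ->
  (forall z, measurable_fun setT (enc z)) -> (forall z xq, (0 <= enc z xq)%R) ->
  (forall xq, \sum_(0 <= z <oo) (enc z xq)%:E = 1) ->
  (forall z, markov_kernel (dec z)) ->
  (n.+1%:R^-1)%:E * \int[pQ]_q
      (\sum_(0 <= z <oo) negplogp (\int[pXn]_x (enc z (x, q))%:E)) <= r%:E ->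
  (n.+1%:R^-1)%:E * (\sum_(t < n.+1)
       \int[pXn]_x \int[pQ]_q \sum_(0 <= z <oo)
          ((enc z (x, q))%:E * \int[dec z q]_y (Delta (tnth x t) (tnth y t))%:E)) <= D%:E ->
  meq pXhn (fun B => \int[pXn]_x \int[pQ]_q \sum_(0 <= z <oo)
                            ((enc z (x, q))%:E * dec z q B)) ->
  (forall muhs, (forall t, is_marg pXhn t (muhs t)) ->
     \sum_(t < n.+1) dX pX (muhs t) <= dnn) ->
  (n.+1%:R^-1)%:E * dnn <= P%:E ->
  RDP pX Delta dX D P <= r%:E.
Proof.
move=> mDelta Delta0 divX convX pXnE prodE menc enc0 enc1 hdec hrate hdist pXhnE hA4 hperc.
have n0 : (0 < n.+1)%N by [].
have [K [hK [KB Kg]]] := code_kernel pQ menc enc0 enc1 hdec.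
have [k [hk kg]] := single_letter_kernel pXnE n0 hK.
have [pXh [pXhB pXhg]] := probability_bind pX hk.
have nn0 : (0 <= n.+1%:R^-1 :> R)%R by rewrite invr_ge0.
apply: (@le_trans _ _ (mutual_info pX k)); last first.
  apply: mutual_info_le => // u c mu u0 u1 c1 uc.
  apply: le_trans (single_letter_information n0 prodE menc enc0 enc1 hdec hK Kg kg
    mu u0 u1 c1 uc) _.
  by rewrite leeD2r.
apply: ereal_inf_lbound; exists k => //; split => //; split.
  have eD0 (xy : T * T) : 0 <= (Delta xy.1 xy.2)%:E by rewrite lee_fin.
  have emD : measurable_fun setT (fun xy : T * T => (Delta xy.1 xy.2)%:E).
    exact/measurable_EFinP.
  have /= -> := kg _ eD0 emD.
  apply: le_trans hdist.
  apply: lee_wpmul2l; first by rewrite lee_fin.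
  apply: lee_sum => t _.
  rewrite le_eqVlt; apply/orP; left; apply/eqP; apply: eq_integral => x _.
  rewrite Kg//.
  - by move=> y; rewrite lee_fin.
  - apply/measurable_EFinP.
    apply: (measurableT_comp (f := fun y => Delta (tnth x t) y)); last exact: measurable_tnth.
    exact: (measurableT_comp mDelta (pair1_measurable (tnth x t))).
(* [pXh] is the average of the marginals of the output block, so convexity and (A4) bound its
   divergence. *)
exists pXh; split; first by move=> B mB; rewrite pXhB.
have /choice[muh hmuh] : forall t, exists mu, is_marg pXhn t mu.
  by move=> t; have [mu [h _]] := marg_exists pXhn t; exists mu.
apply: le_trans hperc.
apply: le_trans (lee_wpmul2l _ (hA4 _ hmuh)); last by rewrite lee_fin.
apply: convex_average => // B mB.
rewrite pXhB//.
have mB2 : measurable_fun setT (fun xy : T * T => (\1_B xy.2)%:E : \bar R).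
  exact: (measurableT_comp (emeasurable_indic mB) measurable_snd).
have B0 (xy : T * T) : 0 <= (\1_B xy.2)%:E :> \bar R by rewrite lee_fin.
have := kg _ B0 mB2; rewrite /=.
have -> : \int[pX]_x \int[k x]_y (\1_B y)%:E = \int[pX]_x k x B.
  by apply: eq_integral => x _; rewrite integral_indicT.
move=> ->; congr (_ * _); apply: eq_bigr => t _.
rewrite (hmuh t)//.
have mBt : measurable [set x : n.+1.-tuple T | B (tnth x t)].
  by rewrite -[X in measurable X]setTI; exact: measurable_tnth.
rewrite [RHS]pXhnE//; apply: eq_integral => x _.
rewrite -KB// -[RHS]integral_indicT//.
Qed.

(** From the one-cell partition with test value 0. It excludes -oo when the value is split into
    cases in the theorem. *)
Lemma mutual_info_ge0 {R : realType} {d} {T : measurableType d} (pX : probability T R)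
    (k : T -> probability T R) : markov_kernel k -> 0 <= mutual_info pX k.
Proof.
move=> hk; have [pY [pYE _]] := probability_bind pX hk.
have [J [Q [_ _ ->]]] := mutual_info_KL hk pYE.
have pT : is_partition (fun _ : 'I_1 => [set: T * T]).
  split => //; split; first by move=> [[|//] ?] [[|//] ?].
  by rewrite big_ord_recl big_ord0 setU0.
have := KL_ge J Q (fun=> 0%R) pT.
rewrite big_ord_recl big_ord0 mulr0 expR0 mulr1 add0r addr0.
by rewrite probability_setT/= addNr.
Qed.

(** * Achievability *)

(** Bit j of coordinate i sits at position [pickle (i, j)]; positions whose first index is at least
    [n] hold a constant bit. *)
Lemma standard_tuple {d} {T : measurableType d} n : standard T -> standard (n.-tuple T).
Proof.
move=> [E [G [mE mG GE]]].
pose ix k : nat * nat := odflt (0%N, 0%N) (unpickle k).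
exists (fun k => if insub (ix k).1 is Some i then [set x | E (ix k).2 (tnth x i)] else setT).
exists (fun b => [tuple G (fun j => b (pickle (val i, j))) | i < n]); split.
- move=> k; case: insub => // i; rewrite -[X in measurable X]setTI.
  exact: measurable_tnth.
- apply/measurable_fun_tnthP => i.
  rewrite (_ : _ \o _ = G \o (fun b : bit_space => (fun j => b (pickle (val i, j))) : bit_space)).
    exact: (measurableT_comp mG (measurable_bit_reindex (fun j => pickle (val i, j)))).
  by apply/funext => b /=; rewrite tnth_mktuple.
- move=> x; apply: eq_from_tnth => i; rewrite tnth_mktuple -[RHS]GE; congr (G _).
  by apply/funext => j; rewrite /set_bits /ix pickleK/= valK.
Qed.

(** [is_prodn] speaks of rectangles only; by uniqueness the given measure is the one constructed in
    [prodn_exists], where product integrands are known. *)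
Lemma prodn_integral {R : realType} {d} {T : measurableType d} (mu : probability T R) n
    (P : probability (n.-tuple T) R) (g : 'I_n -> T -> \bar R) :
  standard T -> is_prodn (fun _ => mu) P ->
  (forall i x, 0 <= g i x) -> (forall i, measurable_fun setT (g i)) ->
  \int[P]_x (\prod_(i < n) g i (tnth x i)) = \prod_(i < n) \int[mu]_x g i x.
Proof.
move=> sT hP g0 mg; have [P' [hP' P'g]] := prodn_exists mu n sT.
by rewrite (meq_integral _ (is_prodn_unique hP hP')) P'g.
Qed.

Lemma prodn_integral2 {R : realType} {d} {T : measurableType d} (mu nu : probability T R) n
    (P Q : probability (n.-tuple T) R) (g : 'I_n -> T * T -> \bar R) :
  standard T -> is_prodn (fun _ => mu) P -> is_prodn (fun _ => nu) Q ->
  (forall i z, 0 <= g i z) -> (forall i, measurable_fun setT (g i)) ->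
  \int[P]_x \int[Q]_y (\prod_(i < n) g i (tnth x i, tnth y i)) =
  \prod_(i < n) \int[mu]_x \int[nu]_y g i (x, y).
Proof.
move=> sT hP hQ g0 mg.
rewrite -(prodn_integral (g := fun i x => \int[nu]_y g i (x, y)) sT hP); last 2 first.
- by move=> i x; exact: integral_ge0.
- by move=> i; exact: (measurable_fun_fubini_tonelli_F (m2 := nu) _ (mg i) (g0 i)).
apply: eq_integral => x _.
rewrite (prodn_integral (g := fun i y => g i (tnth x i, y)) sT hQ)//.
by move=> i; exact: (measurable_fun_section1 _ (mg i)).
Qed.

Lemma simulation_exists {R : realType} {dS dT} {S : measurableType dS}
    {T : measurableType dT} (pS : probability S R) (mu : probability T R)
    (F : S * T -> R) (L : S * T -> nat) (lM : nat -> R) (kap : R) (v : nat -> R) :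
  standard T ->
  measurable_fun setT F -> (forall z, (0 <= F z)%R) ->
  (forall x, \int[mu]_y (F (x, y))%:E = 1) ->
  measurable_fun setT L -> (forall z, (F z <= expR (lM (L z)))%R) ->
  (0 <= kap)%R -> (forall l, (0 <= lM l + kap)%R) ->
  (forall l, (0 < v l)%R) -> (forall l, (v l <= 1)%R) ->
  \sum_(0 <= l <oo) (v l)%:E <= 1 ->
  exists (lam : probability (real_borel R) R) (enc : nat -> S * real_borel R -> R)
         (dec : nat -> real_borel R -> probability T R),
    [/\ forall z, measurable_fun setT (enc z), forall z xq, (0 <= enc z xq)%R,
        forall xq, \sum_(0 <= z <oo) (enc z xq)%:E = 1 & forall z, markov_kernel (dec z)] /\
    (forall x (h : T -> \bar R), (forall y, 0 <= h y) -> measurable_fun setT h ->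
      \int[lam]_u (\sum_(0 <= z <oo) ((enc z (x, u))%:E * \int[dec z u]_y h y)) =
      \int[mu]_y ((F (x, y))%:E * h y)) /\
    \int[lam]_u (\sum_(0 <= z <oo) negplogp (\int[pS]_x (enc z (x, u))%:E)) + kap%:E <=
      4%:E + \int[pS]_x \int[mu]_y ((F (x, y))%:E *
        (3 * - ln (v (L (x, y))) + lM (L (x, y)) + kap)%:E).
Proof.
move=> sT mF F0 F1 mL FM kap0 lMkap v0 v1 vsum.
have [lam /(_ _ _ mu sT)[V [W [mV mW VW]]]] := uniform_split R.
have mY := measurable_iid_seq mV mW.
have lawY (c h : T -> \bar R) j := @iid_integral_geometric _ _ _ _ _ _ _ mV mW VW c h j.
have [e eP] := @nneseries_pair R.
exists lam, (enc mu (iid_seq V W) F L lM e), (dec (iid_seq V W) e); split; first split.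
- exact: measurable_enc.
- exact: enc_ge0.
- exact: enc_sum.
- exact: markov_dec.
- split; first exact: simulation_law.
  exact: (simulation_entropy pS mY lawY mF F0 F1 mL FM eP kap0 lMkap v0 v1 vsum).
Qed.

(** As - ln v is affine in the level, the cost of describing the level is controlled by its mean.
    The slope [eta] may be as small as desired, at the price of a larger constant [c]. *)
Lemma geometric_weights {R : realType} (eta : R) : (0 < eta)%R ->
  exists (v : nat -> R) (c : R), [/\ (0 <= c)%R, forall l, (0 < v l)%R,
    forall l, (v l <= 1)%R, \sum_(0 <= l <oo) (v l)%:E <= 1 &
    forall l, (- ln (v l) = c + eta * l%:R)%R].
Proof.
move=> eta0; pose a : R := (1 - expR (- eta))%R.
have ee : (0 < expR (- eta) < 1)%R.
  by rewrite expR_gt0 -expR0 ltr_expR oppr_lt0.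
have a0 : (0 < a)%R by case/andP: ee => ? ?; rewrite subr_gt0.
have a1 : (a <= 1)%R by case/andP: ee => ? ?; rewrite gerBl ltW.
have aE : (1 - a = expR (- eta))%R by rewrite opprB addrC subrK.
have e0 l : (0 < expR (- eta) ^+ l)%R by rewrite exprn_gt0 ?expR_gt0.
exists (fun l => a * expR (- eta) ^+ l)%R, (- ln a)%R; split.
- by rewrite oppr_ge0 ln_le0.
- by move=> l; rewrite mulr_gt0.
- move=> l; case/andP: ee => e1 e2; apply: mulr_ile1 => //; try exact: ltW.
  by apply: exprn_ile1; exact: ltW.
- under eq_eseriesr do rewrite EFinM -aE.
  rewrite nneseriesZl; last by move=> l _; rewrite lee_fin aE ltW.
  by rewrite nneseries_geometric// -EFinM divff// gt_eqF.
- move=> l; rewrite lnM ?posrE// lnXn ?expR_gt0// expRK.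
  by rewrite opprD -mulr_natl; ring.
Qed.

Lemma sume_const_ge0 {R : realType} n (x : \bar R) : 0 <= x ->
  \sum_(t < n) x = n%:R%:E * x.
Proof.
move=> x0; elim: n => [|n IH]; first by rewrite big_ord0 mul0e.
by rewrite big_ord_recl IH -natr1 EFinD ge0_muleDl ?lee_fin// mul1e addeC.
Qed.

(** The excess [eps] is spent in four equal parts: e^delta - 1 for the width of the levels, e^(-b)
    for density values below e^(-b), 3 eta K for describing the level, and (4 + 3 c) / n for the
    constants. *)
Lemma achievable_of_kernel {R : realType} {d} {T : measurableType d} (sT : standard T)
    (pX : probability T R) (Delta : T -> T -> R)
    (dX : probability T R -> probability T R -> \bar R)
    (dn : forall n, probability (n.-tuple T) R -> probability (n.-tuple T) R -> \bar R)
    (k : T -> probability T R) (pXh : probability T R) (D P r eps : R) :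
  measurable_fun setT (fun xy : T * T => Delta xy.1 xy.2) ->
  (forall x y, (0 <= Delta x y)%R) ->
  (forall mu nu, 0 <= dX mu nu) ->
  (forall n (P Ph : probability (n.-tuple T) R),
      is_prodn (fun _ => pX) P -> is_prodn (fun _ => pXh) Ph ->
      dn n P Ph = \sum_(t < n) dX pX pXh) ->
  markov_kernel k -> \int[pX]_x \int[k x]_y (Delta x y)%:E <= D%:E ->
  meq pXh (fun B => \int[pX]_x k x B) -> dX pX pXh <= P%:E ->
  mutual_info pX k <= r%:E -> (0 < eps)%R ->
  achievable_cr pX Delta dn D P (r + eps)%R.
Proof.
move=> mDelta Delta0 dX0 A5 hk hD pXhE hP hI eps0.
pose delta : R := ln (1 + eps / 4).
have delta0 : (0 < delta)%R by rewrite ln_gt0// ltrDl divr_gt0.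
pose b : R := ln (1 + 4 / eps).
have b0 : (0 <= b)%R by rewrite ln_ge0// lerDl divr_ge0// ltW.
have ed : (expR delta = 1 + eps / 4)%R by rewrite lnK// posrE addr_gt0// divr_gt0.
have eb : (expR (- b) <= eps / 4)%R.
  have h : (0 < 1 + 4 / eps)%R by rewrite addr_gt0// divr_gt0.
  rewrite expRN lnK ?posrE// -[leRHS]invrK lef_pV2 ?posrE ?invr_gt0 ?divr_gt0//.
  by rewrite invf_div; lra.
have [f [m [[mf f0 f1 fE] [mm fm mK]]]] := mutual_info_density b hk pXhE hI delta0.
pose K : R := ((r - 1 + expR delta + expR (- b) + b) / delta)%R.
rewrite -/K in mK.
have K0 : (0 <= K)%R.
  rewrite -lee_fin; apply: le_trans mK; apply: integral_ge0 => x _.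
  by apply: integral_ge0 => y _; rewrite mule_ge0 ?lee_fin.
have dK : (delta * K - b <= r + eps / 2)%R.
  by rewrite /K mulrC divfK ?gt_eqF// ed; lra.
(* The denominator gives 3 eta K <= eps / 4; the added 1 avoids division by zero when K = 0. *)
pose eta : R := (eps / (12 * (K + 1)))%R.
have eta0 : (0 < eta)%R by rewrite divr_gt0// mulr_gt0// ltr_wpDl.
have etaK : (3 * eta * K <= eps / 4)%R.
  have K1 : (0 < K + 1)%R by lra.
  have -> : (3 * eta * K = eps / 4 * (K / (K + 1)))%R.
    by rewrite /eta; field; rewrite gt_eqF.
  apply: ler_piMr; first by apply: divr_ge0 => //; exact: ltW.
  by rewrite ler_pdivrMr// mul1r; lra.
have [v [c [c0 v0 v1 vsum vln]]] := geometric_weights eta0.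
exists (Num.trunc ((4 + 3 * c) / (eps / 4))).+1 => n Nn pXn pXnE.
have n0 : (0 < n)%N by apply: leq_trans Nn.
have nn0 : (0 <= n%:R^-1 :> R)%R by rewrite invr_ge0.
have nR0 : (0 < n%:R :> R)%R by rewrite ltr0n.
have [mun [munE _]] := prodn_exists pXh n sT.
have mpair t : measurable_fun setT
    (fun xy : n.-tuple T * n.-tuple T => (tnth xy.1 t, tnth xy.2 t)).
  apply/measurable_fun_pairP; split.
    exact: (measurableT_comp (measurable_tnth t) measurable_fst).
  exact: (measurableT_comp (measurable_tnth t) measurable_snd).
pose F (xy : n.-tuple T * n.-tuple T) : R := (\prod_(t < n) f (tnth xy.1 t, tnth xy.2 t))%R.
(* One label for the whole block: the letter bounds multiply, so the labels add, and a single level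
   is drawn and described for all n letters. *)
pose L (xy : n.-tuple T * n.-tuple T) : nat := (\sum_(t < n) m (tnth xy.1 t, tnth xy.2 t))%N.
have mF : measurable_fun setT F.
  by apply: measurable_prod => t _; exact: (measurableT_comp mf (mpair t)).
have F0 xy : (0 <= F xy)%R by rewrite prodr_ge0.
have ef0 z : 0 <= (f z)%:E by rewrite lee_fin.
have mef : measurable_fun setT (fun z => (f z)%:E) by exact/measurable_EFinP.
have F1 x : \int[mun]_y (F (x, y))%:E = 1.
  under eq_integral do rewrite -prodEFin.
  rewrite (prodn_integral (g := fun t y => (f (tnth x t, y))%:E) sT munE)//.
    by rewrite big1.
  by move=> t; exact: (measurable_fun_section1 _ mef).
have mmR : measurable_fun setT (fun z => (m z)%:R : R).
  exact: (measurableT_comp (g := m)).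
have LR xy : (L xy)%:R = (\sum_(t < n) (m (tnth xy.1 t, tnth xy.2 t))%:R)%R :> R.
  by rewrite /L natr_sum.
have mLR : measurable_fun setT (fun xy => (L xy)%:R : R).
  under eq_fun do rewrite LR; apply: measurable_sum => t.
  exact: (measurableT_comp mmR (mpair t)).
have mL : measurable_fun setT L.
  apply: measurable_natP => l; under eq_set do rewrite -(ler_nat R).
  rewrite -[X in measurable X]setTI.
  exact: (measurable_fun_le measurableT mLR (measurable_cst _)).
pose lM (l : nat) : R := (delta * l%:R - n%:R * b)%R.
have FM xy : (F xy <= expR (lM (L xy)))%R.
  have -> : (lM (L xy) = \sum_(t < n) (delta * (m (tnth xy.1 t, tnth xy.2 t))%:R - b))%R.
    by rewrite /lM LR sumrB -mulr_sumr sumr_const card_ord mulr_natl.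
  by rewrite expR_sum; apply: ler_prod => t _; rewrite f0 fm.
(* Cancels the offset of [lM], leaving [delta] times the label. *)
pose kap : R := (n%:R * b)%R.
have kap0 : (0 <= kap)%R by rewrite mulr_ge0.
have lMkap l : (0 <= lM l + kap)%R.
  by rewrite /lM /kap subrK mulr_ge0// ltW.
have [lam [enc [dec [[menc enc0 enc1 hdec] [law ent]]]]] :=
  simulation_exists pXn (standard_tuple n sT) mF F0 F1 mL FM kap0 lMkap v0 v1 vsum.
(* The factors of the other coordinates integrate to 1 by [f1]. *)
have marg2 t (g : T * T -> \bar R) : (forall z, 0 <= g z) -> measurable_fun setT g ->
    \int[pXn]_x \int[mun]_y ((F (x, y))%:E * g (tnth x t, tnth y t)) =
    \int[pX]_x \int[pXh]_y ((f (x, y))%:E * g (x, y)).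
  move=> g0 mg.
  pose h (i : 'I_n) z := (f z)%:E * (if i == t then g z else 1).
  have h0 i z : 0 <= h i z by rewrite mule_ge0//; case: ifP.
  have mh i : measurable_fun setT (h i).
    by apply: emeasurable_funM => //; case: (i == t).
  transitivity (\int[pXn]_x \int[mun]_y (\prod_(i < n) h i (tnth x i, tnth y i))).
    apply: eq_integral => x _; apply: eq_integral => y _.
    rewrite big_split/= -prodEFin; congr (_ * _).
    rewrite (bigD1 t)//= eqxx big1 ?mule1// => i /negPf ->//.
  rewrite (prodn_integral2 sT pXnE munE h0 mh) (bigD1 t)//= big1 ?mule1.
    by apply: eq_integral => x _; apply: eq_integral => y _; rewrite /h eqxx.
  move=> i /negPf it; rewrite -[RHS](probability_integral_cst pX).
  apply: eq_integral => x _; rewrite -(f1 x); apply: eq_integral => y _.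
  by rewrite /h it mule1.
have single t (g : T * T -> \bar R) : (forall z, 0 <= g z) -> measurable_fun setT g ->
    \int[pXn]_x \int[lam]_q \sum_(0 <= z <oo)
      ((enc z (x, q))%:E * \int[dec z q]_y g (tnth x t, tnth y t)) =
    \int[pX]_x \int[pXh]_y ((f (x, y))%:E * g (x, y)).
  move=> g0 mg; rewrite -(marg2 t)//; apply: eq_integral => x _.
  rewrite (law x (fun y => g (tnth x t, tnth y t)))//.
  exact: (measurable_fun_section1 x (measurableT_comp mg (mpair t))).
have eD0 (z : T * T) : 0 <= (Delta z.1 z.2)%:E by rewrite lee_fin.
have meD : measurable_fun setT (fun z : T * T => (Delta z.1 z.2)%:E) by exact/measurable_EFinP.
have avg (x : \bar R) : 0 <= x -> (n%:R^-1)%:E * \sum_(t < n) x = x.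
  by move=> x0; rewrite sume_const_ge0// muleA -EFinM mulVf ?mul1e// gt_eqF.
exists (R^o : pmetricType R); split; first exact: polish_real.
exists lam, enc, dec; split => //; split => //; split => //; split => //.
split; [|split].
- have em0 z : 0 <= (m z)%:R%:E :> \bar R by rewrite lee_fin.
  have mem : measurable_fun setT (fun z => (m z)%:R%:E : \bar R) by exact/measurable_EFinP.
  have eF0 xy : 0 <= (F xy)%:E by rewrite lee_fin.
  have meF : measurable_fun setT (fun xy => (F xy)%:E) by exact/measurable_EFinP.
  have meL : measurable_fun setT (fun xy => (L xy)%:R%:E : \bar R) by exact/measurable_EFinP.
  have FL0 xy : 0 <= (F xy)%:E * (L xy)%:R%:E by rewrite mule_ge0// lee_fin.
  have mFL : measurable_fun setT (fun xy => (F xy)%:E * (L xy)%:R%:E) by exact: emeasurable_funM.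
  pose G t xy := (F xy)%:E * (m (tnth xy.1 t, tnth xy.2 t))%:R%:E.
  have G0 t xy : 0 <= G t xy by rewrite mule_ge0.
  have mG t : measurable_fun setT (G t).
    by apply: emeasurable_funM => //; exact: (measurableT_comp mem (mpair t)).
  have EL : \int[pXn]_x \int[mun]_y ((F (x, y))%:E * (L (x, y))%:R%:E) <= (n%:R * K)%:E.
    have -> : \int[pXn]_x \int[mun]_y ((F (x, y))%:E * (L (x, y))%:R%:E) =
        \int[pXn]_x \int[mun]_y (\sum_(t < n) G t (x, y)).
      apply: eq_integral => x _; apply: eq_integral => y _.
      by rewrite LR -sumEFin ge0_sume_distrr// => t _; rewrite lee_fin.
    under eq_integral => x _.
      rewrite ge0_integral_sum//; last by move=> t; exact: (measurable_fun_section1 x (mG t)).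
      over.
    rewrite ge0_integral_sum//; last 2 first.
    - by move=> t; exact: (measurable_fun_fubini_tonelli_F (m2 := mun) _ (mG t) (G0 t)).
    - by move=> t x _; exact: integral_ge0.
    under eq_bigr do rewrite (marg2 _ (fun z => (m z)%:R%:E) em0 mem).
    rewrite sume_const_ge0; last first.
      by apply: integral_ge0 => x _; apply: integral_ge0 => y _; rewrite mule_ge0.
    by rewrite EFinM; apply: lee_wpmul2l mK; rewrite lee_fin ltW.
  have a0 : (0 <= 3 * eta + delta)%R.
    by move: (ltW eta0) (ltW delta0) => ? ?; apply: addr_ge0 => //; exact: mulr_ge0.
  have c30 : (0 <= 3 * c)%R by rewrite mulr_ge0.
  have EX : \int[pXn]_x \int[mun]_y ((F (x, y))%:E *
        (3 * - ln (v (L (x, y))) + lM (L (x, y)) + kap)%:E) <=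
      (3 * c + (3 * eta + delta) * (n%:R * K))%:E.
    have -> : \int[pXn]_x \int[mun]_y ((F (x, y))%:E *
        (3 * - ln (v (L (x, y))) + lM (L (x, y)) + kap)%:E) =
        \int[pXn]_x ((3 * c)%:E + (3 * eta + delta)%:E *
          \int[mun]_y ((F (x, y))%:E * (L (x, y))%:R%:E)).
      apply: eq_integral => x _.
      have mFx := measurable_fun_section1 x meF.
      have mFLx := measurable_fun_section1 x mFL.
      rewrite -integralZ_ge0//.
      rewrite -[X in X + _]mule1 -(F1 x) -integralZ_ge0// -ge0_integralD//.
      - apply: eq_integral => y _; rewrite vln /lM /kap -!EFinM -EFinD; congr EFin; ring.
      - by move=> y _; rewrite mule_ge0// lee_fin.
      - exact: emeasurable_funM.
      - by move=> y _; rewrite mule_ge0// lee_fin.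
      - exact: emeasurable_funM.
    have mFLi := measurable_fun_fubini_tonelli_F (m2 := mun) _ mFL FL0.
    rewrite ge0_integralD//; last 2 first.
    - by move=> x _; rewrite mule_ge0 ?lee_fin//; exact: integral_ge0.
    - exact: emeasurable_funM.
    rewrite probability_integral_cst integralZ_ge0//; last by move=> x; exact: integral_ge0.
    by rewrite [leRHS]EFinD; apply: leeD2l; rewrite EFinM; apply: lee_wpmul2l EL; rewrite lee_fin.
  have nE : ((4 + 3 * c) / n%:R <= eps / 4)%R.
    have e4 : (0 < eps / 4)%R by rewrite divr_gt0.
    rewrite ler_pdivrMr// -ler_pdivrMl// mulrC ltW//.
    apply: (lt_le_trans (truncnS_gt _)).
    by rewrite ler_nat.
  have := le_trans ent (leeD2l 4%:E EX).
  rewrite -leeBrDr// => Hle.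
  apply: le_trans (lee_wpmul2l _ Hle) _; first by rewrite lee_fin.
  rewrite -!EFinD -EFinM lee_fin /kap.
  have -> : (n%:R^-1 * (4 + (3 * c + (3 * eta + delta) * (n%:R * K)) - n%:R * b) =
    (4 + 3 * c) / n%:R + 3 * eta * K + (delta * K - b))%R.
    by field; rewrite gt_eqF.
  lra.
- under eq_bigr do rewrite (single _ (fun z => (Delta z.1 z.2)%:E) eD0 meD).
  rewrite avg; last first.
    by apply: integral_ge0 => x _; apply: integral_ge0 => y _; rewrite mule_ge0// (eD0 (x, y)).
  by have /= <- := fE _ eD0 meD.
- have [Kn [hKn [KnB Kng]]] := code_kernel lam menc enc0 enc1 hdec.
  have [pXhn [pXhnB pXhng]] := probability_bind pXn hKn.
  exists pXhn; split.
    by move=> B mB; rewrite pXhnB//; apply: eq_integral => x _; rewrite KnB.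
  rewrite (A5 _ _ _ pXnE); first by rewrite avg.
  (* The output law is tested on rectangles: the block density is a product, and each of its factors
     yields the marginal [pXh]. *)
  move=> A mA; have mR := measurable_rect mA.
  have i0 i y : 0 <= (\1_(A i) y)%:E :> \bar R by rewrite lee_fin.
  have mi i : measurable_fun setT (fun y => (\1_(A i) y)%:E : \bar R).
    exact: emeasurable_indic.
  have mi2 i : measurable_fun setT (fun z : T * T => (\1_(A i) z.2)%:E : \bar R).
    exact: (measurableT_comp (mi i) measurable_snd).
  transitivity (\int[pXn]_x \int[mun]_y ((F (x, y))%:E *
      (\1_[set x : n.-tuple T | forall i, A i (tnth x i)] y)%:E)).
    rewrite pXhnB//; apply: eq_integral => x _.
    rewrite -law//; last exact: emeasurable_indic.
    rewrite KnB//; apply: eq_integral => q _; apply: eq_eseriesr => z _.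
    by rewrite integral_indicT.
  pose g (i : 'I_n) (z : T * T) := (f z)%:E * (\1_(A i) z.2)%:E.
  transitivity (\int[pXn]_x \int[mun]_y (\prod_(i < n) g i (tnth x i, tnth y i))).
    apply: eq_integral => x _; apply: eq_integral => y _.
    by rewrite big_split/= -prodEFin prodn_indic.
  rewrite (prodn_integral2 sT pXnE munE)//; last 2 first.
  - by move=> i z; rewrite mule_ge0.
  - by move=> i; exact: emeasurable_funM.
  rewrite -prodEFin; apply: eq_bigr => i _.
  have /= <- := fE (fun z => (\1_(A i) z.2)%:E) (fun z => i0 i z.2) (mi2 i).
  rewrite fineK ?fin_num_measure// pXhE//.
  by apply: eq_integral => x _; rewrite integral_indicT.
Qed.

Theorem theorem9 (R : realType) (X : pmetricType R) (hX : polish X)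
  (pX : probability (borelT X) R)
  (Delta : borelT X -> borelT X -> R)
  (hDm : measurable_fun setT (fun xy : borelT X * borelT X => Delta xy.1 xy.2))
  (hD0 : forall x y, (0 <= Delta x y)%R)
  (hDeq : forall x y, Delta x y = 0%R <-> x = y)
  (dX : probability (borelT X) R -> probability (borelT X) R -> \bar R)
  (dn : forall n, probability (n.-tuple (borelT X)) R ->
                  probability (n.-tuple (borelT X)) R -> \bar R)
  (hdX : is_divergence dX)
  (hdn : forall n, is_divergence (dn n))
  (hd1 : forall (mu nu : probability (borelT X) R)
                (mu1 nu1 : probability (1.-tuple (borelT X)) R),
      is_marg mu1 ord0 mu -> is_marg nu1 ord0 nu -> dn 1%N mu1 nu1 = dX mu nu)
  (A1 : convex_snd dX /\ forall n, convex_snd (dn n))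
  (A4 : forall n (mus : 'I_n -> probability (borelT X) R)
               (P : probability (n.-tuple (borelT X)) R)
               (Ph : probability (n.-tuple (borelT X)) R)
               (muhs : 'I_n -> probability (borelT X) R),
      is_prodn mus P -> (forall t, is_marg Ph t (muhs t)) ->
      \sum_(t < n) dX (mus t) (muhs t) <= dn n P Ph)
  (A5 : forall n (mus nus : 'I_n -> probability (borelT X) R)
               (P Ph : probability (n.-tuple (borelT X)) R),
      is_prodn mus P -> is_prodn nus Ph ->
      dn n P Ph = \sum_(t < n) dX (mus t) (nus t))
  (D P : R) (hD : (0 <= D)%R) (hP : (0 <= P)%R) :
  Rcr pX Delta dn D P = RDP pX Delta dX D P.
Proof.
have sT := polish_standard hX.
have [dX0 _] := hdX.
apply/eqP; rewrite eq_le; apply/andP; split.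
- apply: le_ereal_inf_tmp => _ [k [hk [hDk [pXh [pXhE hPk]]]] <-].
  have := mutual_info_ge0 pX hk.
  (* A kernel with infinite mutual information satisfies the inequality trivially. *)
  case E : (mutual_info pX k) => [r| |]// _; last by rewrite leey.
  apply/lee_addgt0Pr => eps eps0; apply: ereal_inf_lbound.
  exists (r + eps)%R => //.
  apply: (achievable_of_kernel sT hDm hD0 dX0 _ hk hDk pXhE hPk _ eps0); last by rewrite E.
  by move=> n P0 Ph; exact: A5.
- apply: le_ereal_inf_tmp => _ [Rt [N ach] <-].
  (* The converse bound holds at each single positive block length; at N + 1 a code is available. *)
  have [pXn [pXnE prodE]] := prodn_exists pX N.+1 sT.
  have [Q [_ [pQ [enc [dec [menc [enc0 [enc1 [hdec [hR [hDi [pXhn [pXhnE hPe]]]]]]]]]]]]] :=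
    ach N.+1 (leqnSn N) pXn pXnE.
  apply: (RDP_le_rate hDm hD0 hdX A1.1 pXnE prodE menc enc0 enc1 hdec hR hDi pXhnE _ hPe).
  by move=> muhs hm; exact: A4.
Qed.
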